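(* Let $N_1$ and $N_2$ be positive odd integers. Then, as meromorphic functions of $x\in\mathbb{C}$, $$\mathcal C_2(x,(N_1,N_2))=\prod_{k_1=0}^{N_2-1}\prod_{k_2=0}^{N_1-1}\mathcal C_2\left(\frac{x+N_1k_1+N_2k_2}{N_1N_2}\right)^{(-1)^{k_1+k_2}}.$$
   Context: For $\omega_1,\omega_2>0$ and $\mathrm{Re}(x)>0$, let $\zeta_{E,2}(s,x,(\omega_1,\omega_2))=\sum_{m_1,m_2=0}^\infty(-1)^{m_1+m_2}(x+m_1\omega_1+m_2\omega_2)^{-s}$ (principal branch, absolutely convergent for $\mathrm{Re}(s)>2$), continued analytically in $s$ to a function holomorphic at $s=0$. Define $\bar\Gamma_2(x,(\omega_1,\omega_2))=\exp\left(\frac{\partial}{\partial s}\zeta_{E,2}(s,x,(\omega_1,\omega_2))\big|_{s=0}\right)$, extended to a meromorphic function of $x\in\mathbb{C}$, and $$\mathcal C_2(x,(\omega_1,\omega_2))=\frac{\bar\Gamma_2(\omega_1+\omega_2-x,(\omega_1,\omega_2))}{\bar\Gamma_2(x,(\omega_1,\omega_2))},\qquad \mathcal C_2(x)=\mathcal C_2(x,(1,1)).$$ *)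

(* Defs.v *)
From Stdlib Require Import Reals ZArith List ClassicalEpsilon.
From Coquelicot Require Import Coquelicot.
Open Scope R_scope.
Open Scope C_scope.

Definition Cexp (z : C) : C :=
  (exp (Re z) * cos (Im z), exp (Re z) * sin (Im z))%R.

(** The principal logarithm on the right half-plane [0 < Re z], the only
    region where it is used; elsewhere the value is not meaningful. *)
Definition Clog (z : C) : C := (ln (Cmod z), atan (Im z / Re z)).

Definition Cprod (n : nat) (f : nat -> C) : C :=
  fold_right Cmult 1 (map f (seq 0 n)).

Definition Cpowz (z : C) (e : Z) : C :=
  match e with
  | Z0 => 1
  | Zpos p => z ^ Pos.to_nat p
  | Zneg p => / (z ^ Pos.to_nat p)
  end.

(** Iterated sum; for the absolutely convergent series considered here the
    order of summation is immaterial. *)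
Definition is_double_series (a : nat -> nat -> C) (l : C) : Prop :=
  exists r : nat -> C,
    (forall m1, is_series (K := C_AbsRing) (V := C_NormedModule) (a m1) (r m1))
    /\ is_series (K := C_AbsRing) (V := C_NormedModule) r l.

Definition holomorphic_at (f : C -> C) (a : C) : Prop :=
  locally a (fun z => ex_derive (K := C_AbsRing) (V := C_NormedModule) f z).

Definition connected (U : C -> Prop) : Prop :=
  forall A B : C -> Prop, open A -> open B ->
    (forall z, U z -> A z \/ B z) ->
    (forall z, U z -> ~ (A z /\ B z)) ->
    (exists z, U z /\ A z) -> forall z, U z -> A z.

(** A meromorphic function is represented by a total function [C -> C] whose
    values on a closed discrete set (which includes its poles) are irrelevant. *)
Definition meromorphic (f : C -> C) : Prop :=
  forall a : C, exists (n : nat) (g : C -> C),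
    holomorphic_at g a /\ locally' a (fun z => (z - a) ^ n * f z = g z).

Definition eq_meromorphic (f g : C -> C) : Prop :=
  meromorphic f /\ meromorphic g /\
  forall a : C, locally' a (fun z => f z = g z).

Definition zetaE2_term (w1 w2 : R) (x s : C) (m1 m2 : nat) : C :=
  (- (1)) ^ (m1 + m2) *
  Cexp (- s * Clog (x + INR m1 * w1 + INR m2 * w2)).

(** [F] is an analytic continuation, to some domain containing [0], of the
    series defined on [2 < Re s]; intended for [0 < w1], [0 < w2], [0 < Re x]. *)
Definition is_zetaE2 (w1 w2 : R) (x : C) (F : C -> C) : Prop :=
  exists U : C -> Prop,
    open U /\ connected U /\ U 0 /\
    (forall s, 2 < Re s -> U s)%R /\
    (forall s, U s -> holomorphic_at F s) /\
    (forall s, (2 < Re s)%R -> is_double_series (zetaE2_term w1 w2 x s) (F s)).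

Definition zetaE2 (w1 w2 : R) (x : C) : C -> C :=
  epsilon (inhabits (fun _ : C => RtoC 0)) (is_zetaE2 w1 w2 x).

Definition is_Gammabar2 (w1 w2 : R) (G : C -> C) : Prop :=
  meromorphic G /\
  forall x : C, (0 < Re x)%R -> G x = Cexp (C_derive (zetaE2 w1 w2 x) 0).

Definition Gammabar2 (w1 w2 : R) : C -> C :=
  epsilon (inhabits (fun _ : C => RtoC 0)) (is_Gammabar2 w1 w2).

Definition C2 (w1 w2 : R) (x : C) : C :=
  Gammabar2 w1 w2 (w1 + w2 - x) / Gammabar2 w1 w2 x.

(* Main.v *)
(** The terms [(x + m1 + m2)^(-s)] depend on [m1 + m2] only, so on [2 < Re s] the series for
    [zeta_(E,2)(s, x, (1,1))] is the alternating series of [(n+1)(x+n)^(-s)].  Averaging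
    consecutive partial sums [K] times (Euler's transformation) leaves increments that are [K]-th
    differences, of size [n^(1 - Re s - K)]; this continues the series to all [s], gives the value
    [1/4] at [s = 0] for every [x], and shows that [D(x) = d/ds zeta_(E,2)(0, x, (1,1))] is
    holomorphic in [x].  Since [D(x) + 2 D(x+1) + D(x+2) = - log x], the relation
    [G(x) = 1 / (x G(x+1)^2 G(x+2))] extends [G = exp D] meromorphically to the plane.

    For odd [N1], [N2], writing [m1 = N2 n1 + k1] and [m2 = N1 n2 + k2] expresses
    [zeta_(E,2)(s, x, (N1,N2))] through the [(1,1)] function at the points
    [y = (x + N1 k1 + N2 k2)/(N1 N2)], with the factor [(N1 N2)^(-s)].  Its derivative contributes a
    constant independent of [x], which cancels in the quotient defining [C_2]; the reflection
    [k1 -> N2 - 1 - k1], [k2 -> N1 - 1 - k2] turns [x -> N1 + N2 - x] into [y -> 2 - y].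

    The continuations are only characterised by their defining properties, so identity theorems for
    holomorphic and meromorphic functions are needed; they are derived from Goursat's theorem and
    Cauchy's formula on rectangles. *)
Require Import Defs.
From Stdlib Require Import Reals ZArith List Lra Lia ClassicalEpsilon.
From Coquelicot Require Import Coquelicot.
Open Scope R_scope.
Open Scope C_scope.

(** * Complex differentiation in Coquelicot's C *)

(** [zetaE2] and [Gammabar2] are [epsilon] choices, so nothing is known of them until a witness for
    each defining property is built. [ZvN] and [GN] are these witnesses: finite combinations of the
    (1,1) functions, so that one single series is all that has to be continued. Uniqueness then
    carries their properties over. The chosen [zetaE2] lives on an unknown connected domain, but the
    witness is entire, so the two can be compared on that domain. [Gammabar2] is determined only off
    a discrete set, hence every identity is asserted on punctured neighbourhoods. Since [C2] is a
    quotient and exponents may be -1, meromorphy is carried in the form [mnz], which is closed under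
    inversion. [holomorphic_at] provides a derivative but not its continuity, hence Goursat's
    subdivision. Taylor series never appear: Cauchy integrals of f(w)/(w-a)^m give their
    coefficients and remainders at once. Squares replace circles, so that only integrals along
    axis-parallel segments occur. *)

Notation cderiv f z l :=
  (is_derive (K := C_AbsRing) (V := C_NormedModule) (f : C -> C) (z : C) (l : C)).

Definition cdiff (f : C -> C) (z : C) : Prop := exists l : C, cderiv f z l.

(** Stated with [Cmod] because the two uniform structures on [C] have different balls, squares for
    [C_UniformSpace] and discs for the absolute ring; this form is neutral between them. *)
Definition ccont (f : C -> C) (z : C) : Prop :=
  forall eps : R, (0 < eps)%R -> exists d : R, (0 < d)%R /\
    forall w, (Cmod (w - z) < d)%R -> (Cmod (f w - f z) < eps)%R.

Lemma Rabs_le_sqrt2 (x y : R) : (Rabs x <= sqrt (x ^ 2 + y ^ 2))%R.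
Proof.
  rewrite <- sqrt_Rsqr_abs. apply sqrt_le_1_alt. unfold Rsqr. nra.
Qed.

Lemma Re_Im_le_Cmod (z : C) : (Rabs (Re z) <= Cmod z /\ Rabs (Im z) <= Cmod z)%R.
Proof.
  split; unfold Cmod, Re, Im.
  - apply Rabs_le_sqrt2.
  - rewrite Rplus_comm. apply Rabs_le_sqrt2.
Qed.

Lemma Cmod_le_sum (z : C) : (Cmod z <= Rabs (Re z) + Rabs (Im z))%R.
Proof.
  unfold Cmod, Re, Im. destruct z as [x y]; simpl fst; simpl snd.
  apply Rsqr_incr_0_var.
  - rewrite Rsqr_sqrt by nra. unfold Rsqr.
    assert (H1 := Rsqr_abs x). assert (H2 := Rsqr_abs y). unfold Rsqr in *.
    assert (H3 := Rabs_pos x). assert (H4 := Rabs_pos y). nra.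
  - assert (H3 := Rabs_pos x). assert (H4 := Rabs_pos y). lra.
Qed.

Lemma Cmod_minus_sym (z w : C) : Cmod (z - w) = Cmod (w - z).
Proof. rewrite <- Cmod_opp. f_equal. ring. Qed.

Lemma Cmod_triangle_minus (z w : C) : (Cmod (z - w) <= Cmod z + Cmod w)%R.
Proof. unfold Cminus. rewrite <- (Cmod_opp w). apply Cmod_triangle. Qed.

Lemma Cmod_triangle_3 (z w u : C) : (Cmod (z - w) <= Cmod (z - u) + Cmod (u - w))%R.
Proof. replace (z - w) with ((z - u) + (u - w)) by ring. apply Cmod_triangle. Qed.

Lemma Cmod_triangle_rev (z w : C) : (Cmod z - Cmod w <= Cmod (z - w))%R.
Proof.
  assert (H := Cmod_triangle (z - w) w). replace (z - w + w) with z in H by ring. lra.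
Qed.

Lemma Cmod_zero_minus (z : C) : Cmod (z - z) = 0%R.
Proof. replace (z - z) with (RtoC 0) by ring. apply Cmod_0. Qed.

Lemma locally_Cmod (a : C) (P : C -> Prop) :
  locally (T := C_UniformSpace) a P <->
  exists d : R, (0 < d)%R /\ forall w, (Cmod (w - a) < d)%R -> P w.
Proof.
  split.
  - intros [d Hd]. exists d. split; [apply cond_pos|].
    intros w Hw. apply Hd.
    apply (C_NormedModule_mixin_compat1 a w d). exact Hw.
  - intros [d [Hd H]].
    (* A ball of [C_UniformSpace] is a square: the one of radius d/2 lies in the disc of radius sqrt
       2 * d/2 < d. *)
    assert (H2 : (0 < d / 2)%R) by lra.
    exists (mkposreal _ H2). intros w Hw. apply H.
    apply (C_NormedModule_mixin_compat2 a w) in Hw. simpl in Hw.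
    assert (Hs : (sqrt 2 < 2)%R).
    { rewrite <- (sqrt_Rsqr 2) at 2 by lra. apply sqrt_lt_1_alt. unfold Rsqr. lra. }
    change (minus w a) with (w - a) in Hw. nra.
Qed.

Lemma locally_Cmod_AbsRing (a : C) (P : C -> Prop) :
  locally (T := AbsRing_UniformSpace C_AbsRing) a P <->
  exists d : R, (0 < d)%R /\ forall w, (Cmod (w - a) < d)%R -> P w.
Proof. rewrite <- locally_C. apply locally_Cmod. Qed.

Lemma locally'_Cmod (a : C) (P : C -> Prop) :
  locally' (T := C_UniformSpace) a P <->
  exists d : R, (0 < d)%R /\ forall w, (Cmod (w - a) < d)%R -> w <> a -> P w.
Proof. unfold locally', within. rewrite locally_Cmod. tauto. Qed.

Lemma cderiv_eps (f : C -> C) (z l : C) :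
  cderiv f z l <->
  forall eps : R, (0 < eps)%R -> exists d : R, (0 < d)%R /\
    forall w, (Cmod (w - z) < d)%R ->
      (Cmod (f w - f z - l * (w - z)) <= eps * Cmod (w - z))%R.
Proof.
  split.
  - intros [_ H] eps Heps.
    assert (H1 := H z (fun P HP => HP) (mkposreal eps Heps)).
    apply locally_Cmod_AbsRing in H1. destruct H1 as [d [Hd H1]].
    exists d. split; [assumption|]. intros w Hw. specialize (H1 w Hw).
    rewrite (Cmult_comm l). exact H1.
  - intros H. split.
    + apply is_linear_scal_l.
    + intros x Hx eps.
      apply (is_filter_lim_locally_unique (K := C_AbsRing) (V := AbsRing_NormedModule C_AbsRing)) in Hx. subst x.
      apply locally_Cmod_AbsRing.
      destruct (H eps (cond_pos eps)) as [d [Hd H1]].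
      exists d. split; [assumption|]. intros w Hw. specialize (H1 w Hw).
      rewrite (Cmult_comm l) in H1. exact H1.
Qed.

(** Gives access to Coquelicot's product rule, stated over the other normed module on [C]. *)
Lemma cderiv_absring (f : C -> C) (z l : C) :
  cderiv f z l <->
  is_derive (K := C_AbsRing) (V := AbsRing_NormedModule C_AbsRing) f z l.
Proof.
  split; intros [H1 H2]; (split; [destruct H1; split; assumption| exact H2]).
Qed.

Lemma ccont_continuous (f : C -> C) (z : C) :
  ccont f z <->
  continuous (U := AbsRing_UniformSpace C_AbsRing)
    (T := AbsRing_UniformSpace C_AbsRing) f z.
Proof.
  split.
  - intros H P HP. apply locally_Cmod_AbsRing in HP. destruct HP as [e [He HP]].
    apply locally_Cmod_AbsRing. destruct (H e He) as [d [Hd H1]].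
    exists d. split; [assumption|]. auto.
  - intros H eps Heps.
    assert (H1 : locally (T := AbsRing_UniformSpace C_AbsRing) (f z)
                   (fun y => (Cmod (y - f z) < eps)%R)).
    { apply locally_Cmod_AbsRing. exists eps. auto. }
    apply H in H1. apply locally_Cmod_AbsRing in H1. exact H1.
Qed.

Lemma cderiv_ccont (f : C -> C) (z l : C) : cderiv f z l -> ccont f z.
Proof.
  intros H. apply ccont_continuous.
  apply (ex_derive_continuous (K := C_AbsRing) (V := AbsRing_NormedModule C_AbsRing)).
  exists l. apply cderiv_absring. exact H.
Qed.

Lemma cdiff_ccont (f : C -> C) (z : C) : cdiff f z -> ccont f z.
Proof. intros [l H]. exact (cderiv_ccont f z l H). Qed.

Lemma ccont_const (c z : C) : ccont (fun _ => c) z.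
Proof.
  intros eps He. exists 1%R. split; [lra|]. intros. rewrite Cmod_zero_minus. exact He.
Qed.

Lemma ccont_id (z : C) : ccont (fun w => w) z.
Proof. intros eps He. exists eps. auto. Qed.

Lemma ccont_plus (f g : C -> C) (z : C) :
  ccont f z -> ccont g z -> ccont (fun w => f w + g w) z.
Proof.
  rewrite !ccont_continuous. intros Hf Hg.
  exact (continuous_plus (U := AbsRing_UniformSpace C_AbsRing) (V := AbsRing_NormedModule C_AbsRing) f g z Hf Hg).
Qed.

Lemma ccont_opp (f : C -> C) (z : C) : ccont f z -> ccont (fun w => - f w) z.
Proof.
  rewrite !ccont_continuous. intros Hf.
  exact (continuous_opp (U := AbsRing_UniformSpace C_AbsRing) (V := AbsRing_NormedModule C_AbsRing) f z Hf).
Qed.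

Lemma ccont_minus (f g : C -> C) (z : C) :
  ccont f z -> ccont g z -> ccont (fun w => f w - g w) z.
Proof. intros Hf Hg. apply ccont_plus; [|apply ccont_opp]; assumption. Qed.

Lemma ccont_mult (f g : C -> C) (z : C) :
  ccont f z -> ccont g z -> ccont (fun w => f w * g w) z.
Proof.
  rewrite !ccont_continuous. intros Hf Hg.
  exact (continuous_mult (U := AbsRing_UniformSpace C_AbsRing) (K := C_AbsRing) f g z Hf Hg).
Qed.

Lemma ccont_comp (f g : C -> C) (z : C) :
  ccont g z -> ccont f (g z) -> ccont (fun w => f (g w)) z.
Proof.
  rewrite !ccont_continuous. intros Hg Hf. exact (continuous_comp (U := AbsRing_UniformSpace C_AbsRing)
    (V := AbsRing_UniformSpace C_AbsRing) (W := AbsRing_UniformSpace C_AbsRing) g f z Hg Hf).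
Qed.

Lemma ccont_neq_0 (f : C -> C) (z : C) : ccont f z -> f z <> 0 ->
  exists d : R, (0 < d)%R /\ forall w, (Cmod (w - z) < d)%R ->
    (Cmod (f z) / 2 < Cmod (f w))%R /\ f w <> 0.
Proof.
  intros H Hz. assert (H0 : (0 < Cmod (f z))%R) by (apply Cmod_gt_0; exact Hz).
  destruct (H (Cmod (f z) / 2)%R ltac:(lra)) as [d [Hd H1]].
  exists d. split; [assumption|]. intros w Hw. specialize (H1 w Hw).
  assert (H2 := Cmod_triangle_rev (f z) (f w)).
  rewrite Cmod_minus_sym in H2. split; [lra|].
  apply Cmod_gt_0. lra.
Qed.

Lemma Cinv_sub (a b : C) : a <> 0 -> b <> 0 -> / a - / b = (b - a) / (a * b).
Proof. intros. field. auto. Qed.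

Lemma ccont_inv_id (z : C) : z <> 0 -> ccont Cinv z.
Proof.
  intros Hz eps He. assert (H0 : (0 < Cmod z)%R) by (apply Cmod_gt_0; exact Hz).
  exists (Rmin (Cmod z / 2) (eps * (Cmod z * Cmod z / 2))).
  assert (0 < Cmod z * Cmod z)%R by nra.
  split; [apply Rmin_pos; [lra| nra]|].
  intros w Hw.
  assert (Hw1 := Rlt_le_trans _ _ _ Hw (Rmin_l _ _)).
  assert (Hw2 := Rlt_le_trans _ _ _ Hw (Rmin_r _ _)).
  assert (H2 := Cmod_triangle_rev z w). rewrite Cmod_minus_sym in H2.
  assert (Hw0 : w <> 0) by (apply Cmod_gt_0; lra).
  rewrite Cinv_sub by assumption.
  rewrite Cmod_div by (apply Cmult_neq_0; assumption).
  rewrite Cmod_mult, Cmod_minus_sym.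
  apply Rmult_lt_reg_r with (Cmod w * Cmod z)%R; [nra|].
  unfold Rdiv. rewrite Rmult_assoc, Rinv_l by nra.
  assert (H3 : (Cmod z * Cmod z / 2 <= Cmod w * Cmod z)%R) by nra.
  apply (Rmult_le_compat_l eps) in H3; lra.
Qed.

Lemma ccont_inv (f : C -> C) (z : C) :
  ccont f z -> f z <> 0 -> ccont (fun w => / f w) z.
Proof. intros H H0. apply (ccont_comp Cinv f); [assumption | apply ccont_inv_id; assumption]. Qed.

Lemma ccont_div (f g : C -> C) (z : C) :
  ccont f z -> ccont g z -> g z <> 0 -> ccont (fun w => f w / g w) z.
Proof. intros. apply ccont_mult; [assumption | apply ccont_inv; assumption]. Qed.

Lemma ccont_pow (f : C -> C) (n : nat) (z : C) :
  ccont f z -> ccont (fun w => f w ^ n) z.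
Proof.
  intros H. induction n; simpl; [apply ccont_const | apply ccont_mult; assumption].
Qed.

Lemma cderiv_eq (f : C -> C) (z l m : C) : cderiv f z l -> l = m -> cderiv f z m.
Proof. intros H E. rewrite <- E. exact H. Qed.

Lemma cderiv_ext (f g : C -> C) (z l : C) :
  (forall w, f w = g w) -> cderiv f z l -> cderiv g z l.
Proof. intros H. apply is_derive_ext. exact H. Qed.

Lemma cderiv_ext_loc (f g : C -> C) (z l : C) :
  (exists d : R, (0 < d)%R /\ forall w, (Cmod (w - z) < d)%R -> f w = g w) ->
  cderiv f z l -> cderiv g z l.
Proof.
  intros H. apply is_derive_ext_loc. apply locally_Cmod_AbsRing. exact H.
Qed.

Lemma cderiv_const (c z : C) : cderiv (fun _ => c) z 0.
Proof. apply (is_derive_const (K := C_AbsRing) (V := C_NormedModule)). Qed.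

Lemma cderiv_id (z : C) : cderiv (fun w => w) z 1.
Proof. apply cderiv_absring. apply (is_derive_id (K := C_AbsRing)). Qed.

Lemma cderiv_plus (f g : C -> C) (z l m : C) :
  cderiv f z l -> cderiv g z m -> cderiv (fun w => f w + g w) z (l + m).
Proof. apply (is_derive_plus (K := C_AbsRing) (V := C_NormedModule)). Qed.

Lemma cderiv_opp (f : C -> C) (z l : C) :
  cderiv f z l -> cderiv (fun w => - f w) z (- l).
Proof. apply (is_derive_opp (K := C_AbsRing) (V := C_NormedModule)). Qed.

Lemma cderiv_minus (f g : C -> C) (z l m : C) :
  cderiv f z l -> cderiv g z m -> cderiv (fun w => f w - g w) z (l - m).
Proof. apply (is_derive_minus (K := C_AbsRing) (V := C_NormedModule)). Qed.

Lemma cderiv_mult (f g : C -> C) (z l m : C) :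
  cderiv f z l -> cderiv g z m ->
  cderiv (fun w => f w * g w) z (l * g z + f z * m).
Proof.
  rewrite !cderiv_absring. intros Hf Hg.
  apply (is_derive_mult (K := C_AbsRing) f g z l m Hf Hg). exact Cmult_comm.
Qed.

Lemma cderiv_scal (c : C) (f : C -> C) (z l : C) :
  cderiv f z l -> cderiv (fun w => c * f w) z (c * l).
Proof.
  intros H. eapply cderiv_eq; [apply cderiv_mult; [apply cderiv_const| exact H]| cbv beta; ring].
Qed.

Lemma cderiv_comp (f g : C -> C) (z l m : C) :
  cderiv f (g z) l -> cderiv g z m -> cderiv (fun w => f (g w)) z (m * l).
Proof.
  intros Hf Hg. apply cderiv_absring in Hg.
  exact (is_derive_comp (K := C_AbsRing) (V := C_NormedModule) f g z l m Hf Hg).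
Qed.

(** The remainder 1/w - 1/z + (w-z)/z^2 equals -(1/w - 1/z)(w-z)/z, so continuity of the inverse at
    [z] makes it small against w-z. *)
Lemma cderiv_inv_id (z : C) : z <> 0 -> cderiv Cinv z (- / (z * z)).
Proof.
  intros Hz. apply cderiv_eps. intros eps He.
  destruct (ccont_inv_id z Hz (eps * Cmod z)%R) as [d [Hd H]].
  { assert (0 < Cmod z)%R by (apply Cmod_gt_0; exact Hz). nra. }
  destruct (ccont_neq_0 _ z (ccont_id z) Hz) as [e [He' H0]].
  exists (Rmin d e). split; [apply Rmin_pos; assumption|].
  intros w Hw.
  specialize (H w (Rlt_le_trans _ _ _ Hw (Rmin_l _ _))).
  destruct (H0 w (Rlt_le_trans _ _ _ Hw (Rmin_r _ _))) as [_ Hw0].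
  replace (/ w - / z - - / (z * z) * (w - z)) with (- ((/ w - / z) / z * (w - z)))
    by (field; auto).
  rewrite Cmod_opp, Cmod_mult. apply Rmult_le_compat_r; [apply Cmod_ge_0|].
  rewrite Cmod_div by assumption.
  assert (Hz' : (0 < Cmod z)%R) by (apply Cmod_gt_0; exact Hz).
  apply Rmult_le_reg_r with (Cmod z); [assumption|].
  unfold Rdiv. rewrite Rmult_assoc, Rinv_l by lra. lra.
Qed.

Lemma cderiv_inv (f : C -> C) (z l : C) :
  cderiv f z l -> f z <> 0 -> cderiv (fun w => / f w) z (- l / (f z * f z)).
Proof.
  intros H H0. eapply cderiv_eq.
  - apply (cderiv_comp Cinv f); [apply cderiv_inv_id; exact H0 | exact H].
  - field. exact H0.
Qed.

Lemma cderiv_unique (f : C -> C) (z l m : C) : cderiv f z l -> cderiv f z m -> l = m.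
Proof.
  intros H1 H2. rewrite <- (is_C_derive_unique f z l H1). apply is_C_derive_unique.
  exact H2.
Qed.

Lemma cdiff_const (c z : C) : cdiff (fun _ => c) z.
Proof. eexists. apply cderiv_const. Qed.
Lemma cdiff_id (z : C) : cdiff (fun w => w) z.
Proof. eexists. apply cderiv_id. Qed.
Lemma cdiff_plus (f g : C -> C) (z : C) :
  cdiff f z -> cdiff g z -> cdiff (fun w => f w + g w) z.
Proof. intros [l H] [m H']. eexists. apply cderiv_plus; eassumption. Qed.
Lemma cdiff_opp (f : C -> C) (z : C) : cdiff f z -> cdiff (fun w => - f w) z.
Proof. intros [l H]. eexists. apply cderiv_opp; eassumption. Qed.
Lemma cdiff_minus (f g : C -> C) (z : C) :
  cdiff f z -> cdiff g z -> cdiff (fun w => f w - g w) z.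
Proof. intros [l H] [m H']. eexists. apply cderiv_minus; eassumption. Qed.
Lemma cdiff_mult (f g : C -> C) (z : C) :
  cdiff f z -> cdiff g z -> cdiff (fun w => f w * g w) z.
Proof. intros [l H] [m H']. eexists. apply cderiv_mult; eassumption. Qed.
Lemma cdiff_comp (f g : C -> C) (z : C) :
  cdiff f (g z) -> cdiff g z -> cdiff (fun w => f (g w)) z.
Proof. intros [l H] [m H']. eexists. apply cderiv_comp; eassumption. Qed.
Lemma cdiff_inv (f : C -> C) (z : C) :
  cdiff f z -> f z <> 0 -> cdiff (fun w => / f w) z.
Proof. intros [l H] H0. eexists. apply cderiv_inv; eassumption. Qed.
Lemma cdiff_div (f g : C -> C) (z : C) :
  cdiff f z -> cdiff g z -> g z <> 0 -> cdiff (fun w => f w / g w) z.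
Proof. intros. apply cdiff_mult; [|apply cdiff_inv]; assumption. Qed.
Lemma cdiff_pow (f : C -> C) (n : nat) (z : C) :
  cdiff f z -> cdiff (fun w => f w ^ n) z.
Proof.
  intros H. induction n; simpl; [apply cdiff_const | apply cdiff_mult; assumption].
Qed.
Lemma holomorphic_at_Cmod (f : C -> C) (a : C) :
  holomorphic_at f a <->
  exists d : R, (0 < d)%R /\ forall w, (Cmod (w - a) < d)%R -> cdiff f w.
Proof. unfold holomorphic_at. rewrite locally_Cmod. reflexivity. Qed.

Lemma holomorphic_at_cdiff (f : C -> C) (a : C) : holomorphic_at f a -> cdiff f a.
Proof.
  rewrite holomorphic_at_Cmod. intros [d [Hd H]]. apply H. rewrite Cmod_zero_minus.
  exact Hd.
Qed.

Lemma Cmult_minus_distr_l (c x y : C) : c * (x - y) = c * x - c * y.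
Proof. ring. Qed.

(** * Integrals along rectangles *)

Definition CInt (f : R -> C) (a b : R) : C :=
  (RInt (fun t => Re (f t)) a b, RInt (fun t => Im (f t)) a b).

(** Continuity is two-sided even at the ends of the interval; the integrands are restrictions of
    functions continuous at the points of a segment in [C]. *)
Definition pcont (f : R -> C) (a b : R) : Prop :=
  forall t, (a <= t <= b)%R ->
    continuous (fun t => Re (f t)) t /\ continuous (fun t => Im (f t)) t.

Lemma pcont_ex_RInt (f : R -> C) (a b : R) : (a <= b)%R -> pcont f a b ->
  ex_RInt (fun t => Re (f t)) a b /\ ex_RInt (fun t => Im (f t)) a b.
Proof.
  intros Hab H.
  split; apply (ex_RInt_continuous (V := R_CompleteNormedModule));
    rewrite Rmin_left, Rmax_right by assumption; intros t Ht; apply (H t Ht).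
Qed.

Lemma pcont_sub (f : R -> C) (a b a' b' : R) :
  (a <= a')%R -> (b' <= b)%R -> pcont f a b -> pcont f a' b'.
Proof. intros Ha Hb H t Ht. apply H. lra. Qed.

Lemma CInt_plus (f g : R -> C) (a b : R) : (a <= b)%R -> pcont f a b -> pcont g a b ->
  CInt (fun t => f t + g t) a b = CInt f a b + CInt g a b.
Proof.
  intros Hab Hf Hg.
  destruct (pcont_ex_RInt f a b Hab Hf) as [F1 F2].
  destruct (pcont_ex_RInt g a b Hab Hg) as [G1 G2].
  unfold CInt, Cplus; simpl. f_equal.
  - exact (RInt_plus (V := R_CompleteNormedModule) _ _ a b F1 G1).
  - exact (RInt_plus (V := R_CompleteNormedModule) _ _ a b F2 G2).
Qed.

Lemma CInt_scal (k : C) (f : R -> C) (a b : R) : (a <= b)%R -> pcont f a b ->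
  CInt (fun t => k * f t) a b = k * CInt f a b.
Proof.
  intros Hab Hf.
  destruct (pcont_ex_RInt f a b Hab Hf) as [F1 F2].
  unfold CInt, Cmult; simpl. destruct k as [k1 k2]; simpl. f_equal.
  - rewrite (RInt_ext (V := R_CompleteNormedModule) _
       (fun t => minus (scal k1 (Re (f t))) (scal k2 (Im (f t))))) by (intros; reflexivity).
    rewrite (RInt_minus (V := R_CompleteNormedModule)) by (apply (ex_RInt_scal (V := R_NormedModule)); assumption).
    rewrite !(RInt_scal (V := R_CompleteNormedModule)) by assumption. reflexivity.
  - rewrite (RInt_ext (V := R_CompleteNormedModule) _
       (fun t => plus (scal k1 (Im (f t))) (scal k2 (Re (f t))))) by (intros; reflexivity).
    rewrite (RInt_plus (V := R_CompleteNormedModule)) by (apply (ex_RInt_scal (V := R_NormedModule)); assumption).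
    rewrite !(RInt_scal (V := R_CompleteNormedModule)) by assumption. reflexivity.
Qed.

Lemma CInt_ext (f g : R -> C) (a b : R) : (a <= b)%R ->
  (forall t, (a <= t <= b)%R -> f t = g t) -> CInt f a b = CInt g a b.
Proof.
  intros Hab H. unfold CInt. f_equal; apply (RInt_ext (V := R_CompleteNormedModule));
    rewrite Rmin_left, Rmax_right by assumption; intros t Ht; rewrite H; lra || reflexivity.
Qed.

Lemma CInt_Chasles (f : R -> C) (a m b : R) : (a <= m <= b)%R -> pcont f a b ->
  CInt f a b = CInt f a m + CInt f m b.
Proof.
  intros [Ham Hmb] H.
  destruct (pcont_ex_RInt f a m Ham (pcont_sub f a b a m (Rle_refl _) Hmb H)) as [F1 F2].
  destruct (pcont_ex_RInt f m b Hmb (pcont_sub f a b m b Ham (Rle_refl _) H)) as [G1 G2].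
  unfold CInt, Cplus; simpl. f_equal; symmetry;
    apply (RInt_Chasles (V := R_CompleteNormedModule)); assumption.
Qed.

(** The factor 2 comes from bounding real and imaginary part separately; the same loss recurs in all
    the contour estimates. *)
Lemma CInt_bound (f : R -> C) (a b M : R) : (a <= b)%R -> pcont f a b ->
  (forall t, (a <= t <= b)%R -> (Cmod (f t) <= M)%R) ->
  (Cmod (CInt f a b) <= 2 * M * (b - a))%R.
Proof.
  intros Hab Hf HM.
  destruct (pcont_ex_RInt f a b Hab Hf) as [F1 F2].
  eapply Rle_trans; [apply Cmod_le_sum|].
  assert (H1 : (Rabs (RInt (fun t => Re (f t)) a b) <= (b - a) * M)%R).
  { apply abs_RInt_le_const; try assumption. intros t Ht.
    eapply Rle_trans; [apply Re_Im_le_Cmod | apply HM; exact Ht]. }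
  assert (H2 : (Rabs (RInt (fun t => Im (f t)) a b) <= (b - a) * M)%R).
  { apply abs_RInt_le_const; try assumption. intros t Ht.
    eapply Rle_trans; [apply Re_Im_le_Cmod | apply HM; exact Ht]. }
  unfold CInt; simpl. lra.
Qed.

(** The inner map has a real variable and the outer one a complex variable, which [cderiv_comp] does
    not cover; the real difference quotients are compared with l u directly. *)
Lemma cderiv_line (F : C -> C) (p u l : C) (t0 : R) :
  cderiv F (p + t0 * u) l ->
  is_derive (fun t : R => Re (F (p + t * u))) t0 (Re (l * u)) /\
  is_derive (fun t : R => Im (F (p + t * u))) t0 (Im (l * u)).
Proof.
  intros H.
  (* The added 1 keeps the divisions below valid when u = 0. *)
  assert (Hu : (0 < Cmod u + 1)%R) by (assert (H0 := Cmod_ge_0 u); lra).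
  assert (K : forall eps : R, (0 < eps)%R -> exists d : posreal, forall h : R,
     h <> 0%R -> (Rabs h < d)%R ->
     (Cmod ((F (p + (t0 + h)%R * u) - F (p + t0 * u)) / h - l * u)%C < eps)%R).
  { intros eps He.
    rewrite cderiv_eps in H.
    destruct (H (eps / 2 / (Cmod u + 1))%R) as [d [Hd H1]].
    { apply Rdiv_lt_0_compat; lra. }
    assert (Hd' : (0 < d / (Cmod u + 1))%R) by (apply Rdiv_lt_0_compat; lra).
    exists (mkposreal _ Hd'). simpl. intros h Hh0 Hh.
    assert (Hh1 : (0 < Rabs h)%R) by (apply Rabs_pos_lt; exact Hh0).
    assert (E : Cmod (p + (t0 + h)%R * u - (p + t0 * u)) = (Rabs h * Cmod u)%R).
    { rewrite <- Cmod_R, <- Cmod_mult. f_equal. rewrite RtoC_plus. ring. }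
    assert (Hhd : (Rabs h * (Cmod u + 1) < d)%R).
    { apply (Rmult_lt_compat_r (Cmod u + 1)) in Hh; [|assumption].
      unfold Rdiv in Hh. rewrite Rmult_assoc, Rinv_l in Hh by lra. lra. }
    specialize (H1 (p + (t0 + h)%R * u)). rewrite E in H1.
    assert (H2 : (Rabs h * Cmod u < d)%R) by nra. specialize (H1 H2).
    assert (Hc : RtoC h <> 0) by (intros E'; apply RtoC_inj in E'; contradiction).
    replace ((F (p + (t0 + h)%R * u) - F (p + t0 * u)) / h - l * u)
      with ((F (p + (t0 + h)%R * u) - F (p + t0 * u) -
              l * (p + (t0 + h)%R * u - (p + t0 * u))) / h)
      by (rewrite RtoC_plus; field; exact Hc).
    rewrite Cmod_div by exact Hc. rewrite Cmod_R.
    apply Rmult_lt_reg_r with (Rabs h); [assumption|].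
    unfold Rdiv. rewrite Rmult_assoc, Rinv_l by lra. rewrite Rmult_1_r.
    eapply Rle_lt_trans; [exact H1|].
    assert (H3 : (eps / 2 / (Cmod u + 1) * Cmod u <= eps / 2)%R).
    { unfold Rdiv. rewrite Rmult_assoc. rewrite <- (Rmult_1_r (eps * / 2)) at 2.
      apply Rmult_le_compat_l; [lra|].
      apply Rmult_le_reg_l with (Cmod u + 1)%R; [assumption|].
      rewrite <- Rmult_assoc, Rinv_r by lra. lra. }
    nra. }
  split; apply is_derive_Reals; intros eps He; destruct (K eps He) as [d H1];
    exists d; intros h Hh0 Hh; specialize (H1 h Hh0 Hh);
    eapply Rle_lt_trans; [|exact H1| |exact H1].
  - eapply Rle_trans; [|apply (proj1 (Re_Im_le_Cmod _))]. apply Req_le. f_equal.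
    assert (Hc : RtoC h <> 0) by (intros E'; apply RtoC_inj in E'; contradiction).
    unfold Cdiv. rewrite <- RtoC_inv by exact Hh0.
    unfold Re, Im, Rdiv; simpl. ring.
  - eapply Rle_trans; [|apply (proj2 (Re_Im_le_Cmod _))]. apply Req_le. f_equal.
    assert (Hc : RtoC h <> 0) by (intros E'; apply RtoC_inj in E'; contradiction).
    unfold Cdiv. rewrite <- RtoC_inv by exact Hh0.
    unfold Re, Im, Rdiv; simpl. ring.
Qed.

Lemma ccont_line (f : C -> C) (p u : C) (t0 : R) : ccont f (p + t0 * u) ->
  continuous (fun t : R => Re (f (p + t * u))) t0 /\
  continuous (fun t : R => Im (f (p + t * u))) t0.
Proof.
  intros H.
  assert (Hu : (0 < Cmod u + 1)%R) by (assert (H0 := Cmod_ge_0 u); lra).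
  assert (K : forall eps : R, (0 < eps)%R -> exists d : posreal, forall t : R,
     (Rabs (t - t0) < d)%R -> (Cmod (f (p + t * u) - f (p + t0 * u))%C < eps)%R).
  { intros eps He. destruct (H eps He) as [d [Hd H1]].
    assert (Hd' : (0 < d / (Cmod u + 1))%R) by (apply Rdiv_lt_0_compat; lra).
    exists (mkposreal _ Hd'). simpl. intros t Ht. apply H1.
    replace (p + t * u - (p + t0 * u)) with ((t - t0)%R * u)
      by (rewrite RtoC_minus; ring).
    rewrite Cmod_mult, Cmod_R.
    apply (Rmult_lt_compat_r (Cmod u + 1)) in Ht; [|assumption].
    unfold Rdiv in Ht. rewrite Rmult_assoc, Rinv_l in Ht by lra.
    assert (H2 := Rabs_pos (t - t0)). nra. }
  split; intros P [e HP]; destruct (K e (cond_pos e)) as [d H1]; exists d;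
    intros t Ht; apply HP; specialize (H1 t Ht);
    eapply Rle_lt_trans; [|exact H1| |exact H1].
  - eapply Rle_trans; [|apply (proj1 (Re_Im_le_Cmod _))]. apply Req_le. reflexivity.
  - eapply Rle_trans; [|apply (proj2 (Re_Im_le_Cmod _))]. apply Req_le. reflexivity.
Qed.

Lemma horizontal_point (x c : R) : ((x, c) : C) = (0, c) + x * 1.
Proof. unfold Cplus, Cmult, RtoC; simpl. f_equal; ring. Qed.

Lemma vertical_point (a y : R) : ((a, y) : C) = (a, 0) + y * Ci.
Proof. unfold Cplus, Cmult, RtoC, Ci; simpl. f_equal; ring. Qed.

Lemma ccont_pcont_h (f : C -> C) (c a b : R) :
  (forall x, (a <= x <= b)%R -> ccont f (x, c)) -> pcont (fun x => f (x, c)) a b.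
Proof.
  intros H t Ht. specialize (H t Ht). rewrite horizontal_point in H.
  destruct (ccont_line f (0, c) 1 t H) as [H1 H2].
  split; eapply continuous_ext; [| exact H1| | exact H2]; intros x; cbv beta;
    rewrite <- horizontal_point; reflexivity.
Qed.

Lemma ccont_pcont_v (f : C -> C) (a c d : R) :
  (forall y, (c <= y <= d)%R -> ccont f (a, y)) -> pcont (fun y => f (a, y)) c d.
Proof.
  intros H t Ht. specialize (H t Ht). rewrite vertical_point in H.
  destruct (ccont_line f (a, 0) Ci t H) as [H1 H2].
  split; eapply continuous_ext; [| exact H1| | exact H2]; intros x; cbv beta;
    rewrite <- vertical_point; reflexivity.
Qed.

Lemma CInt_FTC (F f : R -> C) (a b : R) : (a <= b)%R -> pcont f a b ->
  (forall t, (a <= t <= b)%R -> is_derive (fun t => Re (F t)) t (Re (f t)) /\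
                               is_derive (fun t => Im (F t)) t (Im (f t))) ->
  CInt f a b = F b - F a.
Proof.
  intros Hab Hf H. unfold CInt.
  rewrite (is_RInt_unique (V := R_CompleteNormedModule) _ a b (minus (Re (F b)) (Re (F a)))).
  rewrite (is_RInt_unique (V := R_CompleteNormedModule) _ a b (minus (Im (F b)) (Im (F a)))).
  reflexivity.
  - apply (is_RInt_derive (V := R_CompleteNormedModule) (fun t => Im (F t)) (fun t => Im (f t)));
    rewrite Rmin_left, Rmax_right by assumption; intros t Ht; [apply H | apply Hf]; exact Ht.
  - apply (is_RInt_derive (V := R_CompleteNormedModule) (fun t => Re (F t)) (fun t => Re (f t)));
    rewrite Rmin_left, Rmax_right by assumption; intros t Ht; [apply H | apply Hf]; exact Ht.
Qed.

(** The counterclockwise integral of f dz around the boundary of [a,b] x [c,d]: dz is dx on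
    horizontal sides and i dy on vertical ones. *)
Definition RI (f : C -> C) (a b c d : R) : C :=
  CInt (fun x => f (x, c)) a b - CInt (fun x => f (x, d)) a b
  + Ci * (CInt (fun y => f (b, y)) c d - CInt (fun y => f (a, y)) c d).

Definition on_bdry (a b c d : R) (z : C) : Prop :=
  ((a <= Re z <= b /\ (Im z = c \/ Im z = d)) \/
   ((Re z = a \/ Re z = b) /\ c <= Im z <= d))%R.

Definition in_rect (a b c d : R) (z : C) : Prop :=
  (a <= Re z <= b /\ c <= Im z <= d)%R.

Lemma on_bdry_in_rect (a b c d : R) (z : C) : (a <= b)%R -> (c <= d)%R ->
  on_bdry a b c d z -> in_rect a b c d z.
Proof. unfold on_bdry, in_rect. intros. lra. Qed.

Lemma bdry_pcont (f : C -> C) (a b c d : R) : 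
  (forall z, on_bdry a b c d z -> ccont f z) ->
  pcont (fun x => f (x, c)) a b /\ pcont (fun x => f (x, d)) a b /\
  pcont (fun y => f (b, y)) c d /\ pcont (fun y => f (a, y)) c d.
Proof.
  intros H.
  split; [apply ccont_pcont_h with (f := f)|split; [apply ccont_pcont_h with (f := f)|
    split; apply ccont_pcont_v with (f := f)]];
  intros t Ht; apply H; unfold on_bdry; simpl; auto.
Qed.

Lemma RI_plus (a b c d : R) (Hab : (a <= b)%R) (Hcd : (c <= d)%R)
  (f g : C -> C) :
  (forall z, on_bdry a b c d z -> ccont f z) ->
  (forall z, on_bdry a b c d z -> ccont g z) ->
  RI (fun w => f w + g w) a b c d = RI f a b c d + RI g a b c d.
Proof.
  intros Hf Hg. destruct (bdry_pcont _ _ _ _ _ Hf) as [F1 [F2 [F3 F4]]].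
  destruct (bdry_pcont _ _ _ _ _ Hg) as [G1 [G2 [G3 G4]]].
  unfold RI.
  rewrite (CInt_plus (fun x => f (x, c)) (fun x => g (x, c))) by assumption.
  rewrite (CInt_plus (fun x => f (x, d)) (fun x => g (x, d))) by assumption.
  rewrite (CInt_plus (fun x => f (a, x)) (fun x => g (a, x))) by assumption.
  rewrite (CInt_plus (fun x => f (b, x)) (fun x => g (b, x))) by assumption.
  ring.
Qed.

Lemma RI_scal (a b c d : R) (Hab : (a <= b)%R) (Hcd : (c <= d)%R)
  (k : C) (f : C -> C) :
  (forall z, on_bdry a b c d z -> ccont f z) ->
  RI (fun w => k * f w) a b c d = k * RI f a b c d.
Proof.
  intros Hf. destruct (bdry_pcont _ _ _ _ _ Hf) as [F1 [F2 [F3 F4]]].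
  unfold RI.
  rewrite (CInt_scal k (fun x => f (x, c))) by assumption.
  rewrite (CInt_scal k (fun x => f (x, d))) by assumption.
  rewrite (CInt_scal k (fun x => f (a, x))) by assumption.
  rewrite (CInt_scal k (fun x => f (b, x))) by assumption.
  ring.
Qed.

Lemma RI_ext (a b c d : R) (Hab : (a <= b)%R) (Hcd : (c <= d)%R)
  (f g : C -> C) :
  (forall z, on_bdry a b c d z -> f z = g z) -> RI f a b c d = RI g a b c d.
Proof.
  intros H. unfold RI.
  rewrite (CInt_ext (fun x => f (x, c)) (fun x => g (x, c)) a b).
  rewrite (CInt_ext (fun x => f (x, d)) (fun x => g (x, d)) a b).
  rewrite (CInt_ext (fun x => f (a, x)) (fun x => g (a, x)) c d).
  rewrite (CInt_ext (fun x => f (b, x)) (fun x => g (b, x)) c d).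
  reflexivity.
  all: try assumption; intros; apply H; unfold on_bdry; simpl; auto.
Qed.

Lemma RI_minus (a b c d : R) (Hab : (a <= b)%R) (Hcd : (c <= d)%R)
  (f g : C -> C) :
  (forall z, on_bdry a b c d z -> ccont f z) ->
  (forall z, on_bdry a b c d z -> ccont g z) ->
  RI (fun w => f w - g w) a b c d = RI f a b c d - RI g a b c d.
Proof.
  intros Hf Hg.
  rewrite (RI_ext a b c d Hab Hcd _ (fun w => f w + (- (1)) * g w)) by (intros; ring).
  rewrite (RI_plus a b c d Hab Hcd f (fun w => (- (1)) * g w)), RI_scal; try assumption.
  - ring.
  - intros z Hz. apply ccont_mult; [apply ccont_const | apply Hg; exact Hz].
Qed.

Lemma RI_bound (a b c d : R) (Hab : (a <= b)%R) (Hcd : (c <= d)%R)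
  (f : C -> C) (M : R) :
  (forall z, on_bdry a b c d z -> ccont f z) ->
  (forall z, on_bdry a b c d z -> (Cmod (f z) <= M)%R) ->
  (Cmod (RI f a b c d) <= 4 * M * ((b - a) + (d - c)))%R.
Proof.
  intros Hf HM. destruct (bdry_pcont _ _ _ _ _ Hf) as [F1 [F2 [F3 F4]]].
  unfold RI.
  assert (H1 : (Cmod (CInt (fun x => f (x, c)) a b) <= 2 * M * (b - a))%R)
    by (apply CInt_bound; try assumption; intros; apply HM; unfold on_bdry; simpl; auto).
  assert (H2 : (Cmod (CInt (fun x => f (x, d)) a b) <= 2 * M * (b - a))%R)
    by (apply CInt_bound; try assumption; intros; apply HM; unfold on_bdry; simpl; auto).
  assert (H3 : (Cmod (CInt (fun x => f (a, x)) c d) <= 2 * M * (d - c))%R)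
    by (apply CInt_bound; try assumption; intros; apply HM; unfold on_bdry; simpl; auto).
  assert (H4 : (Cmod (CInt (fun x => f (b, x)) c d) <= 2 * M * (d - c))%R)
    by (apply CInt_bound; try assumption; intros; apply HM; unfold on_bdry; simpl; auto).
  eapply Rle_trans; [apply Cmod_triangle|]. rewrite Cmod_mult, Cmod_Ci.
  assert (H5 := Cmod_triangle_minus (CInt (fun x => f (x, c)) a b) (CInt (fun x => f (x, d)) a b)).
  assert (H6 := Cmod_triangle_minus (CInt (fun x => f (b, x)) c d) (CInt (fun x => f (a, x)) c d)).
  lra.
Qed.

(** On each side the integral is the increment of [F] between two corners, and the four increments
    cancel around the rectangle. *)
Lemma RI_primitive (a b c d : R) (Hab : (a <= b)%R) (Hcd : (c <= d)%R)
  (F f : C -> C) :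
  (forall z, on_bdry a b c d z -> ccont f z) ->
  (forall z, on_bdry a b c d z -> cderiv F z (f z)) ->
  RI f a b c d = 0.
Proof.
  intros Hf HF. destruct (bdry_pcont _ _ _ _ _ Hf) as [F1 [F2 [F3 F4]]].
  assert (KH : forall e, (forall t, (a <= t <= b)%R -> on_bdry a b c d (t, e)) ->
     pcont (fun x => f (x, e)) a b ->
     CInt (fun x => f (x, e)) a b = F (b, e) - F (a, e)).
  { intros e He Hp. apply (CInt_FTC (fun x => F (x, e))); try assumption.
    intros t Ht. specialize (HF _ (He t Ht)).
    rewrite (horizontal_point t e) in HF at 1.
    destruct (cderiv_line _ _ _ _ _ HF) as [D1 D2]. rewrite Cmult_1_r in D1, D2.
    split; eapply is_derive_ext; [| exact D1| | exact D2]; intros x; cbv beta;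
      rewrite <- horizontal_point; reflexivity. }
  assert (KV : forall e, (forall t, (c <= t <= d)%R -> on_bdry a b c d (e, t)) ->
     pcont (fun x => f (e, x)) c d ->
     Ci * CInt (fun x => f (e, x)) c d = F (e, d) - F (e, c)).
  { intros e He Hp. rewrite <- CInt_scal by assumption.
    apply (CInt_FTC (fun x => F (e, x))); try assumption.
    - apply ccont_pcont_v with (f := fun w => Ci * f w).
      intros y Hy. apply ccont_mult; [apply ccont_const|]. apply Hf. auto.
    - intros t Ht. specialize (HF _ (He t Ht)).
      rewrite (vertical_point e t) in HF at 1.
      destruct (cderiv_line _ _ _ _ _ HF) as [D1 D2]. rewrite Cmult_comm in D1, D2.
      split; eapply is_derive_ext; [| exact D1| | exact D2]; intros x; cbv beta;
        rewrite <- vertical_point; reflexivity. }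
  unfold RI.
  replace (Ci * (CInt (fun y => f (b, y)) c d - CInt (fun y => f (a, y)) c d)) 
    with (Ci * CInt (fun y => f (b, y)) c d - Ci * CInt (fun y => f (a, y)) c d) by ring.
  rewrite !KH, !KV; try assumption; try (intros; unfold on_bdry; simpl; auto).
  ring.
Qed.
Lemma RI_split_v (f : C -> C) (a m b c d : R) : (a <= m <= b)%R ->
  pcont (fun x => f (x, c)) a b -> pcont (fun x => f (x, d)) a b ->
  RI f a b c d = RI f a m c d + RI f m b c d.
Proof.
  intros Hm H1 H2. unfold RI.
  rewrite (CInt_Chasles (fun x => f (x, c)) a m b) by assumption.
  rewrite (CInt_Chasles (fun x => f (x, d)) a m b) by assumption. ring.
Qed.

Lemma RI_split_h (f : C -> C) (a b c m d : R) : (c <= m <= d)%R ->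
  pcont (fun y => f (a, y)) c d -> pcont (fun y => f (b, y)) c d ->
  RI f a b c d = RI f a b c m + RI f a b m d.
Proof.
  intros Hm H1 H2. unfold RI.
  rewrite (CInt_Chasles (fun y => f (a, y)) c m d) by assumption.
  rewrite (CInt_Chasles (fun y => f (b, y)) c m d) by assumption. ring.
Qed.

(** * Goursat's theorem and Cauchy's formula *)

Lemma nested_intervals (A B : nat -> R) :
  (forall n, (A n <= A (S n))%R) -> (forall n, (B (S n) <= B n)%R) ->
  (forall n, (A n <= B n)%R) -> exists x, forall n, (A n <= x <= B n)%R.
Proof.
  intros HA HB HAB.
  assert (HA' : forall n k, (A n <= A (n + k)%nat)%R).
  { intros n k. induction k; [rewrite Nat.add_0_r; lra|].
    rewrite Nat.add_succ_r. eapply Rle_trans; [exact IHk| apply HA]. }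
  assert (HB' : forall n k, (B (n + k)%nat <= B n)%R).
  { intros n k. induction k; [rewrite Nat.add_0_r; lra|].
    rewrite Nat.add_succ_r. eapply Rle_trans; [apply HB | exact IHk]. }
  assert (H : forall n m, (A n <= B m)%R).
  { intros n m. eapply Rle_trans; [apply (HA' n m)|].
    eapply Rle_trans; [apply HAB|]. rewrite Nat.add_comm. apply HB'. }
  destruct (completeness (fun x => exists n, x = A n)) as [x [Hx1 Hx2]].
  - exists (B 0%nat). intros y [n ->]. apply H.
  - exists (A 0%nat), 0%nat. reflexivity.
  - exists x. intros n. split.
    + apply Hx1. exists n. reflexivity.
    + apply Hx2. intros y [m ->]. apply H.
Qed.

Lemma le_of_le_eps (x L : R) : (0 <= L)%R ->
  (forall eps : R, (0 < eps)%R -> (x <= eps * L)%R) -> (x <= 0)%R.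
Proof.
  intros HL H. apply Rnot_lt_le. intros Hx.
  assert (H1 : (0 < x / (2 * (L + 1)))%R) by (apply Rdiv_lt_0_compat; lra).
  specialize (H _ H1).
  assert (H2 : (x / (2 * (L + 1)) * (2 * (L + 1)) = x)%R) by (field; lra).
  nra.
Qed.

Lemma Cmod_le_0 (z : C) : (Cmod z <= 0)%R -> z = 0.
Proof. intros H. apply Cmod_eq_0. assert (H1 := Cmod_ge_0 z). lra. Qed.

Lemma RI_quarter (f : C -> C) (a b c d : R) : (a <= b)%R -> (c <= d)%R ->
  (forall z, in_rect a b c d z -> cdiff f z) ->
  let x := ((a + b) / 2)%R in let y := ((c + d) / 2)%R in
  RI f a b c d = RI f a x c y + RI f a x y d + (RI f x b c y + RI f x b y d).
Proof.
  intros Hab Hcd Hf x y.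
  assert (Hx : (a <= x <= b)%R) by (unfold x; lra).
  assert (Hy : (c <= y <= d)%R) by (unfold y; lra).
  rewrite (RI_split_v f a x b c d Hx).
  rewrite (RI_split_h f a x c y d Hy), (RI_split_h f x b c y d Hy). reflexivity.
  1, 2, 3, 4: apply ccont_pcont_v.
  5, 6: apply ccont_pcont_h.
  all: intros t Ht; apply cdiff_ccont, Hf; unfold in_rect; simpl; lra.
Qed.

(** Some quarter of a rectangle carries at least a quarter of the integral. After n steps the
    integral is at least 4^(-n) times the initial one, in modulus, while differentiability at the
    common point [p] bounds it by 4 eps (L/2^n)^2; the powers of 2 cancel and eps is arbitrary. *)
Theorem Goursat (f : C -> C) (a b c d : R) : (a <= b)%R -> (c <= d)%R ->
  (forall z, in_rect a b c d z -> cdiff f z) -> RI f a b c d = 0.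
Proof.
  intros Hab Hcd Hf.
  set (valid := fun q : (R * R) * (R * R) =>
     (fst (fst q) <= snd (fst q) /\ fst (snd q) <= snd (snd q))%R /\
     forall z, in_rect (fst (fst q)) (snd (fst q)) (fst (snd q)) (snd (snd q)) z -> cdiff f z).
  set (J := fun q : (R * R) * (R * R) =>
     Cmod (RI f (fst (fst q)) (snd (fst q)) (fst (snd q)) (snd (snd q)))).
  set (P := fun q q' : (R * R) * (R * R) =>
     (fst (fst q) <= fst (fst q') /\ snd (fst q') <= snd (fst q) /\
      fst (snd q) <= fst (snd q') /\ snd (snd q') <= snd (snd q) /\
      snd (fst q') - fst (fst q') = (snd (fst q) - fst (fst q)) / 2 /\
      snd (snd q') - fst (snd q') = (snd (snd q) - fst (snd q)) / 2 /\
      J q <= 4 * J q')%R).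
  assert (Hstep : forall q, valid q -> exists q', P q q').
  { intros [[a' b'] [c' d']] [[H1 H2] H3]. simpl in *.
    assert (HQ := RI_quarter f a' b' c' d' H1 H2 H3). cbv zeta in HQ.
    set (x := ((a' + b') / 2)%R) in *. set (y := ((c' + d') / 2)%R) in *.
    assert (HT : (Cmod (RI f a' b' c' d') <=
       Cmod (RI f a' x c' y) + Cmod (RI f a' x y d') +
       (Cmod (RI f x b' c' y) + Cmod (RI f x b' y d')))%R).
    { rewrite HQ. eapply Rle_trans; [apply Cmod_triangle|].
      apply Rplus_le_compat; apply Cmod_triangle. }
    set (m := Cmod (RI f a' b' c' d')) in *.
    destruct (Rle_dec m (4 * Cmod (RI f a' x c' y))) as [L1|L1];
      [exists ((a', x), (c', y)); unfold P, J; simpl; unfold x, y in *; fold m; lra|].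
    destruct (Rle_dec m (4 * Cmod (RI f a' x y d'))) as [L2|L2];
      [exists ((a', x), (y, d')); unfold P, J; simpl; unfold x, y in *; fold m; lra|].
    destruct (Rle_dec m (4 * Cmod (RI f x b' c' y))) as [L3|L3];
      [exists ((x, b'), (c', y)); unfold P, J; simpl; unfold x, y in *; fold m; lra|].
    exists ((x, b'), (y, d')); unfold P, J; simpl; unfold x, y in *; fold m; lra. }
  set (q0 := ((a, b), (c, d)) : (R * R) * (R * R)).
  (* The existence of a good quarter is only a proposition, so the sequence selects one by
     [epsilon]. *)
  set (Q := fix Q n := match n with O => q0 | S n => epsilon (inhabits q0) (P (Q n)) end).
  assert (HV : forall n, valid (Q n) /\ P (Q n) (Q (S n))).
  { assert (HPQ : forall n, valid (Q n) -> P (Q n) (Q (S n))).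
    { intros n Hn. simpl. apply epsilon_spec. apply Hstep. exact Hn. }
    intros n. enough (valid (Q n)) by auto.
    induction n.
    - split; simpl; auto.
    - assert (HP := HPQ n IHn). destruct IHn as [[V1 V2] V3].
      unfold P in HP. split; [lra|].
      intros z Hz. apply V3. unfold in_rect in *. lra. }
  set (L := ((b - a) + (d - c))%R).
  assert (HS : forall n, (snd (fst (Q n)) - fst (fst (Q n)) = (b - a) / 2 ^ n /\
      snd (snd (Q n)) - fst (snd (Q n)) = (d - c) / 2 ^ n /\ J q0 <= 4 ^ n * J (Q n))%R).
  { induction n.
    - simpl. lra.
    - destruct (HV n) as [_ HP]. unfold P in HP.
      destruct IHn as [I1 [I2 I3]]. destruct HP as [_ [_ [_ [_ [P1 [P2 P3]]]]]].
      assert (H2 : (2 ^ n <> 0)%R) by (apply pow_nonzero; lra).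
      rewrite P1, P2, I1, I2. 
      split; [simpl; field; exact H2|]. split; [simpl; field; exact H2|].
      eapply Rle_trans; [exact I3|]. rewrite <- tech_pow_Rmult.
      assert (0 < 4 ^ n)%R by (apply pow_lt; lra). nra. }
  destruct (nested_intervals (fun n => fst (fst (Q n))) (fun n => snd (fst (Q n)))) as [px Hpx].
  { intros n. destruct (HV n) as [_ HP]. apply HP. }
  { intros n. destruct (HV n) as [_ HP]. apply HP. }
  { intros n. destruct (HV n) as [[HP _] _]. apply HP. }
  destruct (nested_intervals (fun n => fst (snd (Q n))) (fun n => snd (snd (Q n)))) as [py Hpy].
  { intros n. destruct (HV n) as [_ HP]. apply HP. }
  { intros n. destruct (HV n) as [_ HP]. apply HP. }
  { intros n. destruct (HV n) as [[HP _] _]. apply HP. }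
  set (p := (px, py) : C).
  assert (HL : (0 <= L)%R) by (unfold L; lra).
  destruct (Hf p) as [l Hl].
  { assert (X := Hpx 0%nat). assert (Y := Hpy 0%nat). simpl in X, Y.
    unfold in_rect; simpl. lra. }
  apply Cmod_le_0. change (J q0 <= 0)%R.
  apply le_of_le_eps with (L := (4 * (L * L))%R); [nra|].
  intros eps He. rewrite cderiv_eps in Hl. destruct (Hl eps He) as [dl [Hdl H]].
  assert (HN : exists n, (L / 2 ^ n < dl)%R).
  { assert (HA : exists n, (L < INR n * dl)%R).
    { destruct (archimed (L / dl)) as [Ha _].
      assert (H0 : (0 <= L / dl)%R) by (apply Rdiv_le_0_compat; lra).
      exists (Z.to_nat (up (L / dl))). rewrite INR_IZR_INZ, Z2Nat.id.
      - apply (Rmult_lt_compat_r dl) in Ha; [|exact Hdl].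
        unfold Rdiv in Ha. rewrite Rmult_assoc, Rinv_l in Ha by lra. lra.
      - apply le_IZR. lra. }
    destruct HA as [n Hn]. exists n.
    assert (H2 : (INR n <= 2 ^ n)%R).
    { clear. induction n; [simpl; lra|]. rewrite S_INR. simpl.
      assert (1 <= 2 ^ n)%R by (apply pow_R1_Rle; lra). lra. }
    assert (H3 : (0 < 2 ^ n)%R) by (apply pow_lt; lra).
    apply Rmult_lt_reg_r with (2 ^ n)%R; [exact H3|].
    unfold Rdiv. rewrite Rmult_assoc, Rinv_l by lra. nra. }
  destruct HN as [n Hn].
  destruct (HS n) as [S1 [S2 S3]]. destruct (HV n) as [[[V1 V2] V3] _].
  assert (X := Hpx n). assert (Y := Hpy n). cbv beta in X, Y.
  unfold J in S3 at 2.
  destruct (Q n) as [[a' b'] [c' d']]. simpl in S1, S2, S3, V1, V2, V3, X, Y.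
  assert (H2 : (0 < 2 ^ n)%R) by (apply pow_lt; lra).
  assert (HLn : ((b' - a') + (d' - c') = L / 2 ^ n)%R)
    by (rewrite S1, S2; unfold L; field; lra).
  assert (Hdist : forall z, on_bdry a' b' c' d' z -> (Cmod (z - p) <= L / 2 ^ n)%R).
  { intros z Hz. apply on_bdry_in_rect in Hz; try assumption. unfold in_rect in Hz.
    eapply Rle_trans; [apply Cmod_le_sum|].
    rewrite <- HLn. apply Rplus_le_compat; unfold p, Re, Im in *; simpl in *; apply Rabs_le; lra. }
  set (A := fun w => f p + l * (w - p)).
  assert (CA : forall z, ccont A z).
  { intros z. unfold A. apply ccont_plus; [apply ccont_const|]. apply ccont_mult; [apply ccont_const|].
    apply ccont_minus; [apply ccont_id| apply ccont_const]. }
  assert (Cf : forall z, on_bdry a' b' c' d' z -> ccont f z).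
  { intros z Hz. apply on_bdry_in_rect in Hz; try assumption. apply cdiff_ccont, V3. exact Hz. }
  (* The affine part [A] of [f] at [p] has a quadratic primitive, so subtracting it leaves the
     integral unchanged and only the eps-small remainder is left to bound. *)
  assert (E : RI f a' b' c' d' = RI (fun w => f w - A w) a' b' c' d').
  { rewrite (RI_minus a' b' c' d' V1 V2 f A); [|assumption| intros; apply CA].
    rewrite (RI_primitive a' b' c' d' V1 V2
       (fun w => (f p - l * p) * w + l / 2 * (w * w)) A).
    - ring.
    - intros; apply CA.
    - intros z _. eapply cderiv_eq.
      + apply cderiv_plus; apply cderiv_scal; [apply cderiv_id|].
        apply cderiv_mult; apply cderiv_id.
      + unfold A. field. }
  assert (B : (Cmod (RI f a' b' c' d') <= 4 * (eps * (L / 2 ^ n)) * (L / 2 ^ n))%R).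
  { rewrite E.
    replace (4 * (eps * (L / 2 ^ n)) * (L / 2 ^ n))%R
      with (4 * (eps * (L / 2 ^ n)) * ((b' - a') + (d' - c')))%R by (rewrite HLn; ring).
    apply RI_bound; try assumption.
    - intros z Hz. apply ccont_minus; auto.
    - intros z Hz. assert (D := Hdist z Hz).
      replace (f z - A z) with (f z - f p - l * (z - p)) by (unfold A; ring).
      eapply Rle_trans; [apply H; lra|]. apply Rmult_le_compat_l; lra. }
  eapply Rle_trans; [exact S3|].
  apply Rle_trans with (4 ^ n * (4 * (eps * (L / 2 ^ n)) * (L / 2 ^ n)))%R.
  - apply Rmult_le_compat_l; [apply pow_le; lra | exact B].
  - replace (4 ^ n)%R with (2 ^ n * 2 ^ n)%R.
    + apply Req_le. field. lra.
    + rewrite <- Rpow_mult_distr. replace (2 * 2)%R with 4%R by lra. reflexivity.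
Qed.

Lemma Cminus_neq_0 (w z : C) : w <> z -> w - z <> 0.
Proof.
  intros H E. apply H. apply Ceq_minus. exact E.
Qed.

(** On a square centred at [z], opposite sides combine to the kernel 2h/(t^2 + h^2), up to a factor
    i. Its primitive 2 atan(t/h) runs from -PI/2 to PI/2 on [-h,h], so each pair of sides
    contributes i PI. *)
Lemma RI_kernel_square (z : C) (h : R) : (0 < h)%R ->
  RI (fun w => / (w - z)) (Re z - h) (Re z + h) (Im z - h) (Im z + h)
  = (0, 2 * PI)%R.
Proof.
  intros Hh. destruct z as [x y]. simpl Re. simpl Im.
  set (z := (x, y) : C).
  assert (Hc : forall w, on_bdry (x - h) (x + h) (y - h) (y + h) w ->
                 ccont (fun w => / (w - z)) w).
  { intros w Hw. apply ccont_inv.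
    - apply ccont_minus; [apply ccont_id | apply ccont_const].
    - apply Cminus_neq_0. intros E. subst w. unfold on_bdry, z in Hw. simpl in Hw. lra. }
  destruct (bdry_pcont _ _ _ _ _ Hc) as [F1 [F2 [F3 F4]]].
  assert (KI : forall u, RInt (fun t => (2 * h / ((t - u) * (t - u) + h * h))%R) (u - h) (u + h) = PI).
  { intros u. apply is_RInt_unique.
    set (F := fun t : R => (2 * atan ((t - u) / h))%R).
    replace PI with (minus (F (u + h)%R) (F (u - h)%R)).
    - apply (is_RInt_derive (V := R_CompleteNormedModule)).
      + intros t _. unfold F. auto_derive; [trivial|]. field. assert (0 <= (t - u) * (t - u))%R by apply Rle_0_sqr. split; nra.
      + intros t _. apply (ex_derive_continuous (K := R_AbsRing) (V := R_NormedModule)).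
        auto_derive. assert (0 <= (t - u) * (t - u))%R by apply Rle_0_sqr. nra.
    - unfold F. replace ((u + h - u) / h)%R with 1%R by (field; lra).
      replace ((u - h - u) / h)%R with (- (1))%R by (field; lra).
      rewrite atan_opp, atan_1. unfold minus, plus, opp; simpl. field. }
  assert (M : forall (f g : R -> C) a b, (a <= b)%R -> pcont f a b -> pcont g a b ->
      CInt f a b - CInt g a b = CInt (fun t => f t - g t) a b).
  { intros f g a b Hab Hf Hg.
    replace (CInt g a b) with (- (- (1) * CInt g a b)) by ring.
    rewrite <- CInt_scal by assumption.
    rewrite (CInt_ext (fun t => f t - g t) (fun t => f t + - (1) * g t)); [|assumption| intros; ring].
    rewrite CInt_plus; try assumption; [ring|].
    intros t Ht. destruct (Hg t Ht) as [G1 G2].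
    split; [eapply continuous_ext; [| apply (continuous_opp (V := R_NormedModule)); exact G1]
           |eapply continuous_ext; [| apply (continuous_opp (V := R_NormedModule)); exact G2]];
    intros s; unfold opp, Re, Im; simpl; ring. }
  unfold RI. rewrite !M; try assumption; try lra.
  rewrite (CInt_ext _ (fun t => (0, 2 * h / ((t - x) * (t - x) + h * h))%R) (x - h) (x + h)); try lra.
  rewrite (CInt_ext _ (fun t => (2 * h / ((t - y) * (t - y) + h * h), 0)%R) (y - h) (y + h)); try lra.
  - unfold CInt, Re, Im; simpl fst; simpl snd. rewrite !KI.
    rewrite !RInt_const. unfold Cmult, Cplus, Ci, scal; simpl. unfold mult; simpl.
    f_equal; ring.
  - intros t Ht. assert (0 <= (t - y) * (t - y))%R by apply Rle_0_sqr.
    unfold z, Cinv, Cminus, Cplus, Copp; simpl. f_equal; field; nra.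
  - intros t Ht. assert (0 <= (t - x) * (t - x))%R by apply Rle_0_sqr.
    unfold z, Cinv, Cminus, Cplus, Copp; simpl. f_equal; field; nra.
Qed.

Definition C2pi_i : C := (0, 2 * PI)%R.

Lemma C2pi_i_neq_0 : C2pi_i <> 0.
Proof. intros E. injection E. assert (H := PI_RGT_0). lra. Qed.

(** By Goursat the contour shrinks to a small square about [z]. There f(w)/(w-z) differs from
    f(z)/(w-z) by a difference quotient, which is bounded, so the two integrals differ by O(h) and
    the second one is known from [RI_kernel_square]. *)
Theorem Cauchy_formula (f : C -> C) (a b c d : R) (z : C) :
  (forall w, in_rect a b c d w -> cdiff f w) ->
  (a < Re z < b)%R -> (c < Im z < d)%R ->
  RI (fun w => f w / (w - z)) a b c d = C2pi_i * f z.
Proof.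
  intros Hf Hx Hy.
  set (g := fun w => f w / (w - z)).
  assert (Hg : forall w, in_rect a b c d w -> w <> z -> cdiff g w).
  { intros w Hw Hwz. unfold g. apply cdiff_div; [apply Hf; exact Hw| |].
    - apply cdiff_minus; [apply cdiff_id| apply cdiff_const].
    - apply Cminus_neq_0. exact Hwz. }
  assert (Hgc : forall w, in_rect a b c d w -> w <> z -> ccont g w).
  { intros. apply cdiff_ccont. auto. }
  assert (Hneq : forall u v, u <> Re z \/ v <> Im z -> ((u, v) : C) <> z).
  { intros u v H E. subst z. simpl in H. lra. }
  destruct (Hf z) as [l Hl]. { unfold in_rect. lra. }
  assert (Hl' := Hl). rewrite cderiv_eps in Hl'. destruct (Hl' 1%R Rlt_0_1) as [dl [Hdl Hq]].
  (* A square of half-side below [h0] stays inside the rectangle, and its points are within 2 h0 <=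
     dl of [z]. *)
  set (h0 := Rmin (dl / 2) (Rmin (Rmin (Re z - a) (b - Re z)) (Rmin (Im z - c) (d - Im z)))).
  assert (H0 : (0 < h0)%R) by (unfold h0; repeat apply Rmin_pos; lra).
  assert (Hh0 : (2 * h0 <= dl /\ a <= Re z - h0 /\ Re z + h0 <= b /\ c <= Im z - h0
                 /\ Im z + h0 <= d)%R).
  { assert (X1 := Rmin_l (dl / 2) (Rmin (Rmin (Re z - a) (b - Re z)) (Rmin (Im z - c) (d - Im z)))).
    assert (X2 := Rmin_r (dl / 2) (Rmin (Rmin (Re z - a) (b - Re z)) (Rmin (Im z - c) (d - Im z)))).
    fold h0 in X1, X2.
    assert (X3 := Rmin_l (Rmin (Re z - a) (b - Re z)) (Rmin (Im z - c) (d - Im z))).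
    assert (X4 := Rmin_r (Rmin (Re z - a) (b - Re z)) (Rmin (Im z - c) (d - Im z))).
    assert (X5 := Rmin_l (Re z - a) (b - Re z)). assert (X6 := Rmin_r (Re z - a) (b - Re z)).
    assert (X7 := Rmin_l (Im z - c) (d - Im z)). assert (X8 := Rmin_r (Im z - c) (d - Im z)).
    lra. }
  assert (K : forall h : R, (0 < h < h0)%R ->
    (Cmod (RI g a b c d - C2pi_i * f z) <= h * (16 * (Cmod l + 1)))%R).
  { intros h Hh.
    set (x1 := (Re z - h)%R). set (x2 := (Re z + h)%R).
    set (y1 := (Im z - h)%R). set (y2 := (Im z + h)%R).
    assert (Hxy : (a < x1 /\ x1 < Re z < x2 /\ x2 < b /\ c < y1 /\ y1 < Im z < y2 /\ y2 < d)%R)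
      by (unfold x1, x2, y1, y2; lra).
    (* Cut off the left and right strips at full height, then the pieces below and above the square;
       none of these four rectangles contains [z]. *)
    assert (E : RI g a b c d = RI g x1 x2 y1 y2).
    { rewrite (RI_split_v g a x1 b c d); [|lra| |].
      2, 3: apply ccont_pcont_h; intros t Ht; apply Hgc; [unfold in_rect; simpl; lra|];
            apply Hneq; right; lra.
      rewrite (RI_split_v g x1 x2 b c d); [|lra| |].
      2, 3: apply ccont_pcont_h; intros t Ht; apply Hgc; [unfold in_rect; simpl; lra|];
            apply Hneq; right; lra.
      rewrite (RI_split_h g x1 x2 c y1 d); [|lra| |].
      2, 3: apply ccont_pcont_v; intros t Ht; apply Hgc; [unfold in_rect; simpl; lra|];
            apply Hneq; left; lra.
      rewrite (RI_split_h g x1 x2 y1 y2 d); [|lra| |].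
      2, 3: apply ccont_pcont_v; intros t Ht; apply Hgc; [unfold in_rect; simpl; lra|];
            apply Hneq; left; lra.
      rewrite (Goursat g a x1 c d), (Goursat g x2 b c d), (Goursat g x1 x2 c y1),
        (Goursat g x1 x2 y2 d); try lra; [ring| | | |];
      (intros w Hw; apply Hg; [unfold in_rect in *; lra|];
       intros ->; unfold in_rect in Hw; lra). }
    rewrite E.
    assert (Hin : forall w, on_bdry x1 x2 y1 y2 w -> in_rect a b c d w /\ w <> z).
    { intros w Hw. split.
      - apply on_bdry_in_rect in Hw; try lra. unfold in_rect in *; lra.
      - intros ->. unfold on_bdry in Hw. lra. }
    assert (Hk : forall w, on_bdry x1 x2 y1 y2 w -> ccont (fun w => / (w - z)) w).
    { intros w Hw. destruct (Hin w Hw) as [_ Hz]. apply ccont_inv.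
      - apply ccont_minus; [apply ccont_id | apply ccont_const].
      - apply Cminus_neq_0. exact Hz. }
    assert (Hk' : forall w, on_bdry x1 x2 y1 y2 w -> ccont (fun w => f z * / (w - z)) w).
    { intros w Hw. apply ccont_mult; [apply ccont_const| auto]. }
    assert (Hgb : forall w, on_bdry x1 x2 y1 y2 w -> ccont g w).
    { intros w Hw. destruct (Hin w Hw). apply Hgc; assumption. }
    replace (C2pi_i * f z) with (RI (fun w => f z * / (w - z)) x1 x2 y1 y2).
    2: { rewrite RI_scal; try lra; [|assumption]. unfold x1, x2, y1, y2.
         rewrite RI_kernel_square by lra. fold C2pi_i. ring. }
    rewrite <- RI_minus; try lra; try assumption.
    eapply Rle_trans.
    - apply (RI_bound x1 x2 y1 y2) with (M := (Cmod l + 1)%R); try lra.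
      + intros w Hw. apply ccont_minus; auto.
      + intros w Hw. destruct (Hin w Hw) as [Hw1 Hw2].
        assert (Hz := Cminus_neq_0 _ _ Hw2).
        assert (Hz' : (0 < Cmod (w - z))%R) by (apply Cmod_gt_0; exact Hz).
        assert (D : (Cmod (w - z) < dl)%R).
        { apply on_bdry_in_rect in Hw; try lra. unfold in_rect, x1, x2, y1, y2 in Hw.
          eapply Rle_lt_trans; [apply Cmod_le_sum|].
          apply Rle_lt_trans with (h + h)%R; [|lra].
          unfold Re, Im in *; simpl; apply Rplus_le_compat; apply Rabs_le; lra. }
        specialize (Hq w D).
        (* The difference quotient is l plus an error of modulus at most 1, by differentiability at
           [z] with eps = 1. *)
        replace (g w - f z * / (w - z)) with ((f w - f z - l * (w - z)) / (w - z) + l)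
          by (unfold g; field; exact Hz).
        eapply Rle_trans; [apply Cmod_triangle|]. rewrite Cmod_div by exact Hz.
        assert ((Cmod (f w - f z - l * (w - z)) / Cmod (w - z) <= 1)%R); [|lra].
        apply Rmult_le_reg_r with (Cmod (w - z)); [exact Hz'|].
        unfold Rdiv. rewrite Rmult_assoc, Rinv_l by lra. lra.
    - unfold x1, x2, y1, y2. assert (X := Cmod_ge_0 l). nra. }
  apply Ceq_minus, Cmod_le_0.
  apply le_of_le_eps with (L := (16 * (Cmod l + 1))%R).
  - assert (X := Cmod_ge_0 l). lra.
  - intros eps He. destruct (Rlt_dec eps h0) as [Hl1|Hl1].
    + apply K. lra.
    + eapply Rle_trans; [apply (K (h0 / 2)%R); lra|].
      apply Rmult_le_compat_r; [|lra]. assert (X := Cmod_ge_0 l). lra.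
Qed.

(** * Consequences of Cauchy's formula *)

Notation sq f a r := (RI (f : C -> C)%C (Re a - r) (Re a + r) (Im a - r) (Im a + r)).
Notation on_sq a r := (on_bdry (Re a - r) (Re a + r) (Im a - r) (Im a + r)).

(** The price of using squares for circles: the distance to the centre varies between r and 2r. This
    is why holomorphy is asked on discs of radius 2r in the lemmas that follow. *)
Lemma on_sq_dist (a w : C) (r : R) : (0 <= r)%R -> on_sq a r w ->
  (r <= Cmod (w - a) <= 2 * r)%R.
Proof.
  intros Hr H. destruct (Re_Im_le_Cmod (w - a)) as [H1 H2].
  assert (H3 := Cmod_le_sum (w - a)).
  replace (Re (w - a)) with (Re w - Re a)%R in * by (unfold Re; simpl; ring).
  replace (Im (w - a)) with (Im w - Im a)%R in * by (unfold Im; simpl; ring).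
  revert H1 H2 H3. unfold on_bdry in H.
  unfold Rabs; destruct (Rcase_abs _), (Rcase_abs _); intros; lra.
Qed.

Lemma in_sq_dist (a w : C) (r : R) :
  in_rect (Re a - r) (Re a + r) (Im a - r) (Im a + r) w -> (Cmod (w - a) <= 2 * r)%R.
Proof.
  intros H. eapply Rle_trans; [apply Cmod_le_sum|]. unfold in_rect in H.
  replace (Re (w - a)) with (Re w - Re a)%R in * by (unfold Re; simpl; ring).
  replace (Im (w - a)) with (Im w - Im a)%R in * by (unfold Im; simpl; ring).
  replace (2 * r)%R with (r + r)%R by ring.
  apply Rplus_le_compat; apply Rabs_le; lra.
Qed.

Lemma dist_in_sq (a z : C) (r : R) : (Cmod (z - a) < r)%R ->
  (Re a - r < Re z < Re a + r /\ Im a - r < Im z < Im a + r)%R.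
Proof.
  intros H. destruct (Re_Im_le_Cmod (z - a)) as [H1 H2].
  replace (Re (z - a)) with (Re z - Re a)%R in * by (unfold Re; simpl; ring).
  replace (Im (z - a)) with (Im z - Im a)%R in * by (unfold Im; simpl; ring).
  assert (X := Rle_abs (Re z - Re a)). assert (Y := Rle_abs (Im z - Im a)).
  assert (X' := Rle_abs (- (Re z - Re a))). assert (Y' := Rle_abs (- (Im z - Im a))).
  rewrite Rabs_Ropp in X', Y'. lra.
Qed.

Lemma Cauchy_square (f : C -> C) (a z : C) (r : R) :
  (forall w, (Cmod (w - a) <= 2 * r)%R -> cdiff f w) -> (Cmod (z - a) < r)%R ->
  sq (fun w => f w / (w - z)) a r = C2pi_i * f z.
Proof.
  intros Hf Hz. destruct (dist_in_sq a z r Hz).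
  apply Cauchy_formula; try assumption.
  intros w Hw. apply Hf. apply in_sq_dist. exact Hw.
Qed.

Lemma sq_bound (f : C -> C) (a : C) (r M : R) : (0 <= r)%R ->
  (forall w, on_sq a r w -> ccont f w) ->
  (forall w, on_sq a r w -> (Cmod (f w) <= M)%R) ->
  (Cmod (sq f a r) <= 16 * M * r)%R.
Proof.
  intros Hr Hc HM. eapply Rle_trans; [apply RI_bound; try lra; eassumption|]. lra.
Qed.

Lemma bdry_bounded (f : C -> C) (a b c d : R) :
  (forall z, on_bdry a b c d z -> ccont f z) ->
  exists M : R, (0 < M)%R /\ forall z, on_bdry a b c d z -> (Cmod (f z) <= M)%R.
Proof.
  intros H. destruct (bdry_pcont _ _ _ _ _ H) as [F1 [F2 [F3 F4]]].
  assert (K : forall (g : R -> C) u v, pcont g u v ->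
     exists M : R, (0 < M)%R /\ forall t, (u <= t <= v)%R -> (Cmod (g t) <= M)%R).
  { intros g u v Hg.
    destruct (bounded_continuity (V := R_NormedModule) (fun t => Re (g t)) u v) as [M1 HM1].
    { intros t Ht. apply (Hg t Ht). }
    destruct (bounded_continuity (V := R_NormedModule) (fun t => Im (g t)) u v) as [M2 HM2].
    { intros t Ht. apply (Hg t Ht). }
    exists (Rabs M1 + Rabs M2 + 1)%R. split.
    - assert (X := Rabs_pos M1). assert (Y := Rabs_pos M2). lra.
    - intros t Ht. specialize (HM1 t Ht). specialize (HM2 t Ht).
      eapply Rle_trans; [apply Cmod_le_sum|].
      change (norm (Re (g t))) with (Rabs (Re (g t))) in HM1.
      change (norm (Im (g t))) with (Rabs (Im (g t))) in HM2.
      assert (X := Rle_abs M1). assert (Y := Rle_abs M2). lra. }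
  destruct (K _ _ _ F1) as [M1 [P1 H1]]. destruct (K _ _ _ F2) as [M2 [P2 H2]].
  destruct (K _ _ _ F3) as [M3 [P3 H3]]. destruct (K _ _ _ F4) as [M4 [P4 H4]].
  exists (M1 + M2 + M3 + M4)%R. split; [lra|].
  intros [x y] Hz. unfold on_bdry in Hz; simpl in Hz.
  destruct Hz as [[Hx [->| ->]]|[[->| ->] Hy]].
  - specialize (H1 x Hx). cbv beta in H1. lra.
  - specialize (H2 x Hx). cbv beta in H2. lra.
  - specialize (H4 y Hy). cbv beta in H4. lra.
  - specialize (H3 y Hy). cbv beta in H3. lra.
Qed.

Lemma ccont_sub_const (a w : C) : ccont (fun w => w - a) w.
Proof. apply ccont_minus; [apply ccont_id | apply ccont_const]. Qed.

Lemma on_sq_neq (a w z : C) (r : R) : (0 <= r)%R -> on_sq a r w -> (Cmod (z - a) < r)%R ->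
  w - z <> 0 /\ (r - Cmod (z - a) <= Cmod (w - z))%R.
Proof.
  intros Hr Hw Hz. apply on_sq_dist in Hw; [|exact Hr].
  assert (H := Cmod_triangle_3 w a z).
  split; [apply Cmod_gt_0|]; lra.
Qed.

(** Differentiation under the integral sign, for a [phi] that is merely continuous on the contour.
    With h = z'-z, 1/(w-z') - 1/(w-z) - h/(w-z)^2 = h^2 / ((w-z)^2 (w-z')), which is O(h^2)
    uniformly on the square. *)
Lemma Cauchy_integral_cderiv (phi : C -> C) (a z : C) (r : R) : (0 < r)%R ->
  (forall w, on_sq a r w -> ccont phi w) -> (Cmod (z - a) < r)%R ->
  cderiv (fun z => sq (fun w => phi w / (w - z)) a r) z
         (sq (fun w => phi w / ((w - z) * (w - z))) a r).
Proof.
  intros Hr Hphi Hz.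
  destruct (bdry_bounded _ _ _ _ _ Hphi) as [M [HM HB]].
  set (dl := (r - Cmod (z - a))%R). assert (Hdl : (0 < dl)%R) by (unfold dl; lra).
  apply cderiv_eps. intros eps He.
  (* The contour keeps distance [dl] from z and dl/2 from z', so [sq_bound] gives 16 r M |h|^2 /
     (dl^3/2) = K |h|^2. *)
  set (K := (32 * M * r / (dl * dl * dl))%R).
  assert (HK : (0 < K)%R).
  { unfold K. apply Rdiv_lt_0_compat; [nra|]. repeat apply Rmult_lt_0_compat; lra. }
  exists (Rmin (dl / 2) (eps / K)). split.
  { apply Rmin_pos; [lra|]. apply Rdiv_lt_0_compat; assumption. }
  intros z' Hz'.
  assert (Hz1 := Rlt_le_trans _ _ _ Hz' (Rmin_l _ _)).
  assert (Hz2 := Rlt_le_trans _ _ _ Hz' (Rmin_r _ _)).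
  assert (Hz'a : (Cmod (z' - a) < r - dl / 2)%R).
  { assert (H := Cmod_triangle_3 z' a z). unfold dl in *. lra. }
  set (h := z' - z) in *.
  assert (Cz : forall w, on_sq a r w -> ccont (fun w => phi w / (w - z)) w).
  { intros w Hw. apply ccont_div; [auto | apply ccont_sub_const |].
    apply (on_sq_neq a w z r); try assumption; lra. }
  assert (Cz' : forall w, on_sq a r w -> ccont (fun w => phi w / (w - z')) w).
  { intros w Hw. apply ccont_div; [auto | apply ccont_sub_const |].
    apply (on_sq_neq a w z' r); try assumption; lra. }
  assert (Cz2 : forall w, on_sq a r w -> ccont (fun w => phi w / ((w - z) * (w - z))) w).
  { intros w Hw. destruct (on_sq_neq a w z r) as [N _]; try assumption; try lra.
    apply ccont_div; [auto | apply ccont_mult; apply ccont_sub_const |].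
    apply Cmult_neq_0; assumption. }
  assert (Cz3 : forall w, on_sq a r w -> ccont (fun w => h * (phi w / ((w - z) * (w - z)))) w).
  { intros w Hw. apply ccont_mult; [apply ccont_const | auto]. }
  assert (Cd : forall w, on_sq a r w -> ccont (fun w => phi w / (w - z') - phi w / (w - z)) w).
  { intros w Hw. apply ccont_minus; auto. }
  rewrite (Cmult_comm _ h).
  rewrite <- RI_scal; try lra; try assumption.
  rewrite <- RI_minus; try lra; try assumption.
  rewrite <- RI_minus; try lra; try assumption.
  apply Rle_trans with (16 * (M * (Cmod h * Cmod h) / (dl * dl * (dl / 2))) * r)%R.
  - apply sq_bound; [lra| |].
    + intros w Hw. apply ccont_minus; auto.
    + intros w Hw. destruct (on_sq_neq a w z r) as [N1 B1]; try assumption; try lra.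
      destruct (on_sq_neq a w z' r) as [N2 B2]; try assumption; try lra.
      replace (phi w / (w - z') - phi w / (w - z) - h * (phi w / ((w - z) * (w - z))))
        with (phi w * (h * h) / ((w - z) * (w - z) * (w - z')))
        by (unfold h; field; auto).
      rewrite Cmod_div by (repeat apply Cmult_neq_0; assumption).
      rewrite !Cmod_mult. fold dl in B1.
      assert (B2' : (dl / 2 <= Cmod (w - z'))%R) by lra.
      assert (Hden : (dl * dl * (dl / 2) <= Cmod (w - z) * Cmod (w - z) * Cmod (w - z'))%R).
      { apply Rmult_le_compat; try lra; [nra|]. apply Rmult_le_compat; lra. }
      assert (Hpos : (0 < dl * dl * (dl / 2))%R) by (repeat apply Rmult_lt_0_compat; lra).
      apply Rmult_le_compat.
      * assert (X := Cmod_ge_0 (phi w)). assert (Y := Cmod_ge_0 h). nra.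
      * apply Rlt_le, Rinv_0_lt_compat. lra.
      * apply Rmult_le_compat_r; [assert (Y := Cmod_ge_0 h); nra | auto].
      * apply Rinv_le_contravar; assumption.
  - replace (16 * (M * (Cmod h * Cmod h) / (dl * dl * (dl / 2))) * r)%R
      with ((K * Cmod h) * Cmod h)%R by (unfold K; field; lra).
    apply Rmult_le_compat_r; [apply Cmod_ge_0|].
    apply Rlt_le. apply (Rmult_lt_compat_l K) in Hz2; [|exact HK].
    replace (K * (eps / K))%R with eps in Hz2 by (field; lra). exact Hz2.
Qed.

Lemma Rpow_half_small (K e : R) : (0 < e)%R -> exists n : nat, (K * (1 / 2) ^ n < e)%R.
Proof.
  intros He.
  destruct (pow_lt_1_zero (1 / 2) ltac:(rewrite Rabs_pos_eq; lra) (e / (Rabs K + 1))%R) as [N HN].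
  { apply Rdiv_lt_0_compat; [assumption|]. assert (X := Rabs_pos K). lra. }
  exists N. specialize (HN N (le_n N)).
  assert (X := Rabs_pos K).
  assert (P : (0 < (1 / 2) ^ N)%R) by (apply pow_lt; lra).
  rewrite Rabs_pos_eq in HN by lra.
  apply (Rmult_lt_compat_r (Rabs K + 1)) in HN; [|lra].
  replace (e / (Rabs K + 1) * (Rabs K + 1))%R with e in HN by (field; lra).
  assert (Y := Rle_abs K). nra.
Qed.

(** * Zeros of holomorphic functions and the identity theorem *)

Definition zero_near (f : C -> C) (a : C) : Prop :=
  exists d : R, (0 < d)%R /\ forall w, (Cmod (w - a) < d)%R -> f w = 0.

Definition factor_near (f : C -> C) (a : C) : Prop :=
  exists (m : nat) (h : C -> C), holomorphic_at h a /\ h a <> 0 /\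
    exists d : R, (0 < d)%R /\ forall w, (Cmod (w - a) < d)%R -> f w = (w - a) ^ m * h w.

(** Let g_m(z) be the Cauchy integral of f(w)/(w-a)^m. Then g_0 = f and g_m(z) = g_m(a) + (z-a)
    g_(m+1)(z), so g_m(a) is the m-th Taylor coefficient and g_m the remainder after division. The
    first nonzero coefficient yields the factorization. If all vanish, f(z) = (z-a)^m g_m(z) for
    every m, which tends to 0 near [a]. *)
Lemma holomorphic_zero_or_factor (f : C -> C) (a : C) :
  holomorphic_at f a -> zero_near f a \/ factor_near f a.
Proof.
  rewrite holomorphic_at_Cmod. intros [d [Hd Hf]].
  set (r := (d / 3)%R). assert (Hr : (0 < r)%R) by (unfold r; lra).
  assert (Hf' : forall w, (Cmod (w - a) <= 2 * r)%R -> cdiff f w)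
    by (intros w Hw; apply Hf; unfold r in Hw; lra).
  assert (N0 : forall w, on_sq a r w -> w - a <> 0).
  { intros w Hw. apply (on_sq_neq a w a r); try lra; [assumption|].
    rewrite Cmod_zero_minus. lra. }
  assert (Cf : forall w, on_sq a r w -> ccont f w).
  { intros w Hw. apply cdiff_ccont, Hf'. apply on_sq_dist in Hw; lra. }
  assert (Cphi : forall m w, on_sq a r w -> ccont (fun w => f w / (w - a) ^ m) w).
  { intros m w Hw. apply ccont_div; [auto| |].
    - apply ccont_pow, ccont_sub_const.
    - apply Cpow_nz. auto. }
  set (g := fun (m : nat) z => / C2pi_i * sq (fun w => f w / (w - a) ^ m / (w - z)) a r).
  assert (Hg : forall m, holomorphic_at (g m) a).
  { intros m. apply holomorphic_at_Cmod. exists r. split; [assumption|].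
    intros w Hw. eexists. apply cderiv_scal.
    apply (Cauchy_integral_cderiv (fun w => f w / (w - a) ^ m)); auto. }
  assert (Hg0 : forall z, (Cmod (z - a) < r)%R -> g 0%nat z = f z).
  { intros z Hz. unfold g. rewrite (RI_ext (Re a - r) (Re a + r) (Im a - r) (Im a + r)) with (g := fun w => f w / (w - z));
      try lra.
    - rewrite Cauchy_square by assumption. field. exact C2pi_i_neq_0.
    - intros w Hw. simpl. unfold Cdiv at 2. rewrite <- RtoC_inv, Rinv_1, Cmult_1_r by lra.
      reflexivity. }
  assert (Cg : forall m z w, (Cmod (z - a) < r)%R -> on_sq a r w ->
     ccont (fun w => f w / (w - a) ^ m / (w - z)) w).
  { intros m z w Hz Hw. apply ccont_div; [apply Cphi; exact Hw | apply ccont_sub_const|].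
    apply (on_sq_neq a w z r); try lra; assumption. }
  assert (Haa : (Cmod (a - a) < r)%R) by (rewrite Cmod_zero_minus; lra).
  assert (HgS : forall m z, (Cmod (z - a) < r)%R -> g m z = g m a + (z - a) * g (S m) z).
  { intros m z Hz. unfold g.
    replace ((z - a) * (/ C2pi_i * sq (fun w => f w / (w - a) ^ S m / (w - z)) a r))
      with (/ C2pi_i * ((z - a) * sq (fun w => f w / (w - a) ^ S m / (w - z)) a r)) by ring.
    rewrite <- RI_scal with (k := z - a); try lra; [|auto]. rewrite <- Cmult_plus_distr_l. f_equal.
    rewrite <- RI_plus; try lra; [|auto|].
    - apply RI_ext; try lra. intros w Hw.
      destruct (on_sq_neq a w z r) as [N1 _]; try lra; try assumption.
      assert (N2 := N0 w Hw). assert (N3 := Cpow_nz _ m N2). simpl. field. auto.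
    - intros w Hw. apply ccont_mult; [apply ccont_const | auto]. }
  destruct (classic (exists m, g m a <> 0)) as [Hex|Hno].
  - right.
    assert (Hmin : exists m, g m a <> 0 /\ forall j, (j < m)%nat -> g j a = 0).
    { destruct Hex as [m0 Hm0]. induction m0 as [m0 IH] using lt_wf_ind.
      destruct (classic (exists j, (j < m0)%nat /\ g j a <> 0)) as [[j [Hj1 Hj2]]|Hj].
      - exact (IH j Hj1 Hj2).
      - exists m0. split; [exact Hm0|]. intros j Hj1. apply NNPP. intros Hj2.
        apply Hj. exists j. auto. }
    destruct Hmin as [m [Hm1 Hm2]].
    exists m, (g m). split; [apply Hg|]. split; [exact Hm1|].
    exists r. split; [assumption|]. intros z Hz. rewrite <- Hg0 by assumption.
    clear Hm1. induction m.
    + simpl. ring.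
    + rewrite IHm by (intros; apply Hm2; lia).
      rewrite (HgS m z Hz), (Hm2 m) by lia. simpl. ring.
  - left. assert (Hz0 : forall m, g m a = 0).
    { intros m. apply NNPP. intros H. apply Hno. exists m. exact H. }
    destruct (bdry_bounded _ _ _ _ _ Cf) as [M [HM HB]].
    exists (r / 2)%R. split; [lra|]. intros z Hz.
    assert (Hzr : (Cmod (z - a) < r)%R) by lra.
    assert (E : forall m, f z = (z - a) ^ m * g m z).
    { induction m.
      - rewrite Hg0 by assumption. simpl. ring.
      - rewrite IHm, (HgS m z Hzr), Hz0. simpl. ring. }
    assert (HK : (0 < Cmod (/ C2pi_i))%R).
    { apply Cmod_gt_0. intros E1. apply C2pi_i_neq_0.
      rewrite <- (Cmult_1_l C2pi_i), <- (Cinv_l C2pi_i C2pi_i_neq_0), E1. ring. }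
    (* On |z-a| < r/2 the factor (z-a)^m brings (r/2)^m against the r^m in the denominator on the
       contour, which leaves (1/2)^m. *)
    assert (B : forall m, (Cmod (f z) <= 32 * M * Cmod (/ C2pi_i) * (1 / 2) ^ m)%R).
    { intros m. rewrite (E m) at 1. rewrite Cmod_mult, Cmod_pow. unfold g. rewrite Cmod_mult.
      assert (B1 : (Cmod (sq (fun w => f w / (w - a) ^ m / (w - z))%C a r)
                  <= 16 * (M / r ^ m / (r / 2)) * r)%R).
      { apply sq_bound; [lra| auto|]. intros w Hw.
        destruct (on_sq_neq a w z r) as [N1 N2]; try lra; try assumption.
        assert (N3 := Cpow_nz _ m (N0 w Hw)).
        rewrite !Cmod_div by assumption. rewrite Cmod_pow.
        apply on_sq_dist in Hw as Hw'; [|lra].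
        apply Rmult_le_compat.
        - apply Rmult_le_pos; [apply Cmod_ge_0|]. apply Rlt_le, Rinv_0_lt_compat.
          rewrite <- Cmod_pow. apply Cmod_gt_0. exact N3.
        - apply Rlt_le, Rinv_0_lt_compat. lra.
        - apply Rmult_le_compat; [apply Cmod_ge_0| | auto |].
          + apply Rlt_le, Rinv_0_lt_compat. rewrite <- Cmod_pow. apply Cmod_gt_0. exact N3.
          + apply Rinv_le_contravar; [apply pow_lt; lra|]. apply pow_incr. lra.
        - apply Rinv_le_contravar; lra. }
      assert (P1 : (Cmod (z - a) ^ m <= (r / 2) ^ m)%R).
      { apply pow_incr. split; [apply Cmod_ge_0| lra]. }
      apply Rle_trans with ((r / 2) ^ m * (Cmod (/ C2pi_i) * (16 * (M / r ^ m / (r / 2)) * r)))%R.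
      - apply Rmult_le_compat; [apply pow_le, Cmod_ge_0 | | exact P1|].
        + apply Rmult_le_pos; [lra | apply Cmod_ge_0].
        + apply Rmult_le_compat_l; lra.
      - apply Req_le. replace (r / 2)%R with (r * (1 / 2))%R by lra.
        rewrite Rpow_mult_distr. field. repeat split; try lra; apply pow_nonzero; lra. }
    apply Cmod_le_0. apply Rnot_lt_le. intros Hpos.
    destruct (Rpow_half_small (32 * M * Cmod (/ C2pi_i)) _ Hpos) as [n Hn].
    specialize (B n). lra.
Qed.

Lemma factor_near_nonzero (f : C -> C) (a : C) : factor_near f a ->
  exists d : R, (0 < d)%R /\ forall w, (Cmod (w - a) < d)%R -> w <> a -> f w <> 0.
Proof.
  intros [m [h [Hh [Ha [d [Hd H]]]]]].
  destruct (ccont_neq_0 h a) as [e [He H1]].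
  - apply cdiff_ccont, holomorphic_at_cdiff. exact Hh.
  - exact Ha.
  - exists (Rmin d e). split; [apply Rmin_pos; assumption|]. intros w Hw Hwa.
    rewrite H by (eapply Rlt_le_trans; [exact Hw | apply Rmin_l]).
    apply Cmult_neq_0.
    + apply Cpow_nz, Cminus_neq_0. exact Hwa.
    + apply H1. eapply Rlt_le_trans; [exact Hw | apply Rmin_r].
Qed.

Lemma open_Cmod (U : C -> Prop) :
  (forall z, U z -> exists d : R, (0 < d)%R /\ forall w, (Cmod (w - z) < d)%R -> U w) ->
  open (T := C_UniformSpace) U.
Proof. intros H z Hz. apply locally_Cmod. apply H. exact Hz. Qed.

Lemma punctured_point (a : C) (d : R) : (0 < d)%R -> exists w, (Cmod (w - a) < d)%R /\ w <> a.
Proof.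
  intros Hd. exists (a + (d / 2)%R). 
  assert (E : a + (d / 2)%R - a = (d / 2)%R) by ring.
  split.
  - rewrite E, Cmod_R, Rabs_pos_eq; lra.
  - intros H. apply Ceq_minus in H. rewrite E in H. apply RtoC_inj in H. lra.
Qed.

(** Used with [P z := f z = g z]; punctured neighbourhoods make it apply to meromorphic functions too. *)
Lemma punctured_dichotomy (U : C -> Prop) (P : C -> Prop) (z0 : C) :
  connected U ->
  (forall a, U a -> locally' (T := C_UniformSpace) a P \/
                    locally' (T := C_UniformSpace) a (fun z => ~ P z)) ->
  U z0 -> locally' (T := C_UniformSpace) z0 P ->
  forall a, U a -> locally' (T := C_UniformSpace) a P.
Proof.
  intros HU H H0 H1.
  assert (Hopen : forall Q : C -> Prop,
     open (T := C_UniformSpace) (fun a => locally' (T := C_UniformSpace) a Q)).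
  { intros Q. apply open_Cmod. intros a Ha. apply locally'_Cmod in Ha.
    destruct Ha as [d [Hd Ha]]. exists d. split; [assumption|]. intros w Hw.
    apply locally'_Cmod. destruct (classic (w = a)) as [->|Hwa].
    - exists d. auto.
    - assert (Hp : (0 < Cmod (w - a))%R) by (apply Cmod_gt_0, Cminus_neq_0; exact Hwa).
      (* The disc about [w] has to avoid [a] itself, where nothing is known about [Q], and to stay
         inside the disc about [a]. *)
      exists (Rmin (Cmod (w - a)) (d - Cmod (w - a))%R).
      split; [apply Rmin_pos; lra|]. intros u Hu _.
      assert (U1 := Rlt_le_trans _ _ _ Hu (Rmin_l _ _)).
      assert (U2 := Rlt_le_trans _ _ _ Hu (Rmin_r _ _)).
      assert (T := Cmod_triangle_3 u a w).
      apply Ha; [lra|]. intros ->. rewrite Cmod_minus_sym in U1. lra. }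
  apply (HU _ (fun a => locally' (T := C_UniformSpace) a (fun z => ~ P z))); auto.
  - intros z _ [A B]. apply locally'_Cmod in A. apply locally'_Cmod in B.
    destruct A as [d [Hd A]]. destruct B as [e [He B]].
    destruct (punctured_point z (Rmin d e)) as [w [Hw Hwz]]; [apply Rmin_pos; assumption|].
    apply (B w); [eapply Rlt_le_trans; [exact Hw| apply Rmin_r] | exact Hwz |].
    apply A; [eapply Rlt_le_trans; [exact Hw| apply Rmin_l] | exact Hwz].
  - exists z0. auto.
Qed.

Lemma holomorphic_at_minus (f g : C -> C) (a : C) :
  holomorphic_at f a -> holomorphic_at g a -> holomorphic_at (fun z => f z - g z) a.
Proof.
  rewrite !holomorphic_at_Cmod. intros [d [Hd Hf]] [e [He Hg]].
  exists (Rmin d e). split; [apply Rmin_pos; assumption|]. intros w Hw. apply cdiff_minus.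
  - apply Hf. eapply Rlt_le_trans; [exact Hw| apply Rmin_l].
  - apply Hg. eapply Rlt_le_trans; [exact Hw| apply Rmin_r].
Qed.

Lemma holomorphic_at_mult (f g : C -> C) (a : C) :
  holomorphic_at f a -> holomorphic_at g a -> holomorphic_at (fun z => f z * g z) a.
Proof.
  rewrite !holomorphic_at_Cmod. intros [d [Hd Hf]] [e [He Hg]].
  exists (Rmin d e). split; [apply Rmin_pos; assumption|]. intros w Hw. apply cdiff_mult.
  - apply Hf. eapply Rlt_le_trans; [exact Hw| apply Rmin_l].
  - apply Hg. eapply Rlt_le_trans; [exact Hw| apply Rmin_r].
Qed.

Lemma holomorphic_eq_dichotomy (f g : C -> C) (a : C) :
  holomorphic_at f a -> holomorphic_at g a ->
  locally' (T := C_UniformSpace) a (fun z => f z = g z) \/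
  locally' (T := C_UniformSpace) a (fun z => ~ f z = g z).
Proof.
  intros Hf Hg. assert (H := holomorphic_at_minus f g a Hf Hg).
  destruct (holomorphic_zero_or_factor _ a H) as [[d [Hd H1]]|H1].
  - left. apply locally'_Cmod. exists d. split; [assumption|]. intros w Hw _.
    apply Ceq_minus. apply H1. exact Hw.
  - right. apply locally'_Cmod. destruct (factor_near_nonzero _ a H1) as [d [Hd H2]].
    exists d. split; [assumption|]. intros w Hw Hwa E. apply (H2 w Hw Hwa).
    apply Ceq_minus in E. exact E.
Qed.

Lemma locally'_eq_cont (f g : C -> C) (a : C) : ccont f a -> ccont g a ->
  locally' (T := C_UniformSpace) a (fun z => f z = g z) -> f a = g a.
Proof.
  intros Hf Hg H. apply locally'_Cmod in H. destruct H as [d [Hd H]].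
  apply Ceq_minus, Cmod_le_0. apply le_of_le_eps with (L := 2%R); [lra|].
  intros eps He.
  destruct (Hf eps He) as [d1 [Hd1 H1]]. destruct (Hg eps He) as [d2 [Hd2 H2]].
  destruct (punctured_point a (Rmin d (Rmin d1 d2))) as [w [Hw Hwa]].
  { repeat apply Rmin_pos; assumption. }
  assert (W1 := Rlt_le_trans _ _ _ Hw (Rmin_l _ _)).
  assert (W2 := Rlt_le_trans _ _ _ Hw (Rmin_r _ _)).
  assert (W3 := Rlt_le_trans _ _ _ W2 (Rmin_l _ _)).
  assert (W4 := Rlt_le_trans _ _ _ W2 (Rmin_r _ _)).
  specialize (H w W1 Hwa). specialize (H1 w W3). specialize (H2 w W4).
  assert (T := Cmod_triangle_3 (f a) (g a) (f w)). rewrite H in T at 2.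
  rewrite (Cmod_minus_sym (f a) (f w)) in T. lra.
Qed.

Theorem identity_theorem (U : C -> Prop) (f g : C -> C) (z0 : C) :
  connected U -> (forall z, U z -> holomorphic_at f z) ->
  (forall z, U z -> holomorphic_at g z) -> U z0 ->
  locally (T := C_UniformSpace) z0 (fun z => f z = g z) ->
  forall z, U z -> f z = g z.
Proof.
  intros HU Hf Hg H0 H1 z Hz.
  apply locally'_eq_cont; try (apply cdiff_ccont, holomorphic_at_cdiff; auto).
  apply (punctured_dichotomy U (fun z => f z = g z) z0); try assumption.
  - intros a Ha. apply holomorphic_eq_dichotomy; auto.
  - apply locally'_Cmod. apply locally_Cmod in H1. destruct H1 as [d [Hd H1]].
    exists d. auto.
Qed.

(** The uniform limit is continuous, so Cauchy's formula on a square passes to [f]; the integral so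
    obtained is complex differentiable by [Cauchy_integral_cderiv]. The derivatives converge because
    they are contour integrals of the same kind. *)
Theorem Weierstrass_uniform_limit (F : nat -> C -> C) (F' : nat -> C) (f : C -> C) (a : C) (r : R) :
  (0 < r)%R ->
  (forall n w, (Cmod (w - a) < r)%R -> cdiff (F n) w) ->
  (forall n, cderiv (F n) a (F' n)) ->
  (forall eps : R, (0 < eps)%R -> exists N, forall n, (N <= n)%nat -> forall w,
     (Cmod (w - a) < r)%R -> (Cmod (F n w - f w) <= eps)%R) ->
  exists D, cderiv f a D /\
    forall eps : R, (0 < eps)%R -> exists N, forall n, (N <= n)%nat -> (Cmod (F' n - D) <= eps)%R.
Proof.
  intros Hr HF HF' Hlim.
  (* A square of half-side r/3 lies within distance 2r/3 < r of [a]. *)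
  set (s := (r / 3)%R). assert (Hs : (0 < s)%R) by (unfold s; lra).
  assert (Cf : forall w, (Cmod (w - a) < r)%R -> ccont f w).
  { intros w Hw eps He.
    destruct (Hlim (eps / 4)%R ltac:(lra)) as [N HN].
    specialize (HN N (le_n N)).
    destruct (cdiff_ccont _ _ (HF N w Hw) (eps / 4)%R ltac:(lra)) as [d [Hd HC]].
    exists (Rmin d (r - Cmod (w - a))%R). split; [apply Rmin_pos; lra|].
    intros u Hu.
    assert (U1 := Rlt_le_trans _ _ _ Hu (Rmin_l _ _)).
    assert (U2 := Rlt_le_trans _ _ _ Hu (Rmin_r _ _)).
    assert (Hur : (Cmod (u - a) < r)%R).
    { assert (T := Cmod_triangle_3 u a w). lra. }
    assert (A1 := HN u Hur). assert (A2 := HN w Hw). specialize (HC u U1).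
    rewrite Cmod_minus_sym in A1.
    assert (T1 := Cmod_triangle_3 (f u) (f w) (F N u)).
    assert (T2 := Cmod_triangle_3 (F N u) (f w) (F N w)). lra. }
  assert (Hsq : forall w, on_sq a s w -> (Cmod (w - a) < r)%R).
  { intros w Hw. apply on_sq_dist in Hw; [|lra]. unfold s in Hw. lra. }
  assert (CF : forall n w, on_sq a s w -> ccont (F n) w).
  { intros n w Hw. apply cdiff_ccont. auto. }
  assert (HI : forall n z, (Cmod (z - a) < s)%R ->
     sq (fun w => F n w / (w - z)) a s = C2pi_i * F n z).
  { intros n z Hz. apply Cauchy_square; [|assumption].
    intros w Hw. apply HF. unfold s in Hw. lra. }
  assert (Hfz : forall z, (Cmod (z - a) < s)%R -> sq (fun w => f w / (w - z)) a s = C2pi_i * f z).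
  { intros z Hz. apply Ceq_minus, Cmod_le_0.
    apply le_of_le_eps with (L := (16 * (1 / (s - Cmod (z - a))) * s + Cmod C2pi_i)%R).
    - apply Rplus_le_le_0_compat; [|apply Cmod_ge_0].
      apply Rmult_le_pos; [|lra]. apply Rmult_le_pos; [lra|].
      apply Rlt_le, Rdiv_lt_0_compat; lra.
    - intros eps He. destruct (Hlim eps He) as [N HN]. specialize (HN N (le_n N)).
      eapply Rle_trans; [apply (Cmod_triangle_3 _ _ (C2pi_i * F N z))|].
      rewrite Rmult_plus_distr_l. apply Rplus_le_compat.
      + rewrite <- HI by assumption.
        assert (N1 : forall w, on_sq a s w -> w - z <> 0 /\ (s - Cmod (z - a) <= Cmod (w - z))%R).
        { intros w Hw. apply (on_sq_neq a w z s); try lra; assumption. }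
        rewrite <- RI_minus; try lra.
        * replace (eps * (16 * (1 / (s - Cmod (z - a))) * s))%R
            with (16 * (eps / (s - Cmod (z - a))) * s)%R by (field; lra).
          apply sq_bound; [lra| |].
          -- intros w Hw. apply ccont_minus; (apply ccont_div; [|apply ccont_sub_const|apply N1; exact Hw]).
             ++ apply Cf. auto.
             ++ auto.
          -- intros w Hw. destruct (N1 w Hw) as [N2 N3].
             replace (f w / (w - z) - F N w / (w - z)) with ((f w - F N w) / (w - z)) by (field; exact N2).
             rewrite Cmod_div by exact N2.
             apply Rmult_le_compat; [apply Cmod_ge_0| | |].
             ++ apply Rlt_le, Rinv_0_lt_compat. lra.
             ++ rewrite Cmod_minus_sym. apply HN. auto.
             ++ apply Rinv_le_contravar; lra.
        * intros w Hw. apply ccont_div; [apply Cf; auto| apply ccont_sub_const|apply N1; exact Hw].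
        * intros w Hw. apply ccont_div; [auto| apply ccont_sub_const|apply N1; exact Hw].
      + replace (C2pi_i * F N z - C2pi_i * f z) with (C2pi_i * (F N z - f z)) by ring.
        rewrite Cmod_mult, Rmult_comm. apply Rmult_le_compat_r; [apply Cmod_ge_0|].
        apply HN. unfold s in Hz. lra. }
  assert (Haa : (Cmod (a - a) < s)%R) by (rewrite Cmod_zero_minus; lra).
  exists (/ C2pi_i * sq (fun w => f w / ((w - a) * (w - a))) a s).
  split.
  - apply (cderiv_ext_loc (fun z => / C2pi_i * sq (fun w => f w / (w - z)) a s)).
    + exists s. split; [assumption|]. intros z Hz. rewrite Hfz by exact Hz. field.
      exact C2pi_i_neq_0.
    + apply cderiv_scal. apply Cauchy_integral_cderiv; try assumption.
      intros w Hw. apply Cf. auto.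
  - assert (EF : forall n, F' n = / C2pi_i * sq (fun w => F n w / ((w - a) * (w - a))) a s).
    { intros n. apply (cderiv_unique (F n) a); [apply HF'|].
      apply (cderiv_ext_loc (fun z => / C2pi_i * sq (fun w => F n w / (w - z)) a s)).
      + exists s. split; [assumption|]. intros z Hz. rewrite HI by exact Hz. field.
        exact C2pi_i_neq_0.
      + apply cderiv_scal. apply Cauchy_integral_cderiv; try assumption. auto. }
    intros eps He.
    assert (HK : (0 < Cmod C2pi_i)%R) by (apply Cmod_gt_0, C2pi_i_neq_0).
    (* The integrand gains a factor at most 1/s^2 and [sq_bound] a factor 16 s; this choice makes
       the product |2 pi i| eps. *)
    destruct (Hlim (eps * s * Cmod C2pi_i / 16)%R) as [N HN].
    { apply Rdiv_lt_0_compat; [|lra]. apply Rmult_lt_0_compat; [nra | assumption]. }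
    exists N. intros n Hn. specialize (HN n Hn).
    assert (N1 : forall w, on_sq a s w -> w - a <> 0 /\ (s <= Cmod (w - a))%R).
    { intros w Hw. destruct (on_sq_neq a w a s) as [X Y]; try lra; try assumption.
      split; [exact X|]. rewrite Cmod_zero_minus in Y. lra. }
    assert (C1 : forall w, on_sq a s w -> ccont (fun w => f w / ((w - a) * (w - a))) w).
    { intros w Hw. apply ccont_div; [apply Cf; auto | apply ccont_mult; apply ccont_sub_const|].
      apply Cmult_neq_0; apply N1; exact Hw. }
    assert (C2 : forall w, on_sq a s w -> ccont (fun w => F n w / ((w - a) * (w - a))) w).
    { intros w Hw. apply ccont_div; [auto | apply ccont_mult; apply ccont_sub_const|].
      apply Cmult_neq_0; apply N1; exact Hw. }
    rewrite EF, <- Cmult_minus_distr_l, Cmod_mult, Cmod_inv by exact C2pi_i_neq_0.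
    apply Rmult_le_reg_l with (Cmod C2pi_i); [exact HK|].
    rewrite <- Rmult_assoc, Rinv_r, Rmult_1_l by lra.
    rewrite <- RI_minus; try lra; try assumption.
    replace (Cmod C2pi_i * eps)%R with (16 * ((eps * s * Cmod C2pi_i / 16) / (s * s)) * s)%R
      by (field; lra).
    apply sq_bound; [lra| |].
    + intros w Hw. apply ccont_minus; auto.
    + intros w Hw. destruct (N1 w Hw) as [N2 N3].
      replace (F n w / ((w - a) * (w - a)) - f w / ((w - a) * (w - a)))
        with ((F n w - f w) / ((w - a) * (w - a))) by (field; exact N2).
      rewrite Cmod_div, Cmod_mult by (apply Cmult_neq_0; exact N2).
      apply Rmult_le_compat; [apply Cmod_ge_0| | |].
      * apply Rlt_le, Rinv_0_lt_compat. nra.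
      * apply HN. auto.
      * apply Rinv_le_contravar; [nra|]. apply Rmult_le_compat; lra.
Qed.

(** * Complex exponential, logarithm and powers *)

Lemma Cexp_plus (a b : C) : Cexp (a + b) = Cexp a * Cexp b.
Proof.
  unfold Cexp, Cmult, Re, Im; simpl. rewrite exp_plus, cos_plus, sin_plus. f_equal; ring.
Qed.

Lemma Cexp_0 : Cexp 0 = 1.
Proof. unfold Cexp, Re, Im; simpl. rewrite exp_0, cos_0, sin_0. unfold RtoC. f_equal; ring. Qed.

Lemma Cexp_opp (a : C) : Cexp a * Cexp (- a) = 1.
Proof. rewrite <- Cexp_plus, <- Cexp_0. f_equal. ring. Qed.

Lemma Cexp_neq_0 (a : C) : Cexp a <> 0.
Proof. intros H. assert (E := Cexp_opp a). rewrite H, Cmult_0_l in E. symmetry in E. exact (C1_nz E). Qed.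

Lemma Cexp_inv (a : C) : Cexp (- a) = / Cexp a.
Proof.
  assert (H := Cexp_neq_0 a). rewrite <- (Cmult_1_l (/ Cexp a)), <- (Cexp_opp a). field. exact H.
Qed.

Lemma Cmod_Cexp (z : C) : Cmod (Cexp z) = exp (Re z).
Proof.
  unfold Cmod, Cexp; simpl fst; simpl snd.
  replace ((exp (Re z) * cos (Im z)) ^ 2 + (exp (Re z) * sin (Im z)) ^ 2)%R with (Rsqr (exp (Re z))).
  - rewrite sqrt_Rsqr; [reflexivity|]. apply Rlt_le, exp_pos.
  - assert (H := sin2_cos2 (Im z)). unfold Rsqr in *.
    transitivity (exp (Re z) * exp (Re z) * (sin (Im z) * sin (Im z) + cos (Im z) * cos (Im z)))%R;
      [rewrite H|]; ring.
Qed.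

Lemma derivable_pt_lim_mult_form (f : R -> R) (l : R) : derivable_pt_lim f 0 l ->
  forall eps : R, (0 < eps)%R -> exists d : R, (0 < d)%R /\
    forall h, (Rabs h < d)%R -> (Rabs (f h - f 0 - l * h) <= eps * Rabs h)%R.
Proof.
  intros H eps He. destruct (H eps He) as [d Hd]. exists d. split; [apply cond_pos|].
  intros h Hh. destruct (Req_dec h 0) as [->|Hh0].
  - replace (f 0 - f 0 - l * 0)%R with 0%R by ring. rewrite Rabs_R0. lra.
  - specialize (Hd h Hh0 Hh). rewrite Rplus_0_l in Hd.
    replace (f h - f 0 - l * h)%R with (((f h - f 0) / h - l) * h)%R by (field; exact Hh0).
    rewrite Rabs_mult. apply Rmult_le_compat_r; [apply Rabs_pos| lra].
Qed.

Lemma cderiv_Cexp_0 : cderiv Cexp 0 1.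
Proof.
  apply cderiv_eps. intros eps0 He0.
  (* The cap at 1 gives |exp a - 1| <= 2|a| and exp a <= 2 for the real parts a that occur. *)
  set (eps := Rmin eps0 1 : R).
  assert (He : (0 < eps)%R) by (apply Rmin_pos; lra).
  assert (He1 : (eps <= 1)%R) by apply Rmin_r.
  assert (He2 : (eps <= eps0)%R) by apply Rmin_l.
  assert (D1 := derivable_pt_lim_mult_form _ _ derivable_pt_lim_exp_0 (eps / 16)%R ltac:(lra)).
  assert (D2 := derivable_pt_lim_mult_form _ _ derivable_pt_lim_cos_0 (eps / 16)%R ltac:(lra)).
  assert (D3 := derivable_pt_lim_mult_form _ _ derivable_pt_lim_sin_0 (eps / 16)%R ltac:(lra)).
  destruct D1 as [d1 [Hd1 D1]]. destruct D2 as [d2 [Hd2 D2]]. destruct D3 as [d3 [Hd3 D3]].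
  exists (Rmin (eps / 16) (Rmin d1 (Rmin d2 d3))).
  split; [repeat apply Rmin_pos; lra|].
  intros w Hw. replace (w - 0) with w in * by ring.
  assert (W0 := Rlt_le_trans _ _ _ Hw (Rmin_l _ _)).
  assert (W1 := Rlt_le_trans _ _ _ Hw (Rmin_r _ _)).
  assert (W2 := Rlt_le_trans _ _ _ W1 (Rmin_r _ _)).
  assert (W3 := Rlt_le_trans _ _ _ W2 (Rmin_l _ _)).
  assert (W4 := Rlt_le_trans _ _ _ W2 (Rmin_r _ _)).
  assert (W5 := Rlt_le_trans _ _ _ W1 (Rmin_l _ _)).
  clear Hw W1 W2.
  destruct (Re_Im_le_Cmod w) as [Ha Hb].
  rewrite Cexp_0. replace (Cexp w - 1 - 1 * w) with (Cexp w - 1 - w) by ring.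
  set (m := Cmod w) in *.
  apply Rle_trans with (eps * m)%R; [|apply Rmult_le_compat_r; [apply Cmod_ge_0| lra]].
  eapply Rle_trans; [apply Cmod_le_sum|].
  unfold Cexp, Re, Im in *; simpl. destruct w as [a b]; simpl in *.
  specialize (D1 a ltac:(lra)). specialize (D2 b ltac:(lra)). specialize (D3 b ltac:(lra)).
  rewrite exp_0 in D1. rewrite cos_0 in D2. rewrite sin_0 in D3.
  assert (Ea := Rle_abs a).
  assert (X1 : (Rabs (exp a - 1) <= 2 * Rabs a)%R).
  { replace (exp a - 1)%R with ((exp a - 1 - 1 * a) + a)%R by ring.
    eapply Rle_trans; [apply Rabs_triang|]. assert (P := Rabs_pos a). nra. }
  assert (X2 : (Rabs (exp a) <= 2)%R).
  { replace (exp a) with ((exp a - 1) + 1)%R by ring.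
    eapply Rle_trans; [apply Rabs_triang|]. rewrite Rabs_R1. lra. }
  assert (Pb := Rabs_pos b). assert (Pa := Rabs_pos a).
  assert (Y1 : (Rabs (exp a * cos b + - (1) + - a) <= eps / 16 * m + 2 * (eps / 16 * m))%R).
  { replace (exp a * cos b + - (1) + - a)%R
      with ((exp a - 1 - 1 * a) + exp a * (cos b - 1 - 0 * b))%R by ring.
    eapply Rle_trans; [apply Rabs_triang|]. rewrite Rabs_mult.
    apply Rplus_le_compat; [nra|]. apply Rmult_le_compat; try apply Rabs_pos; nra. }
  assert (Y2 : (Rabs (exp a * sin b + - 0 + - b) <= 2 * (eps / 16 * m) + 2 * (eps / 16) * m)%R).
  { replace (exp a * sin b + - 0 + - b)%R
      with (exp a * (sin b - 0 - 1 * b) + (exp a - 1) * b)%R by ring.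
    eapply Rle_trans; [apply Rabs_triang|]. rewrite !Rabs_mult.
    apply Rplus_le_compat; apply Rmult_le_compat; try apply Rabs_pos; nra. }
  assert (0 <= m)%R by apply Cmod_ge_0. nra.
Qed.

Lemma cderiv_Cexp (z : C) : cderiv Cexp z (Cexp z).
Proof.
  apply (cderiv_ext (fun w => Cexp z * Cexp (w - z))).
  - intros w. rewrite <- Cexp_plus. f_equal. ring.
  - eapply cderiv_eq.
    + apply cderiv_scal. apply (cderiv_comp Cexp (fun w => w - z)).
      * replace (z - z) with (RtoC 0) by ring. apply cderiv_Cexp_0.
      * apply cderiv_minus; [apply cderiv_id | apply cderiv_const].
    + ring.
Qed.

Lemma cderiv_Cexp_comp (f : C -> C) (z l : C) : cderiv f z l ->
  cderiv (fun w => Cexp (f w)) z (l * Cexp (f z)).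
Proof. intros H. apply (cderiv_comp Cexp f); [apply cderiv_Cexp | exact H]. Qed.

Lemma cdiff_Cexp_comp (f : C -> C) (z : C) : cdiff f z -> cdiff (fun w => Cexp (f w)) z.
Proof. intros [l H]. eexists. apply cderiv_Cexp_comp. exact H. Qed.

Lemma Re_pos_neq_0 (z : C) : (0 < Re z)%R -> z <> 0.
Proof. intros H ->. simpl in H. lra. Qed.

Lemma Re_le_Cmod (z : C) : (Re z <= Cmod z)%R.
Proof. eapply Rle_trans; [apply Rle_abs | apply re_le_Cmod]. Qed.

Lemma Cexp_Clog (z : C) : (0 < Re z)%R -> Cexp (Clog z) = z.
Proof.
  intros Hz. assert (Hm : (0 < Cmod z)%R) by (apply Cmod_gt_0, Re_pos_neq_0; exact Hz).
  unfold Cexp, Clog, Re, Im in *; simpl. rewrite exp_ln by exact Hm.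
  rewrite cos_atan, sin_atan.
  assert (E : (sqrt (1 + Rsqr (snd z / fst z)) = Cmod z / fst z)%R).
  { rewrite <- (sqrt_Rsqr (Cmod z / fst z)).
    - f_equal. unfold Rsqr, Rdiv. 
      replace (Cmod z * / fst z * (Cmod z * / fst z))%R with (Cmod z ^ 2 * (/ fst z * / fst z))%R by ring.
      rewrite Cmod2_alt. unfold Re, Im. field. lra.
    - apply Rlt_le, Rdiv_lt_0_compat; assumption. }
  rewrite E. destruct z as [x y]; simpl in *. f_equal; field; split; lra.
Qed.

Lemma ccont_Clog (z : C) : (0 < Re z)%R -> ccont Clog z.
Proof.
  intros Hz. assert (Hm : (0 < Cmod z)%R) by (apply Cmod_gt_0, Re_pos_neq_0; exact Hz).
  intros eps He.
  assert (C1 : continuous (U := R_UniformSpace) ln (Cmod z)).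
  { apply (ex_derive_continuous (K := R_AbsRing) (V := R_NormedModule)). auto_derive. exact Hm. }
  assert (C2 : continuous (T := C_UniformSpace) (U := R_UniformSpace)
                 (fun w : C => atan (snd w / fst w)) z).
  { apply (continuous_comp (U := C_UniformSpace) (V := R_UniformSpace) (W := R_UniformSpace)
             (fun w : C => (snd w / fst w)%R) atan).
    - apply (continuous_mult (U := C_UniformSpace) (K := R_AbsRing)).
      + apply (continuous_snd (U := R_UniformSpace) (V := R_UniformSpace)).
      + apply (continuous_comp (U := C_UniformSpace) (V := R_UniformSpace) (W := R_UniformSpace)
             (fun w : C => fst w) Rinv).
        * apply (continuous_fst (U := R_UniformSpace) (V := R_UniformSpace)).
        * apply continuous_Rinv. unfold Re in Hz. lra.
    - apply continuous_atan. }
  assert (H2 : (0 < eps / 2)%R) by lra.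
  destruct (C1 _ (locally_ball (T := R_UniformSpace) (ln (Cmod z)) (mkposreal _ H2))) as [d1 Hd1].
  assert (L2 := C2 _ (locally_ball (T := R_UniformSpace) (atan (snd z / fst z)) (mkposreal _ H2))).
  apply locally_Cmod in L2. destruct L2 as [d2 [Hd2 L2]].
  exists (Rmin d1 d2). split; [apply Rmin_pos; [apply cond_pos | assumption]|].
  intros w Hw.
  assert (W1 := Rlt_le_trans _ _ _ Hw (Rmin_l _ _)).
  assert (W2 := Rlt_le_trans _ _ _ Hw (Rmin_r _ _)).
  specialize (L2 w W2).
  assert (L1 : ball (M := R_UniformSpace) (Cmod z) d1 (Cmod w)).
  { change (Rabs (Cmod w - Cmod z) < d1)%R.
    assert (T1 := Cmod_triangle_rev w z). assert (T2 := Cmod_triangle_rev z w).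
    rewrite Cmod_minus_sym in T2. apply Rabs_lt_between'. lra. }
  specialize (Hd1 _ L1).
  change (Rabs (ln (Cmod w) - ln (Cmod z)) < eps / 2)%R in Hd1.
  change (Rabs (atan (snd w / fst w) - atan (snd z / fst z)) < eps / 2)%R in L2.
  eapply Rle_lt_trans; [apply Cmod_le_sum|].
  unfold Clog, Re, Im in *; simpl. unfold Rminus in *. lra.
Qed.

(** [Clog] is a continuous right inverse of [Cexp], whose derivative at Clog z is z. With u = Clog w
    - Clog z, the expansion w - z = z u + o(u) first gives |z| |u| <= 2|w-z| and then, divided by z,
    the derivative 1/z. *)
Lemma cderiv_Clog (z : C) : (0 < Re z)%R -> cderiv Clog z (/ z).
Proof.
  intros Hz. assert (Hz0 := Re_pos_neq_0 z Hz).
  assert (Hm : (0 < Cmod z)%R) by (apply Cmod_gt_0; exact Hz0).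
  apply cderiv_eps. intros eps He.
  assert (D := cderiv_Cexp (Clog z)). rewrite Cexp_Clog in D by exact Hz.
  rewrite cderiv_eps in D.
  set (e := Rmin (Cmod z / 2) (eps * (Cmod z * Cmod z) / 2)).
  assert (Hmm : (0 < Cmod z * Cmod z)%R) by nra.
  assert (He' : (0 < e)%R) by (apply Rmin_pos; [lra|]; apply Rdiv_lt_0_compat; [nra|lra]).
  assert (E1 : (e <= Cmod z / 2)%R) by apply Rmin_l.
  assert (E2 : (e <= eps * (Cmod z * Cmod z) / 2)%R) by apply Rmin_r.
  destruct (D e He') as [d1 [Hd1 H1]].
  destruct (ccont_Clog z Hz d1 Hd1) as [d2 [Hd2 H2]].
  exists (Rmin d2 (Re z)). split; [apply Rmin_pos; assumption|].
  intros w Hw.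
  assert (W1 := Rlt_le_trans _ _ _ Hw (Rmin_l _ _)).
  assert (W2 := Rlt_le_trans _ _ _ Hw (Rmin_r _ _)).
  assert (Hrw : (0 < Re w)%R).
  { destruct (Re_Im_le_Cmod (w - z)) as [A _].
    replace (Re (w - z)) with (Re w - Re z)%R in A by (unfold Re; simpl; ring).
    assert (B := Rle_abs (- (Re w - Re z))). rewrite Rabs_Ropp in B. lra. }
  specialize (H2 w W1). specialize (H1 (Clog w) H2).
  rewrite !Cexp_Clog in H1 by assumption.
  set (u := Clog w - Clog z) in *.
  assert (B1 : (Cmod z * Cmod u <= Cmod (w - z) + e * Cmod u)%R).
  { rewrite <- Cmod_mult.
    replace (z * u) with ((w - z) - (w - z - z * u)) by ring.
    eapply Rle_trans; [apply Cmod_triangle_minus|]. lra. }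
  assert (B2 : (Cmod z * Cmod u <= 2 * Cmod (w - z))%R).
  { assert (X := Cmod_ge_0 u). nra. }
  replace (u - / z * (w - z)) with (- ((w - z - z * u) / z)) by (field; exact Hz0).
  rewrite Cmod_opp, Cmod_div by exact Hz0.
  apply Rmult_le_reg_r with (Cmod z); [exact Hm|].
  unfold Rdiv. rewrite Rmult_assoc, Rinv_l, Rmult_1_r by lra.
  eapply Rle_trans; [exact H1|].
  apply Rmult_le_reg_r with (Cmod z); [exact Hm|].
  assert (X := Cmod_ge_0 (w - z)).
  apply Rle_trans with (e * (2 * Cmod (w - z)))%R; [nra|].
  apply Rle_trans with ((eps * (Cmod z * Cmod z) / 2) * (2 * Cmod (w - z)))%R; [nra|].
  apply Req_le. field.
Qed.

Lemma Clog_scal (r : R) (z : C) : (0 < r)%R -> (0 < Re z)%R -> Clog (r * z) = RtoC (ln r) + Clog z.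
Proof.
  intros Hr Hz. assert (Hm : (0 < Cmod z)%R) by (apply Cmod_gt_0, Re_pos_neq_0; exact Hz).
  unfold Clog. rewrite Cmod_mult, Cmod_R, Rabs_pos_eq by lra. rewrite ln_mult by assumption.
  unfold Cplus, RtoC; simpl. f_equal. rewrite Rplus_0_l. f_equal.
  destruct z as [x y]. unfold Re, Im in *; simpl in *. field. split; [|nra].
  assert (0 < r * x)%R by nra. lra.
Qed.

(** The principal power z^(-s), with the minus sign of the zeta series built in. *)
Definition pw (s z : C) : C := Cexp (- s * Clog z).

Lemma pw_0 (z : C) : pw 0 z = 1.
Proof. unfold pw. rewrite <- Cexp_0. f_equal. ring. Qed.

Lemma pw_shift (s z : C) : (0 < Re z)%R -> pw (s - 1) z = z * pw s z.
Proof.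
  intros Hz. unfold pw. rewrite <- (Cexp_Clog z Hz) at 2. rewrite <- Cexp_plus. f_equal. ring.
Qed.

Lemma pw_scal (s : C) (r : R) (z : C) : (0 < r)%R -> (0 < Re z)%R ->
  pw s (r * z) = Cexp (- s * ln r) * pw s z.
Proof.
  intros. unfold pw. rewrite Clog_scal by assumption. rewrite <- Cexp_plus. f_equal. ring.
Qed.

Lemma cderiv_pw_s (s z : C) : cderiv (fun s => pw s z) s (- Clog z * pw s z).
Proof.
  unfold pw. eapply cderiv_eq.
  - apply cderiv_Cexp_comp. apply cderiv_mult; [apply cderiv_opp, cderiv_id | apply cderiv_const].
  - cbv beta. ring.
Qed.

Lemma cderiv_pw_z (s z : C) : (0 < Re z)%R -> cderiv (pw s) z (- s * pw (s + 1) z).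
Proof.
  intros Hz. assert (Hz0 := Re_pos_neq_0 z Hz). unfold pw at 1. eapply cderiv_eq.
  - apply cderiv_Cexp_comp. apply cderiv_scal. apply cderiv_Clog. exact Hz.
  - cbv beta. change (Cexp (- s * Clog z)) with (pw s z). assert (E := pw_shift (s + 1) z Hz).
    replace (s + 1 - 1) with s in E by ring. rewrite E.
    field. exact Hz0.
Qed.

(** |z^(-s)| = exp(Im s * arg z - Re s * ln |z|), and |arg z| < PI/2 <= 2 on the right half-plane;
    this is the 2 in the exponential. *)
Lemma pw_bound (s z : C) (k n : nat) : (1 <= n)%nat -> (INR n <= Re z)%R -> (INR k <= Re s)%R ->
  (Cmod (pw s z) <= exp (2 * Cmod s) / INR n ^ k)%R.
Proof.
  intros Hn Hz Hs. apply (le_INR 1) in Hn. simpl in Hn.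
  assert (Hm : (INR n <= Cmod z)%R) by (eapply Rle_trans; [exact Hz | apply Re_le_Cmod]).
  unfold pw. rewrite Cmod_Cexp.
  replace (Re (- s * Clog z)) with (Im s * atan (Im z / Re z) - Re s * ln (Cmod z))%R
    by (unfold Clog, Re, Im; simpl; ring).
  unfold Rminus. rewrite exp_plus.
  assert (Hl : (0 <= ln (INR n))%R).
  { rewrite <- ln_1. apply ln_le; lra. }
  assert (Hl2 : (ln (INR n) <= ln (Cmod z))%R) by (apply ln_le; lra).
  apply Rmult_le_compat; try (apply Rlt_le, exp_pos).
  - assert (A : (Im s * atan (Im z / Re z) <= 2 * Cmod s)%R).
    { eapply Rle_trans; [apply Rle_abs|]. rewrite Rabs_mult, Rmult_comm.
      destruct (Re_Im_le_Cmod s) as [_ X].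
      apply Rmult_le_compat; try apply Rabs_pos; [|exact X].
      assert (Y := atan_bound (Im z / Re z)). assert (P := PI_4). apply Rabs_le. lra. }
    destruct A as [A|A]; [apply Rlt_le, exp_increasing; exact A | rewrite A; lra].
  - assert (E : (/ INR n ^ k = exp (- (INR k * ln (INR n))))%R).
    { rewrite exp_Ropp. f_equal. rewrite <- ln_pow by lra. rewrite exp_ln; [reflexivity|].
      apply pow_lt. lra. }
    rewrite E. assert (Hk := pos_INR k).
    assert (A : (- (Re s * ln (Cmod z)) <= - (INR k * ln (INR n)))%R).
    { apply Ropp_le_contravar. apply Rmult_le_compat; lra. }
    destruct A as [A|A]; [apply Rlt_le, exp_increasing; exact A | rewrite A; lra].
Qed.

(** * Finite differences and Euler means *)

(** The difference is g(z) - g(z+1), the sign produced when consecutive terms of an alternating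
    series are averaged. *)
Fixpoint Dc (K : nat) (g : C -> C) (z : C) : C :=
  match K with
  | O => g z
  | S K => Dc K g z - Dc K g (z + 1)
  end.

Lemma Dc_S (K : nat) (g : C -> C) (z : C) : Dc (S K) g z = Dc K g z - Dc K g (z + 1).
Proof. reflexivity. Qed.

Lemma Re_plus_1 (z : C) : Re (z + 1) = (Re z + 1)%R.
Proof. reflexivity. Qed.

Lemma Dc_cderiv (K : nat) (g g' : C -> C) :
  (forall z, (0 < Re z)%R -> cderiv g z (g' z)) ->
  forall z, (0 < Re z)%R -> cderiv (Dc K g) z (Dc K g' z).
Proof.
  intros H. induction K as [|K IH]; intros z Hz; simpl.
  - apply H. exact Hz.
  - apply cderiv_minus; [apply IH; exact Hz|].
    eapply cderiv_eq.
    + apply (cderiv_comp (Dc K g) (fun z => z + 1)).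
      * apply IH. rewrite Re_plus_1. lra.
      * apply cderiv_plus; [apply cderiv_id | apply cderiv_const].
    + ring.
Qed.

Lemma Dc_scal (K : nat) (k : C) (g : C -> C) (z : C) :
  Dc K (fun z => k * g z) z = k * Dc K g z.
Proof.
  revert z. induction K as [|K IH]; intros z; simpl; [reflexivity|]. rewrite !IH. ring.
Qed.

(** The real mean value theorem is applied to real and imaginary part separately, at two different
    points, hence the factor 2. *)
Lemma mean_value_bound (f : C -> C) (f' : C -> C) (z : C) (M : R) :
  (forall t : R, (0 <= t <= 1)%R -> cderiv f (z + t) (f' (z + t))) ->
  (forall t : R, (0 <= t <= 1)%R -> (Cmod (f' (z + t)%C) <= M)%R) ->
  (Cmod (f z - f (z + 1))%C <= 2 * M)%R.
Proof.
  intros Hd HM.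
  assert (K : forall t : R, (0 <= t <= 1)%R ->
     is_derive (fun t : R => Re (f (z + t))) t (Re (f' (z + t))) /\
     is_derive (fun t : R => Im (f (z + t))) t (Im (f' (z + t)))).
  { intros t Ht. specialize (Hd t Ht).
    destruct (cderiv_line f z 1 (f' (z + t)) t) as [A B].
    - rewrite Cmult_1_r. exact Hd.
    - rewrite Cmult_1_r in A, B.
      split; eapply is_derive_ext; [|exact A| |exact B]; intros u; cbv beta;
        rewrite Cmult_1_r; reflexivity. }
  assert (V : forall h h' : R -> R, (forall t, (0 <= t <= 1)%R -> is_derive h t (h' t)) ->
     (forall t, (0 <= t <= 1)%R -> (Rabs (h' t) <= M)%R) -> (Rabs (h 0 - h 1) <= M)%R).
  { intros h h' H1 H2.
    destruct (MVT_gen h 0 1 h') as [c [Hc1 Hc2]].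
    - rewrite Rmin_left, Rmax_right by lra. intros t Ht. apply H1. lra.
    - rewrite Rmin_left, Rmax_right by lra. intros t Ht.
      apply continuity_pt_filterlim.
      apply (ex_derive_continuous (K := R_AbsRing) (V := R_NormedModule)).
      exists (h' t). apply H1. exact Ht.
    - rewrite Rmin_left, Rmax_right in Hc1 by lra.
      rewrite Rabs_minus_sym, Hc2. rewrite Rminus_0_r, Rmult_1_r. apply H2. exact Hc1. }
  eapply Rle_trans; [apply Cmod_le_sum|].
  assert (E0 : z + 0%R = z) by ring.
  assert (V1 := V (fun t => Re (f (z + t))) (fun t => Re (f' (z + t)))
    (fun t Ht => proj1 (K t Ht))).
  assert (V2 := V (fun t => Im (f (z + t))) (fun t => Im (f' (z + t)))
    (fun t Ht => proj2 (K t Ht))).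
  cbv beta in V1, V2. rewrite E0 in V1, V2.
  replace (2 * M)%R with (M + M)%R by ring.
  apply Rplus_le_compat.
  - apply V1. intros t Ht. eapply Rle_trans; [apply Re_Im_le_Cmod | apply HM; exact Ht].
  - apply V2. intros t Ht. eapply Rle_trans; [apply Re_Im_le_Cmod | apply HM; exact Ht].
Qed.

(** The modulus of the Pochhammer symbol s(s+1)...(s+K-1), which arises on differentiating z^(-s) K
    times. *)
Fixpoint poch_mod (s : C) (K : nat) : R :=
  match K with O => 1 | S K => Cmod s * poch_mod (s + 1) K end.

Lemma poch_mod_pos (s : C) (K : nat) : (0 <= poch_mod s K)%R.
Proof.
  revert s. induction K; intros s; simpl; [lra|].
  apply Rmult_le_pos; [apply Cmod_ge_0 | apply IHK].
Qed.

Lemma poch_mod_le (s : C) (K : nat) : (poch_mod s K <= (Cmod s + INR K) ^ K)%R.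
Proof.
  revert s. induction K; intros s; [simpl; lra|].
  rewrite S_INR. simpl.
  assert (X := Cmod_ge_0 s). assert (Y := pos_INR K).
  apply Rmult_le_compat; [exact X | apply poch_mod_pos | lra|].
  eapply Rle_trans; [apply IHK|]. apply pow_incr.
  assert (Z := Cmod_ge_0 (s + 1)). assert (T := Cmod_triangle s 1). rewrite Cmod_1 in T. lra.
Qed.

(** Each difference is traded for a derivative by the mean value bound, and the derivative of z^(-s)
    is -s z^(-s-1). So K differences raise the exponent by K, at the cost of 2^K and the Pochhammer
    factor. *)
Lemma Dc_pw_bound (K : nat) (s z : C) (M : R) : (0 < Re z)%R ->
  (forall t : R, (0 <= t)%R -> (Cmod (pw (s + INR K) (z + t)) <= M)%R) ->
  (Cmod (Dc K (pw s) z) <= 2 ^ K * poch_mod s K * M)%R.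
Proof.
  revert s z M. induction K as [|K IH]; intros s z M Hz HM.
  - simpl. rewrite !Rmult_1_l. specialize (HM 0%R (Rle_refl _)).
    simpl in HM. replace (s + 0) with s in HM by ring. replace (z + 0) with z in HM by ring.
    exact HM.
  - simpl Dc. simpl pow. simpl poch_mod.
    replace (2 * 2 ^ K * (Cmod s * poch_mod (s + 1) K) * M)%R
      with (2 * (Cmod s * (2 ^ K * poch_mod (s + 1) K * M)))%R by ring.
    apply (mean_value_bound (Dc K (pw s)) (Dc K (fun z => - s * pw (s + 1) z))).
    + intros t Ht. apply (Dc_cderiv K (pw s)).
      * apply cderiv_pw_z.
      * unfold Re in *; simpl. lra.
    + intros t Ht. rewrite Dc_scal, Cmod_mult, Cmod_opp.
      apply Rmult_le_compat_l; [apply Cmod_ge_0|].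
      apply IH.
      * unfold Re in *; simpl. lra.
      * intros u Hu. replace (z + t + u) with (z + (t + u)%R) by (rewrite RtoC_plus; ring).
        replace (s + 1 + INR K) with (s + INR (S K)) by (rewrite S_INR, RtoC_plus; ring).
        apply HM. lra.
Qed.

(** The [K]-th difference of [(n+1)(x+n)^(-s) = (x+n)^(1-s) + (1-x)(x+n)^(-s)]. *)
Definition term (K : nat) (x s : C) (n : nat) : C :=
  Dc K (pw (s - 1)) (x + INR n) + (1 - x) * Dc K (pw s) (x + INR n).

Lemma term_S (K : nat) (x s : C) (n : nat) : term (S K) x s n = term K x s n - term K x s (S n).
Proof.
  unfold term. rewrite !Dc_S, S_INR.
  replace (x + INR n + 1) with (x + (INR n + 1)%R) by (rewrite RtoC_plus; ring). ring.
Qed.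

Lemma term_0 (x s : C) (n : nat) : (0 < Re x)%R -> term 0 x s n = (INR n + 1) * pw s (x + INR n).
Proof.
  intros Hx. unfold term. simpl Dc. rewrite pw_shift; [ring|].
  assert (H := pos_INR n). unfold Re in *; simpl. lra.
Qed.

(** Uniform over |s| <= S and |x| <= X: the bound S + 1 also covers the exponent s - 1, and 2 + X is
    1 plus the bound 1 + X of |1 - x|. *)
Definition term_const (K : nat) (S X : R) : R :=
  (2 ^ K * (S + 1 + INR K) ^ K * exp (2 * (S + 1 + INR K)) * (2 + X))%R.

(** [Dc_pw_bound] and [pw_bound] for both halves of [term]; the extra 1 in the condition on [k] pays
    for the exponent s - 1. *)
Lemma term_bound (K k n : nat) (x s : C) (S X : R) :
  (0 < Re x)%R -> (Cmod s <= S)%R -> (Cmod x <= X)%R -> (INR k + 1 <= Re s + INR K)%R ->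
  (1 <= n)%nat -> (Cmod (term K x s n) <= term_const K S X / INR n ^ k)%R.
Proof.
  intros Hx Hs HX HK Hn.
  assert (HX0 := Cmod_ge_0 x). assert (HS0 := Cmod_ge_0 s). assert (HK0 := pos_INR K).
  assert (Hn1 := le_INR _ _ Hn). simpl in Hn1.
  assert (Hnk : (0 < INR n ^ k)%R) by (apply pow_lt; lra).
  set (E := (exp (2 * (S + 1 + INR K)) / INR n ^ k)%R).
  assert (HE : (0 <= E)%R) by (apply Rlt_le, Rdiv_lt_0_compat; [apply exp_pos | exact Hnk]).
  assert (HP : (0 <= 2 ^ K)%R) by (apply pow_le; lra).
  assert (B : forall s', (Cmod s' <= S + 1)%R -> (INR k <= Re s' + INR K)%R ->
     (Cmod (Dc K (pw s') (x + INR n)) <= 2 ^ K * (S + 1 + INR K) ^ K * E)%R).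
  { intros s' H1 H2. eapply Rle_trans; [apply (Dc_pw_bound K s' (x + INR n) E)|].
    - unfold Re in *; simpl. lra.
    - intros t Ht. eapply Rle_trans; [apply (pw_bound _ _ k n Hn)|].
      + unfold Re in *; simpl. lra.
      + unfold Re in *; simpl. lra.
      + apply Rmult_le_compat_r; [apply Rlt_le, Rinv_0_lt_compat; exact Hnk|].
        assert (A : (2 * Cmod (s' + INR K) <= 2 * (S + 1 + INR K))%R).
        { assert (T := Cmod_triangle s' (INR K)). rewrite Cmod_R, Rabs_pos_eq in T by exact HK0. lra. }
        destruct A as [A|A]; [apply Rlt_le, exp_increasing; exact A | rewrite A; lra].
    - apply Rmult_le_compat_r; [exact HE|]. apply Rmult_le_compat_l; [exact HP|].
      eapply Rle_trans; [apply poch_mod_le|]. apply pow_incr.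
      assert (Z := Cmod_ge_0 s'). lra. }
  unfold term. eapply Rle_trans; [apply Cmod_triangle|]. rewrite Cmod_mult.
  assert (B1 := B (s - 1)).
  assert (B2 := B s ltac:(lra) ltac:(lra)).
  assert (T1 := Cmod_triangle_minus s 1). assert (T2 := Cmod_triangle_minus 1 x).
  rewrite Cmod_1 in T1, T2.
  specialize (B1 ltac:(lra)). 
  assert (R1 : Re (s - 1) = (Re s - 1)%R) by reflexivity.
  specialize (B1 ltac:(lra)).
  replace (term_const K S X / INR n ^ k)%R with
    (2 ^ K * (S + 1 + INR K) ^ K * E + (1 + X) * (2 ^ K * (S + 1 + INR K) ^ K * E))%R
    by (unfold term_const, E; field; lra).
  apply Rplus_le_compat; [exact B1|].
  apply Rmult_le_compat; try apply Cmod_ge_0; [lra | exact B2].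
Qed.

Fixpoint psum (u : nat -> C) (N : nat) : C :=
  match N with O => 0 | S N => psum u N + u N end.

Definition sgn (n : nat) : C := (- (1)) ^ n.

Lemma sgn_S (n : nat) : sgn (S n) = - sgn n.
Proof. unfold sgn. simpl. ring. Qed.

Lemma sgn_plus (n m : nat) : sgn (n + m) = sgn n * sgn m.
Proof.
  induction n; [unfold sgn; simpl; ring|]. rewrite Nat.add_succ_l, !sgn_S, IHn. ring.
Qed.

Lemma Cmod_sgn (n : nat) : Cmod (sgn n) = 1%R.
Proof. unfold sgn. rewrite Cmod_pow, Cmod_m1. apply pow1. Qed.

(** Iterated means of consecutive partial sums: Euler's transformation of an alternating series. *)
Fixpoint emean (u : nat -> C) (K N : nat) : C :=
  match K with
  | O => psum u N
  | S K => (emean u K N + emean u K (S N)) / 2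
  end.

Definition clim (S : nat -> C) (l : C) : Prop :=
  forall eps : R, (0 < eps)%R -> exists N, forall n, (N <= n)%nat -> (Cmod (S n - l) <= eps)%R.

Lemma clim_unique (S : nat -> C) (l m : C) : clim S l -> clim S m -> l = m.
Proof.
  intros Hl Hm. apply Ceq_minus, Cmod_le_0. apply le_of_le_eps with (L := 2%R); [lra|].
  intros eps He. destruct (Hl eps He) as [N1 H1]. destruct (Hm eps He) as [N2 H2].
  specialize (H1 (N1 + N2)%nat ltac:(lia)). specialize (H2 (N1 + N2)%nat ltac:(lia)).
  assert (T := Cmod_triangle_3 l m (S (N1 + N2)%nat)).
  rewrite (Cmod_minus_sym l (S _)) in T. lra.
Qed.

Lemma clim_ext (S T : nat -> C) (l : C) : (forall n, S n = T n) -> clim S l -> clim T l.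
Proof.
  intros E H eps He. destruct (H eps He) as [N HN]. exists N. intros n Hn. rewrite <- E. auto.
Qed.

Lemma clim_const (l : C) : clim (fun _ => l) l.
Proof. intros eps He. exists 0%nat. intros. rewrite Cmod_zero_minus. lra. Qed.

Lemma clim_shift (S : nat -> C) (l : C) (k : nat) : clim S l -> clim (fun n => S (n + k)%nat) l.
Proof. intros H eps He. destruct (H eps He) as [N HN]. exists N. intros. apply HN. lia. Qed.

Lemma clim_plus (S T : nat -> C) (l m : C) : clim S l -> clim T m ->
  clim (fun n => S n + T n) (l + m).
Proof.
  intros HS HT eps He.
  destruct (HS (eps / 2)%R ltac:(lra)) as [N1 H1]. destruct (HT (eps / 2)%R ltac:(lra)) as [N2 H2].
  exists (N1 + N2)%nat. intros n Hn. specialize (H1 n ltac:(lia)). specialize (H2 n ltac:(lia)).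
  replace (S n + T n - (l + m)) with ((S n - l) + (T n - m)) by ring.
  eapply Rle_trans; [apply Cmod_triangle|]. lra.
Qed.

Lemma clim_scal (k : C) (S : nat -> C) (l : C) : clim S l -> clim (fun n => k * S n) (k * l).
Proof.
  intros H eps He. assert (Hk := Cmod_ge_0 k).
  destruct (H (eps / (Cmod k + 1))%R) as [N HN]; [apply Rdiv_lt_0_compat; lra|].
  exists N. intros n Hn. specialize (HN n Hn).
  rewrite <- Cmult_minus_distr_l, Cmod_mult.
  apply Rle_trans with (Cmod k * (eps / (Cmod k + 1)))%R; [apply Rmult_le_compat_l; assumption|].
  apply Rle_trans with ((Cmod k + 1) * (eps / (Cmod k + 1)))%R; [|apply Req_le; field; lra].
  apply Rmult_le_compat_r; [|lra]. apply Rlt_le, Rdiv_lt_0_compat; lra.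
Qed.

Lemma clim_bound_inv (S : nat -> C) (l : C) (B : R) :
  (forall N, (1 <= N)%nat -> (Cmod (S N - l) <= B / INR N)%R) -> clim S l.
Proof.
  intros H eps He.
  destruct (archimed (B / eps)) as [Ha _].
  exists (Z.to_nat (up (B / eps)) + 1)%nat. intros n Hn.
  eapply Rle_trans; [apply H; lia|].
  assert (Hn0 : (0 < INR n)%R) by (apply lt_0_INR; lia).
  apply Rmult_le_reg_r with (INR n); [exact Hn0|].
  unfold Rdiv. rewrite Rmult_assoc, Rinv_l, Rmult_1_r by lra.
  assert (H1 : (IZR (up (B / eps)) <= INR n)%R).
  { rewrite INR_IZR_INZ. apply IZR_le. lia. }
  apply (Rmult_lt_compat_r eps) in Ha; [|exact He].
  unfold Rdiv in Ha. rewrite Rmult_assoc, Rinv_l, Rmult_1_r in Ha by lra. nra.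
Qed.

Lemma clim_emean_S (u : nat -> C) (K : nat) (l : C) : clim (emean u K) l -> clim (emean u (S K)) l.
Proof.
  intros H. simpl. replace l with (/ 2 * (l + l)) by (field; intros E; apply RtoC_inj in E; lra).
  apply clim_ext with (S := fun N => / 2 * (emean u K N + emean u K (N + 1)%nat)).
  - intros n. rewrite Nat.add_1_r. unfold Cdiv. ring.
  - apply clim_scal, clim_plus; [exact H | apply clim_shift; exact H].
Qed.

Lemma clim_emean_le (u : nat -> C) (K K' : nat) (l : C) : (K <= K')%nat ->
  clim (emean u K) l -> clim (emean u K') l.
Proof. intros H Hl. induction H; [exact Hl | apply clim_emean_S; exact IHle]. Qed.

(** Averaging preserves limits, so both sequences can be compared at the common order K + K'. This
    makes [Zv] independent of the order. *)
Lemma clim_emean_unique (u : nat -> C) (K K' : nat) (l m : C) :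
  clim (emean u K) l -> clim (emean u K') m -> l = m.
Proof.
  intros Hl Hm. apply (clim_unique (emean u (K + K'))).
  - apply (clim_emean_le u K); [lia | exact Hl].
  - apply (clim_emean_le u K'); [lia | exact Hm].
Qed.

Lemma RtoC_2_neq_0 : RtoC 2 <> 0.
Proof. intros E. apply RtoC_inj in E. lra. Qed.

(** Averaging two consecutive increments of opposite sign replaces v K by half of its difference.
    This is the mechanism of the continuation: each order improves the decay of the increments by
    one power of N. *)
Lemma emean_step (v : nat -> nat -> C) (K N : nat) :
  (forall K n, v (S K) n = v K n - v K (S n)) ->
  emean (fun n => sgn n * v 0%nat n) K (S N) - emean (fun n => sgn n * v 0%nat n) K N
  = sgn N / 2 ^ K * v K N.
Proof.
  intros Hv. revert N. assert (H2 := RtoC_2_neq_0). induction K as [|K IH]; intros N.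
  - simpl. unfold Cdiv. rewrite <- RtoC_inv, Rinv_1 by lra. ring.
  - assert (H2K := Cpow_nz 2 K H2).
    simpl emean. simpl Cpow.
    replace ((emean (fun n => sgn n * v 0%nat n) K (S N) + emean (fun n => sgn n * v 0%nat n) K (S (S N))) / 2 -
      (emean (fun n => sgn n * v 0%nat n) K N + emean (fun n => sgn n * v 0%nat n) K (S N)) / 2)
    with (((emean (fun n => sgn n * v 0%nat n) K (S N) - emean (fun n => sgn n * v 0%nat n) K N) +
      (emean (fun n => sgn n * v 0%nat n) K (S (S N)) - emean (fun n => sgn n * v 0%nat n) K (S N))) / 2)
    by (field; exact H2).
    rewrite !IH, Hv, sgn_S. field. assumption.
Qed.

(** Telescoping [1/N^(k+2) <= 2 (1/N^(k+1) - 1/(N+1)^(k+1))] bounds the tails. *)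
Lemma clim_of_steps (S : nat -> C) (B : R) (k : nat) : (0 <= B)%R ->
  (forall N, (1 <= N)%nat -> (Cmod (S (1 + N)%nat - S N) <= B / INR N ^ (k + 2))%R) ->
  exists l, forall N, (1 <= N)%nat -> (Cmod (S N - l) <= 2 * B / INR N ^ (k + 1))%R.
Proof.
  intros HB H.
  assert (HC : forall N M, (1 <= N)%nat ->
     (Cmod (S (N + M)%nat - S N) <= 2 * B * (/ INR N ^ (k + 1) - / INR (N + M) ^ (k + 1)))%R).
  { intros N M HN. induction M as [|M IH].
    - rewrite Nat.add_0_r, Cmod_zero_minus. apply Req_le. ring.
    - assert (T := Cmod_triangle_3 (S (N + Datatypes.S M)%nat) (S N) (S (N + M)%nat)).
      assert (H1 := H (N + M)%nat ltac:(lia)).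
      replace (1 + (N + M))%nat with (N + Datatypes.S M)%nat in H1 by lia.
      eapply Rle_trans; [exact T|].
      assert (A : (B / INR (N + M) ^ (k + 2) <=
        2 * B * (/ INR (N + M) ^ (k + 1) - / INR (N + Datatypes.S M) ^ (k + 1)))%R).
      { replace (N + Datatypes.S M)%nat with (Datatypes.S (N + M)) by lia.
        set (n := (N + M)%nat). assert (Hn : (1 <= INR n)%R) by (apply (le_INR 1); unfold n; lia).
        rewrite S_INR. set (y := INR n) in *.
        assert (P1 : (0 < y ^ k)%R) by (apply pow_lt; lra).
        assert (P2 : (y ^ k <= (y + 1) ^ k)%R) by (apply pow_incr; lra).
        rewrite !pow_add. simpl. rewrite !Rmult_1_r.
        (* Replacing (y+1)^k by y^k leaves y^(-k) (1/y - 1/(y+1)) = y^(-k) / (y(y+1)), which is at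
           least half of y^(-k-2) since y >= 1. *)
        assert (Q : (/ ((y + 1) ^ k * (y + 1)) <= / (y ^ k * (y + 1)))%R).
        { apply Rinv_le_contravar; [nra|]. apply Rmult_le_compat_r; lra. }
        apply Rle_trans with (2 * B * (/ (y ^ k * y) - / (y ^ k * (y + 1))))%R.
        - replace (2 * B * (/ (y ^ k * y) - / (y ^ k * (y + 1))))%R
            with (B * (/ (y ^ k) * (2 / (y * (y + 1)))))%R by (field; lra).
          replace (B / (y ^ k * (y * y)))%R with (B * (/ (y ^ k) * / (y * y)))%R by (field; lra).
          apply Rmult_le_compat_l; [exact HB|]. apply Rmult_le_compat_l.
          + apply Rlt_le, Rinv_0_lt_compat. exact P1.
          + replace (2 / (y * (y + 1)))%R with (/ (y * (y + 1) / 2))%R by (field; lra).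
            apply Rinv_le_contravar; nra.
        - apply Rmult_le_compat_l; lra. }
      lra. }
  assert (Hpos : forall N, (1 <= N)%nat -> (0 <= / INR N ^ (k + 1))%R).
  { intros N HN. apply Rlt_le, Rinv_0_lt_compat, pow_lt, lt_0_INR. lia. }
  assert (HC2 : forall N M, (1 <= N)%nat -> (N <= M)%nat ->
     (Cmod (S M - S N) <= 2 * B / INR N ^ (k + 1))%R).
  { intros N M HN HM. replace M with (N + (M - N))%nat by lia.
    eapply Rle_trans; [apply HC; exact HN|]. unfold Rdiv.
    apply Rmult_le_compat_l; [lra|]. assert (X := Hpos (N + (M - N))%nat ltac:(lia)). lra. }
  assert (HA : forall e : R, (0 < e)%R -> exists N, (1 <= N)%nat /\ (4 * B / INR N ^ (k + 1) < e)%R).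
  { intros e He. destruct (archimed (4 * B / e)) as [Ha _].
    exists (Z.to_nat (up (4 * B / e)) + 1)%nat. split; [lia|].
    set (n := (Z.to_nat (up (4 * B / e)) + 1)%nat).
    assert (Hn : (1 <= INR n)%R) by (apply (le_INR 1); unfold n; lia).
    assert (Hn2 : (INR n <= INR n ^ (k + 1))%R).
    { rewrite pow_add, pow_1. assert (1 <= INR n ^ k)%R by (apply pow_R1_Rle; exact Hn). nra. }
    assert (H1 : (IZR (up (4 * B / e)) <= INR n)%R).
    { rewrite INR_IZR_INZ. apply IZR_le. unfold n. lia. }
    apply Rmult_lt_reg_r with (INR n ^ (k + 1))%R; [lra|].
    unfold Rdiv. rewrite Rmult_assoc, Rinv_l, Rmult_1_r by lra.
    apply (Rmult_lt_compat_r e) in Ha; [|exact He].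
    unfold Rdiv in Ha. rewrite Rmult_assoc, Rinv_l, Rmult_1_r in Ha by lra. nra. }
  (* [p] stands for [Re] or [Im]: the completeness used is that of the reals. *)
  assert (HCau : forall p : C -> R, (forall z, (Rabs (p z) <= Cmod z)%R) ->
      (forall z w, p (z - w) = (p z - p w)%R) -> {l : R | Un_cv (fun n => p (S n)) l}).
  { intros p Hp Hpm. apply Rcomplete.R_complete. intros e He.
    destruct (HA e He) as [N [HN1 HN2]]. exists N. intros n m Hn Hm.
    unfold R_dist. rewrite <- Hpm. eapply Rle_lt_trans; [apply Hp|].
    eapply Rle_lt_trans; [apply (Cmod_triangle_3 _ _ (S N))|].
    assert (X := HC2 N n HN1 Hn). assert (Y := HC2 N m HN1 Hm).
    rewrite (Cmod_minus_sym (S N)). unfold Rdiv in *. lra. }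
  destruct (HCau Re) as [l1 L1]; [apply re_le_Cmod | reflexivity|].
  destruct (HCau Im) as [l2 L2]; [apply Re_Im_le_Cmod | reflexivity|].
  exists (l1, l2). intros N HN.
  apply Rnot_lt_le. intros Hc.
  (* If the bound failed by [gap], some far term S M closer than [gap] to the limit would violate
     [HC2]. *)
  set (gap := (Cmod (S N - (l1, l2)) - 2 * B / INR N ^ (k + 1))%R).
  assert (Hg : (0 < gap)%R) by (unfold gap; lra).
  destruct (L1 (gap / 2)%R ltac:(lra)) as [N1 H1]. destruct (L2 (gap / 2)%R ltac:(lra)) as [N2 H2].
  set (M := (N + N1 + N2)%nat).
  specialize (H1 M ltac:(unfold M; lia)). specialize (H2 M ltac:(unfold M; lia)).
  unfold R_dist in H1, H2.
  assert (T := Cmod_triangle_3 (S N) (l1, l2) (S M)).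
  assert (X := HC2 N M HN ltac:(unfold M; lia)).
  assert (Y := Cmod_le_sum (S M - (l1, l2))).
  rewrite (Cmod_minus_sym (S N) (S M)) in T.
  replace (Re (S M - (l1, l2))) with (Re (S M) - l1)%R in Y by reflexivity.
  replace (Im (S M - (l1, l2))) with (Im (S M) - l2)%R in Y by reflexivity.
  unfold gap in *. lra.
Qed.

(** * The continuation for periods (1,1) *)

Definition emZ (K : nat) (x s : C) (N : nat) : C := emean (fun n => sgn n * term 0 x s n) K N.

Lemma emZ_step (K : nat) (x s : C) (N : nat) :
  emZ K x s (S N) - emZ K x s N = sgn N / 2 ^ K * term K x s N.
Proof. apply (emean_step (fun K n => term K x s n)). intros. apply term_S. Qed.

Lemma Cmod_sgn_pow2_le (K N : nat) (z : C) : (Cmod (sgn N / 2 ^ K * z) <= Cmod z)%R.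
Proof.
  rewrite Cmod_mult, Cmod_div by (apply Cpow_nz, RtoC_2_neq_0).
  rewrite Cmod_sgn, Cmod_pow, Cmod_R, Rabs_pos_eq by lra.
  rewrite <- (Rmult_1_l (Cmod z)) at 2. apply Rmult_le_compat_r; [apply Cmod_ge_0|].
  assert (H : (1 <= 2 ^ K)%R) by (apply pow_R1_Rle; lra).
  apply Rmult_le_reg_r with (2 ^ K)%R; [lra|].
  unfold Rdiv. rewrite Rmult_assoc, Rinv_l by lra. lra.
Qed.

Lemma term_const_pos (K : nat) (S X : R) : (0 <= S)%R -> (0 <= X)%R -> (0 <= term_const K S X)%R.
Proof.
  intros HS HX. assert (H := pos_INR K). unfold term_const.
  repeat apply Rmult_le_pos; try lra; try (apply pow_le; lra). apply Rlt_le, exp_pos.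
Qed.

(** The threshold 3 makes the increments O(N^(-2)), so that they can be summed with a tail O(1/N).
    The constant depends only on bounds for [s] and [x], which gives the uniformity asked by
    Weierstrass' theorem. *)
Lemma emZ_converges (K : nat) (x s : C) (S X : R) :
  (0 < Re x)%R -> (Cmod s <= S)%R -> (Cmod x <= X)%R -> (3 <= Re s + INR K)%R ->
  exists l, forall N, (1 <= N)%nat -> (Cmod (emZ K x s N - l) <= 2 * term_const K S X / INR N)%R.
Proof.
  intros Hx HS HX HK.
  destruct (clim_of_steps (emZ K x s) (term_const K S X) 0) as [l Hl].
  - apply term_const_pos.
    + assert (H := Cmod_ge_0 s). lra.
    + assert (H := Cmod_ge_0 x). lra.
  - intros N HN. change (1 + N)%nat with (Datatypes.S N). rewrite emZ_step.
    eapply Rle_trans; [apply Cmod_sgn_pow2_le|].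
    apply term_bound; try assumption. simpl. lra.
  - exists l. intros N HN. specialize (Hl N HN). rewrite pow_1 in Hl. exact Hl.
Qed.

(** The value at [s] of the entire continuation of [zeta_(E,2)(., x, (1,1))]: the limit of the
    Euler means of any sufficiently large order. *)
Definition Zv (x s : C) : C :=
  epsilon (inhabits (RtoC 0)) (fun l => exists K, clim (emZ K x s) l).

Lemma Zv_eq (K : nat) (x s l : C) : clim (emZ K x s) l -> Zv x s = l.
Proof.
  intros H. unfold Zv.
  destruct (epsilon_spec (inhabits (RtoC 0)) (fun l => exists K, clim (emZ K x s) l)
    (ex_intro _ l (ex_intro _ K H))) as [K' H'].
  exact (clim_emean_unique _ _ _ _ _ H' H).
Qed.

Lemma Zv_approx (K : nat) (x s : C) (S X : R) (N : nat) :
  (0 < Re x)%R -> (Cmod s <= S)%R -> (Cmod x <= X)%R -> (3 <= Re s + INR K)%R ->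
  (1 <= N)%nat -> (Cmod (emZ K x s N - Zv x s) <= 2 * term_const K S X / INR N)%R.
Proof.
  intros Hx HS HX HK HN.
  destruct (emZ_converges K x s S X Hx HS HX HK) as [l Hl].
  rewrite (Zv_eq K x s l); [auto|]. apply clim_bound_inv with (1 := Hl).
Qed.

Lemma Zv_clim (K : nat) (x s : C) : (0 < Re x)%R -> (3 <= Re s + INR K)%R -> clim (emZ K x s) (Zv x s).
Proof.
  intros Hx HK. eapply clim_bound_inv. intros N HN.
  apply (Zv_approx K x s (Cmod s) (Cmod x)); try assumption; apply Rle_refl.
Qed.

Lemma exists_INR_ge (r : R) : exists n, (r <= INR n)%R.
Proof.
  destruct (archimed r) as [H _]. exists (Z.to_nat (up r)).
  rewrite INR_IZR_INZ. eapply Rle_trans; [apply Rlt_le; exact H|]. apply IZR_le. lia.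
Qed.

Lemma emean_cderiv (u : C -> nat -> C) (u' : nat -> C) (s : C) (K N : nat) :
  (forall n, cderiv (fun s => u s n) s (u' n)) ->
  cderiv (fun s => emean (u s) K N) s (emean u' K N).
Proof.
  intros H. revert N. induction K as [|K IH]; intros N; simpl.
  - induction N as [|N IHN]; simpl; [apply cderiv_const | apply cderiv_plus; auto].
  - eapply cderiv_eq.
    + apply (cderiv_ext (fun s => / 2 * (emean (u s) K N + emean (u s) K (S N)))).
      * intros w. unfold Cdiv. ring.
      * apply cderiv_scal, cderiv_plus; apply IH.
    + unfold Cdiv. ring.
Qed.

Lemma emean_cdiff (u : C -> nat -> C) (s : C) (K N : nat) :
  (forall n, cdiff (fun s => u s n) s) -> cdiff (fun s => emean (u s) K N) s.
Proof.
  intros H. eexists. apply (emean_cderiv u (fun n => C_derive (fun s => u s n) s)).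
  intros n. destruct (H n) as [l Hl]. rewrite (is_C_derive_unique _ _ _ Hl). exact Hl.
Qed.

Definition term' (x s : C) (n : nat) : C :=
  - Clog (x + INR n) * pw (s - 1) (x + INR n) + (1 - x) * (- Clog (x + INR n) * pw s (x + INR n)).

Lemma cderiv_term (x s : C) (n : nat) : cderiv (fun s => sgn n * term 0 x s n) s (sgn n * term' x s n).
Proof.
  apply cderiv_scal. unfold term, term'; simpl Dc. apply cderiv_plus.
  - eapply cderiv_eq.
    + apply (cderiv_comp (fun s => pw s (x + INR n)) (fun s => s - 1)).
      * apply cderiv_pw_s.
      * apply cderiv_minus; [apply cderiv_id | apply cderiv_const].
    + cbv beta. ring.
  - apply cderiv_scal. apply cderiv_pw_s.
Qed.

Definition emZ' (K : nat) (x s : C) (N : nat) : C := emean (fun n => sgn n * term' x s n) K N.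

Lemma cderiv_emZ (K : nat) (x s : C) (N : nat) : cderiv (fun s => emZ K x s N) s (emZ' K x s N).
Proof.
  apply (emean_cderiv (fun s n => sgn n * term 0 x s n)). intros n. apply cderiv_term.
Qed.

Lemma Zv_cdiff (x s : C) : (0 < Re x)%R -> cdiff (Zv x) s.
Proof.
  intros Hx. destruct (exists_INR_ge (4 - Re s)) as [K HK].
  destruct (Weierstrass_uniform_limit (fun n s => emZ K x s n) (fun n => emZ' K x s n) (Zv x) s 1)
    as [D [HD _]].
  - lra.
  - intros n w _. eexists. apply cderiv_emZ.
  - intros n. apply cderiv_emZ.
  - intros eps He.
    set (B := (2 * term_const K (Cmod s + 1) (Cmod x))%R).
    assert (HB : forall N, (1 <= N)%nat -> forall w, (Cmod (w - s) < 1)%R ->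
       (Cmod (emZ K x w N - Zv x w) <= B / INR N)%R).
    { intros N HN w Hw. apply Zv_approx; try assumption; try apply Rle_refl.
      - assert (T := Cmod_triangle_rev w s). lra.
      - destruct (dist_in_sq _ _ _ Hw). lra. }
    destruct (clim_bound_inv (fun n => RtoC (B / INR n)) 0 B) with (eps := eps) as [N HN].
    { intros N HN. replace (RtoC (B / INR N) - 0) with (RtoC (B / INR N)) by ring.
      rewrite Cmod_R, Rabs_pos_eq; [lra|]. apply Rmult_le_pos.
      - unfold B. apply Rmult_le_pos; [lra|]. apply term_const_pos; [|apply Cmod_ge_0].
        assert (X := Cmod_ge_0 s). lra.
      - apply Rlt_le, Rinv_0_lt_compat, lt_0_INR. lia. }
    { exact He. }
    exists (N + 1)%nat. intros n Hn w Hw. eapply Rle_trans; [apply HB; [lia|exact Hw]|].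
    specialize (HN n ltac:(lia)).
    replace (RtoC (B / INR n) - 0) with (RtoC (B / INR n)) in HN by ring.
    rewrite Cmod_R in HN. eapply Rle_trans; [apply Rle_abs | exact HN].
  - exists D. exact HD.
Qed.

Definition Dz (x : C) : C := C_derive (Zv x) 0.

Lemma cderiv_Zv_0 (x : C) : (0 < Re x)%R -> cderiv (Zv x) 0 (Dz x).
Proof.
  intros Hx. destruct (Zv_cdiff x 0 Hx) as [l Hl]. unfold Dz.
  rewrite (is_C_derive_unique _ _ _ Hl). exact Hl.
Qed.

(** Turns the rate of convergence of functions of s into a rate for their derivatives at 0, as
    [emZ'_approx] uses it. *)
Lemma Cauchy_estimate (f : C -> C) (a l : C) (r M : R) : (0 < r)%R ->
  (forall w, (Cmod (w - a) <= 2 * r)%R -> cdiff f w) ->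
  (forall w, (Cmod (w - a) <= 2 * r)%R -> (Cmod (f w) <= M)%R) ->
  cderiv f a l -> (Cmod l <= Cmod (/ C2pi_i) * (16 * M / r))%R.
Proof.
  intros Hr Hf HM Hl.
  assert (Hsq : forall w, on_sq a r w -> (Cmod (w - a) <= 2 * r)%R).
  { intros w Hw. apply on_sq_dist in Hw; lra. }
  assert (Haa : (Cmod (a - a) < r)%R) by (rewrite Cmod_zero_minus; lra).
  assert (E : l = / C2pi_i * sq (fun w => f w / ((w - a) * (w - a))) a r).
  { apply (cderiv_unique f a); [exact Hl|].
    apply (cderiv_ext_loc (fun z => / C2pi_i * sq (fun w => f w / (w - z)) a r)).
    - exists r. split; [assumption|]. intros z Hz. rewrite Cauchy_square by assumption. field.
      exact C2pi_i_neq_0.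
    - apply cderiv_scal. apply Cauchy_integral_cderiv; try assumption.
      intros w Hw. apply cdiff_ccont. auto. }
  rewrite E, Cmod_mult. apply Rmult_le_compat_l; [apply Cmod_ge_0|].
  assert (N1 : forall w, on_sq a r w -> w - a <> 0 /\ (r <= Cmod (w - a))%R).
  { intros w Hw. destruct (on_sq_neq a w a r) as [X Y]; try lra; try assumption.
    split; [exact X|]. rewrite Cmod_zero_minus in Y. lra. }
  replace (16 * M / r)%R with (16 * (M / (r * r)) * r)%R by (field; lra).
  apply sq_bound; [lra| |].
  - intros w Hw. apply ccont_div.
    + apply cdiff_ccont. auto.
    + apply ccont_mult; apply ccont_sub_const.
    + apply Cmult_neq_0; apply N1; exact Hw.
  - intros w Hw. destruct (N1 w Hw) as [N2 N3].
    rewrite Cmod_div, Cmod_mult by (apply Cmult_neq_0; exact N2).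
    apply Rmult_le_compat; [apply Cmod_ge_0| | auto|].
    + apply Rlt_le, Rinv_0_lt_compat. nra.
    + apply Rinv_le_contravar; [nra|]. apply Rmult_le_compat; lra.
Qed.

(** Cauchy's estimate on |s| <= 1, where Re s >= -1 makes the order 4 sufficient. The bound is
    uniform for |x| <= X, so [Dz] is a locally uniform limit in the variable x. With r = 1/2 the
    constant is 16 * 2 / (1/2) = 64. *)
Lemma emZ'_approx (x : C) (X : R) (N : nat) : (0 < Re x)%R -> (Cmod x <= X)%R -> (1 <= N)%nat ->
  (Cmod (emZ' 4 x 0 N - Dz x) <= Cmod (/ C2pi_i) * (64 * term_const 4 1 X) / INR N)%R.
Proof.
  intros Hx HX HN.
  assert (HN0 : (0 < INR N)%R) by (apply lt_0_INR; lia).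
  replace (Cmod (/ C2pi_i) * (64 * term_const 4 1 X) / INR N)%R
    with (Cmod (/ C2pi_i) * (16 * (2 * term_const 4 1 X / INR N) / (1 / 2)))%R by (field; lra).
  apply (Cauchy_estimate (fun s => emZ 4 x s N - Zv x s) 0); [lra| | |].
  - intros w _. apply cdiff_minus; [eexists; apply cderiv_emZ | apply Zv_cdiff; exact Hx].
  - intros w Hw. replace (w - 0) with w in Hw by ring. apply Zv_approx; try assumption; [lra|].
    destruct (Re_Im_le_Cmod w) as [A _]. assert (A' := Rle_abs (- Re w)). rewrite Rabs_Ropp in A'.
    simpl. lra.
  - apply cderiv_minus; [apply cderiv_emZ | apply cderiv_Zv_0; exact Hx].
Qed.

Lemma Re_plus_nat (x : C) (n : nat) : (0 < Re x)%R -> (0 < Re (x + INR n))%R.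
Proof. intros H. assert (X := pos_INR n). unfold Re in *; simpl. lra. Qed.

(** Weierstrass' theorem once more, now in x, on the disc of radius Re x0, which stays in the right
    half-plane. *)
Lemma Dz_cdiff (x0 : C) : (0 < Re x0)%R -> cdiff Dz x0.
Proof.
  intros Hx0.
  assert (Hball : forall w, (Cmod (w - x0) < Re x0)%R -> (0 < Re w)%R).
  { intros w Hw. destruct (dist_in_sq _ _ _ Hw). lra. }
  assert (Hd : forall n w, (Cmod (w - x0) < Re x0)%R -> cdiff (fun x => emZ' 4 x 0 n) w).
  { intros n w Hw. apply (emean_cdiff (fun x n => sgn n * term' x 0 n)). intros k.
    apply cdiff_mult; [apply cdiff_const|]. unfold term'.
    assert (Hk := Re_plus_nat w k (Hball w Hw)).
    assert (Hs : cdiff (fun x => x + INR k) w) by (apply cdiff_plus; [apply cdiff_id| apply cdiff_const]).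
    assert (HL : cdiff (fun x => Clog (x + INR k)) w).
    { apply (cdiff_comp Clog); [|exact Hs]. eexists. apply cderiv_Clog. exact Hk. }
    assert (HP : forall s, cdiff (fun x => pw s (x + INR k)) w).
    { intros s. apply (cdiff_comp (pw s)); [|exact Hs]. eexists. apply cderiv_pw_z. exact Hk. }
    apply cdiff_plus.
    - apply cdiff_mult; [apply cdiff_opp; exact HL | apply HP].
    - apply cdiff_mult; [apply cdiff_minus; [apply cdiff_const | apply cdiff_id]|].
      apply cdiff_mult; [apply cdiff_opp; exact HL | apply HP]. }
  destruct (Weierstrass_uniform_limit (fun n x => emZ' 4 x 0 n)
    (fun n => C_derive (fun x => emZ' 4 x 0 n) x0) Dz x0 (Re x0)) as [D [HD _]].
  - exact Hx0.
  - exact Hd.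
  - intros n. destruct (Hd n x0) as [l Hl]; [rewrite Cmod_zero_minus; exact Hx0|].
    rewrite (is_C_derive_unique _ _ _ Hl). exact Hl.
  - intros eps He.
    set (B := (Cmod (/ C2pi_i) * (64 * term_const 4 1 (Cmod x0 + Re x0)))%R).
    destruct (clim_bound_inv (fun n => RtoC (B / INR n)) 0 B) with (eps := eps) as [N HN].
    { intros N HN. replace (RtoC (B / INR N) - 0) with (RtoC (B / INR N)) by ring.
      rewrite Cmod_R, Rabs_pos_eq; [lra|]. apply Rmult_le_pos.
      - unfold B. apply Rmult_le_pos; [apply Cmod_ge_0|]. apply Rmult_le_pos; [lra|].
        apply term_const_pos; [lra|]. assert (X := Cmod_ge_0 x0). lra.
      - apply Rlt_le, Rinv_0_lt_compat, lt_0_INR. lia. }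
    { exact He. }
    exists (N + 1)%nat. intros n Hn w Hw.
    eapply Rle_trans; [apply (emZ'_approx w (Cmod x0 + Re x0)); [apply Hball; exact Hw| |lia]|].
    + assert (T := Cmod_triangle_rev w x0). lra.
    + fold B. specialize (HN n ltac:(lia)).
      replace (RtoC (B / INR n) - 0) with (RtoC (B / INR n)) in HN by ring.
      rewrite Cmod_R in HN. eapply Rle_trans; [apply Rle_abs | exact HN].
  - exists D. exact HD.
Qed.

(** With the offsets N+2, N+1, N all three sums end at the same power, and the relation holds
    exactly at every stage and order: the coefficients n+3, -2(n+2), n+1 add up to 0 and only x^(-s)
    survives. *)
Lemma emZ_shift (K : nat) (x s : C) (N : nat) : (0 < Re x)%R ->
  emZ K x s (S (S N)) + 2 * emZ K (x + 1) s (S N) + emZ K (x + 2) s N = pw s x.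
Proof.
  intros Hx.
  assert (H1 : (0 < Re (x + 1))%R) by (unfold Re in *; simpl; lra).
  assert (H2 : (0 < Re (x + 2))%R) by (unfold Re in *; simpl; lra).
  assert (T : forall n, sgn (S (S n)) * term 0 x s (S (S n)) + 2 * (sgn (S n) * term 0 (x + 1) s (S n))
     + sgn n * term 0 (x + 2) s n = 0).
  { intros n. rewrite !term_0 by assumption. rewrite !sgn_S, !S_INR, !RtoC_plus.
    replace (x + 1 + (INR n + 1)) with (x + (INR n + 1 + 1)) by ring.
    replace (x + 2 + INR n) with (x + (INR n + 1 + 1)) by ring. ring. }
  revert N. induction K as [|K IH]; intros N.
  - unfold emZ; cbn [emean]. induction N as [|N IHN].
    + simpl psum. rewrite !term_0 by assumption. rewrite sgn_S. unfold sgn; simpl.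
      replace (x + 1 + 0) with (x + 1) by ring. replace (x + 0) with x by ring. ring.
    + assert (PS : forall u M, psum u (S M) = psum u M + u M) by reflexivity.
      rewrite <- IHN, (PS _ (S (S N))), (PS (fun n => sgn n * term 0 (x + 1) s n) (S N)),
        (PS (fun n => sgn n * term 0 (x + 2) s n) N).
      match goal with |- _ = ?r => rewrite <- (Cplus_0_r r) end. rewrite <- (T N). ring.
  - assert (E : forall y M, emZ (S K) y s M = (emZ K y s M + emZ K y s (S M)) / 2) by reflexivity.
    rewrite !E. assert (A := IH N). assert (B := IH (S N)).
    transitivity ((pw s x + pw s x) / 2); [|field; exact RtoC_2_neq_0].
    rewrite <- A at 1. rewrite <- B. field.
Qed.

Lemma Zv_shift (x s : C) : (0 < Re x)%R -> Zv x s + 2 * Zv (x + 1) s + Zv (x + 2) s = pw s x.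
Proof.
  intros Hx.
  assert (H1 : (0 < Re (x + 1))%R) by (unfold Re in *; simpl; lra).
  assert (H2 : (0 < Re (x + 2))%R) by (unfold Re in *; simpl; lra).
  destruct (exists_INR_ge (3 - Re s)) as [K HK].
  apply (clim_unique (fun N => emZ K x s (N + 2)%nat + 2 * emZ K (x + 1) s (N + 1)%nat + emZ K (x + 2) s N)).
  - apply clim_plus; [apply clim_plus|].
    + apply (clim_shift (emZ K x s)). apply Zv_clim; [exact Hx | lra].
    + apply clim_scal. apply (clim_shift (emZ K (x + 1) s)). apply Zv_clim; [exact H1 | lra].
    + apply Zv_clim; [exact H2 | lra].
  - apply clim_ext with (S := fun _ => pw s x); [|apply clim_const].
    intros N. rewrite Nat.add_1_r. replace (N + 2)%nat with (S (S N)) by lia.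
    symmetry. apply emZ_shift. exact Hx.
Qed.

Lemma Dz_shift (x : C) : (0 < Re x)%R -> Dz x + 2 * Dz (x + 1) + Dz (x + 2) = - Clog x.
Proof.
  intros Hx.
  assert (H1 : (0 < Re (x + 1))%R) by (unfold Re in *; simpl; lra).
  assert (H2 : (0 < Re (x + 2))%R) by (unfold Re in *; simpl; lra).
  apply (cderiv_unique (fun s => pw s x) 0).
  - apply (cderiv_ext (fun s => Zv x s + 2 * Zv (x + 1) s + Zv (x + 2) s)).
    + intros s. apply Zv_shift. exact Hx.
    + apply cderiv_plus; [apply cderiv_plus; [|apply cderiv_scal]|]; apply cderiv_Zv_0; assumption.
  - eapply cderiv_eq; [apply cderiv_pw_s|]. rewrite pw_0. ring.
Qed.

(** At s = 0 the series is 1 - 2 + 3 - ..., whatever x is. Third differences of n+1 vanish, so its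
    Euler means of order 3 do not depend on N and can be read off at N = 0. *)
Lemma Zv_0 (x : C) : (0 < Re x)%R -> Zv x 0 = / 4.
Proof.
  intros Hx. apply (Zv_eq 3).
  apply clim_ext with (S := fun _ => / 4); [|apply clim_const].
  assert (H2 := RtoC_2_neq_0).
  assert (H4 : RtoC 4 <> 0) by (intros E; apply RtoC_inj in E; lra).
  induction n as [|n IH].
  - unfold emZ; simpl emean. simpl psum. rewrite !term_0 by assumption. rewrite !pw_0.
    unfold sgn; simpl. rewrite !RtoC_plus. field.
  - assert (E : emZ 3 x 0 (S n) - emZ 3 x 0 n = 0).
    { rewrite emZ_step, !term_S, !term_0 by assumption. rewrite !pw_0.
      rewrite !S_INR, !RtoC_plus. ring. }
    apply Ceq_minus in E. rewrite E. exact IH.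
Qed.

(** * Odd integer periods *)

Lemma is_series_clim (u : nat -> C) (l : C) :
  is_series (K := C_AbsRing) (V := C_NormedModule) u l <-> clim (psum u) l.
Proof.
  (* [sum_n] includes its last index, [psum] stops before it. *)
  assert (E : forall n, sum_n (G := C_NormedModule) u n = psum u (S n)).
  { induction n as [|n IH].
    - rewrite sum_O. simpl. symmetry. apply Cplus_0_l.
    - rewrite sum_Sn, IH. reflexivity. }
  split.
  - intros H eps He.
    assert (L : locally (T := C_UniformSpace) l (fun y => (Cmod (y - l) < eps)%R)).
    { apply locally_Cmod. exists eps. auto. }
    destruct (H _ L) as [N HN]. exists (S N). intros n Hn.
    destruct n as [|n]; [lia|]. rewrite <- E. apply Rlt_le. apply HN. lia.
  - intros H P HP. apply locally_Cmod in HP. destruct HP as [d [Hd HP]].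
    destruct (H (d / 2)%R ltac:(lra)) as [N HN]. exists N. intros n Hn. apply HP.
    rewrite E. eapply Rle_lt_trans; [apply HN; lia | lra].
Qed.

(** * Finite sums and residue classes *)

Lemma psum_ext (u v : nat -> C) (N : nat) : (forall n, (n < N)%nat -> u n = v n) -> psum u N = psum v N.
Proof.
  induction N; intros H; simpl; [reflexivity|]. rewrite IHN, H by (intros; auto with arith). reflexivity.
Qed.

Lemma psum_scal (k : C) (u : nat -> C) (N : nat) : psum (fun n => k * u n) N = k * psum u N.
Proof. induction N; simpl; [ring|]. rewrite IHN. ring. Qed.

Lemma psum_plus (u v : nat -> C) (N : nat) : psum (fun n => u n + v n) N = psum u N + psum v N.
Proof. induction N; simpl; [ring|]. rewrite IHN. ring. Qed.

Lemma psum_swap (u : nat -> nat -> C) (M N : nat) :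
  psum (fun m => psum (u m) N) M = psum (fun n => psum (fun m => u m n) M) N.
Proof.
  induction M; simpl.
  - induction N; simpl; [reflexivity|]. rewrite <- IHN. ring.
  - rewrite IHM, <- psum_plus. reflexivity.
Qed.

Lemma psum_add (u : nat -> C) (M N : nat) : psum u (M + N) = psum u M + psum (fun n => u (M + n)%nat) N.
Proof.
  induction N; simpl; [rewrite Nat.add_0_r; ring|].
  rewrite Nat.add_succ_r. simpl. rewrite IHN. ring.
Qed.

Lemma clim_psum (F : nat -> nat -> C) (l : nat -> C) (p : nat) :
  (forall k, (k < p)%nat -> clim (F k) (l k)) ->
  clim (fun n => psum (fun k => F k n) p) (psum l p).
Proof.
  induction p; intros H; simpl; [apply clim_const|].
  apply clim_plus; [apply IHp; auto with arith | apply H; auto with arith].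
Qed.

Lemma psum_update (g h : nat -> C) (j p : nat) (d : C) : (j < p)%nat ->
  (forall k, k <> j -> g k = h k) -> g j = h j + d -> psum g p = psum h p + d.
Proof.
  intros Hj Hk Hg. induction p; [lia|]. simpl.
  destruct (Nat.eq_dec j p) as [->|Hne].
  - rewrite (psum_ext g h) by (intros; apply Hk; lia). rewrite Hg. ring.
  - rewrite IHp by lia. rewrite Hk by lia. ring.
Qed.

(** Among the first p n + j indices, the residue classes k < j have received one more term than the
    others. An inner induction on j adds the terms one at a time, and its end j = p is the next case
    of the induction on n. *)
Lemma psum_dissect (u : nat -> C) (p n j : nat) : (j <= p)%nat ->
  psum u (p * n + j) =
  psum (fun k => psum (fun i => u (p * i + k)%nat) (if k <? j then S n else n)) p.
Proof.
  intros Hj. revert j Hj.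
  assert (Hstep : forall n, 
    psum u (p * n) = psum (fun k => psum (fun i => u (p * i + k)%nat) n) p ->
    forall j, (j <= p)%nat -> psum u (p * n + j) =
      psum (fun k => psum (fun i => u (p * i + k)%nat) (if k <? j then S n else n)) p).
  { clear n. intros n H0. induction j as [|j IH]; intros Hj.
    - rewrite Nat.add_0_r, H0. apply psum_ext. intros k _. reflexivity.
    - rewrite Nat.add_succ_r. simpl psum at 1. rewrite IH by lia. symmetry.
      apply psum_update with (j := j); [lia| |].
      + intros k Hk. destruct (Nat.ltb_spec k (S j)), (Nat.ltb_spec k j); try lia; reflexivity.
      + destruct (Nat.ltb_spec j (S j)), (Nat.ltb_spec j j); try lia. reflexivity. }
  assert (H0 : psum u (p * n) = psum (fun k => psum (fun i => u (p * i + k)%nat) n) p).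
  { induction n as [|n IH].
    - rewrite Nat.mul_0_r. simpl. symmetry. clear. induction p; simpl; [reflexivity|]. rewrite IHp. ring.
    - rewrite Nat.mul_succ_r, (Hstep n IH p) by lia. apply psum_ext.
      intros k Hk. destruct (Nat.ltb_spec k p); [reflexivity | lia]. }
  apply Hstep. exact H0.
Qed.

(** No rearrangement takes place: a partial sum of [u] is a sum of p partial sums, one for each
    class, whose lengths differ by at most one. Convergence of every class therefore suffices. *)
Lemma clim_dissect (u : nat -> C) (l : nat -> C) (p : nat) : (0 < p)%nat ->
  (forall k, (k < p)%nat -> clim (psum (fun i => u (p * i + k)%nat)) (l k)) ->
  clim (psum u) (psum l p).
Proof.
  intros Hp H eps He.
  assert (HU : forall q, (q <= p)%nat -> exists N, forall k, (k < q)%nat -> forall n, (N <= n)%nat ->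
     (Cmod (psum (fun i => u (p * i + k)%nat) n - l k) <= eps / INR p)%R).
  { induction q as [|q IH]; intros Hq; [exists 0%nat; intros; lia|].
    destruct (IH ltac:(lia)) as [N1 H1].
    destruct (H q ltac:(lia) (eps / INR p)%R) as [N2 H2].
    { apply Rdiv_lt_0_compat; [exact He | apply lt_0_INR; lia]. }
    exists (N1 + N2)%nat. intros k Hk n Hn.
    destruct (Nat.eq_dec k q) as [->|Hne]; [apply H2; lia | apply H1; lia]. }
  destruct (HU p (le_n p)) as [N HN].
  exists (p * N)%nat. intros n Hn.
  assert (HpN : (0 < INR p)%R) by (apply lt_0_INR; lia).
  assert (Hm : (n mod p < p)%nat) by (apply Nat.mod_upper_bound; lia).
  assert (HnN : (N <= n / p)%nat) by (apply Nat.div_le_lower_bound; lia).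
  rewrite (Nat.div_mod_eq n p), psum_dissect by lia.
  assert (B : forall (g h : nat -> C) q, (forall k, (k < q)%nat -> (Cmod (g k - h k) <= eps / INR p)%R) ->
     (Cmod (psum g q - psum h q) <= INR q * (eps / INR p))%R).
  { intros g h. induction q as [|q IH]; intros Hq.
    - simpl. rewrite Cmod_zero_minus. lra.
    - rewrite S_INR. simpl psum.
      replace (psum g q + g q - (psum h q + h q)) with ((psum g q - psum h q) + (g q - h q)) by ring.
      eapply Rle_trans; [apply Cmod_triangle|].
      specialize (IH ltac:(intros; apply Hq; lia)). specialize (Hq q ltac:(lia)). lra. }
  eapply Rle_trans; [apply B|].
  - intros k Hk. apply HN; [exact Hk|]. destruct (k <? n mod p); lia.
  - apply Req_le. field. lra.
Qed.

(** * The double series of periods (1,1) *)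

Definition dterm (x s : C) (m1 m2 : nat) : C := sgn (m1 + m2) * pw s (x + INR m1 + INR m2).

Definition drow (x s : C) (m : nat) : C :=
  epsilon (inhabits (RtoC 0)) (fun l => clim (psum (dterm x s m)) l).

(** The row sums are the tails of [sum_n (-1)^n (x+n)^(-s)], and Abel summation turns their sum
    into [sum_n (-1)^n (n+1) (x+n)^(-s)]. *)
Lemma Zv_double_series (x s : C) : (0 < Re x)%R -> (2 < Re s)%R ->
  (forall m, clim (psum (dterm x s m)) (drow x s m)) /\ clim (psum (drow x s)) (Zv x s).
Proof.
  intros Hx Hs.
  set (c := fun n => sgn n * pw s (x + INR n)).
  assert (Hre : forall n, (INR n <= Re (x + INR n))%R) by (intros n; unfold Re in *; simpl; lra).
  set (E1 := exp (2 * Cmod (s + 1))). set (E0 := exp (2 * Cmod s)).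
  assert (HE1 : (0 < E1)%R) by apply exp_pos. assert (HE0 : (0 < E0)%R) by apply exp_pos.
  (* One averaging suffices: first differences are O(N^(-3)) because Re s > 2. The rate N^(-2) is
     what makes the boundary term M (l - psum c M) of the Abel summation vanish. *)
  assert (HT : exists l, forall N, (1 <= N)%nat -> (Cmod (emean c 1 N - l) <= 2 * (2 * Cmod s * E1) / INR N ^ 2)%R).
  { destruct (clim_of_steps (emean c 1) (2 * Cmod s * E1) 1) as [l Hl].
    - assert (X := Cmod_ge_0 s). nra.
    - intros N HN. change (1 + N)%nat with (S N).
      assert (S1 : emean c 1 (S N) - emean c 1 N = sgn N / 2 ^ 1 * Dc 1 (pw s) (x + INR N)).
      { apply (emean_step (fun K n => Dc K (pw s) (x + INR n)) 1 N).
        intros K n. rewrite Dc_S, S_INR, RtoC_plus. do 2 f_equal. ring. }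
      rewrite S1.
      eapply Rle_trans; [apply Cmod_sgn_pow2_le|].
      assert (B := Dc_pw_bound 1 s (x + INR N) (E1 / INR N ^ 3)).
      simpl in B. rewrite !Rmult_1_r in B. simpl.
      replace (2 * Cmod s * E1 / (INR N * (INR N * (INR N * 1))))%R
        with (2 * Cmod s * (E1 / (INR N * (INR N * INR N))))%R by (rewrite Rmult_1_r; unfold Rdiv; ring).
      apply B; [apply Re_plus_nat; exact Hx|].
      intros t Ht. assert (P := pw_bound (s + 1) (x + INR N + t) 3 N HN).
      simpl in P. rewrite Rmult_1_r in P. apply P.
      + unfold Re in *; simpl. lra.
      + unfold Re in *; simpl. lra.
    - exists l. intros N HN. apply Hl. exact HN. }
  destruct HT as [l Hl].
  assert (Hc : forall N, (1 <= N)%nat -> (Cmod (c N) <= E0 / INR N ^ 2)%R).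
  { intros N HN. unfold c. rewrite Cmod_mult, Cmod_sgn, Rmult_1_l.
    apply pw_bound; [exact HN | apply Hre | simpl; lra]. }
  set (B := (4 * Cmod s * E1 + E0)%R).
  assert (HS : forall N, (1 <= N)%nat -> (Cmod (psum c N - l) <= B / INR N ^ 2)%R).
  { intros N HN.
    (* The first mean is the partial sum plus half of the next term. *)
    replace (psum c N - l) with ((emean c 1 N - l) - c N / 2)
      by (simpl; field).
    eapply Rle_trans; [apply Cmod_triangle_minus|].
    assert (X1 := Hl N HN). assert (X2 := Hc N HN).
    rewrite Cmod_div by exact RtoC_2_neq_0. rewrite Cmod_R, Rabs_pos_eq by lra.
    assert (P := Cmod_ge_0 (c N)).
    replace (B / INR N ^ 2)%R with (2 * (2 * Cmod s * E1) / INR N ^ 2 + E0 / INR N ^ 2)%R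
      by (unfold B, Rdiv; ring). lra. }
  assert (Hlim : clim (psum c) l).
  { apply clim_bound_inv with (B := B). intros N HN. eapply Rle_trans; [apply HS; exact HN|].
    assert (Hn := le_INR _ _ HN). simpl in Hn.
    assert (0 <= B)%R by (unfold B; assert (X := Cmod_ge_0 s); nra).
    apply Rmult_le_compat_l; [assumption|]. apply Rinv_le_contravar; simpl; nra. }
  assert (Hrow : forall m, clim (psum (dterm x s m)) (l - psum c m)).
  { intros m. apply clim_ext with (S := fun N => psum c (N + m) + - psum c m).
    - intros N. rewrite Nat.add_comm, psum_add.
      rewrite (psum_ext (dterm x s m) (fun n => c (m + n)%nat)); [ring|].
      intros n _. unfold dterm, c. rewrite plus_INR, RtoC_plus. do 2 f_equal. ring.
    - apply clim_plus; [apply (clim_shift (psum c)); exact Hlim | apply clim_const]. }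
  assert (Hdrow : forall m, drow x s m = l - psum c m).
  { intros m. apply (clim_unique (psum (dterm x s m))); [|apply Hrow].
    unfold drow. apply (epsilon_spec (inhabits (RtoC 0)) (fun l => clim (psum (dterm x s m)) l)).
    exists (l - psum c m). apply Hrow. }
  split; [intros m; rewrite Hdrow; apply Hrow|].
  (* Row m is the tail l - psum c m, and c n is missing from the tails m > n only; it is thus
     counted n+1 times. *)
  assert (Abel : forall M, psum (drow x s) M = INR M * (l - psum c M) + emZ 0 x s M).
  { induction M as [|M IH]; [simpl; unfold emZ; simpl; ring|].
    simpl psum. rewrite IH, Hdrow. rewrite S_INR, RtoC_plus.
    assert (EM : emZ 0 x s (S M) = emZ 0 x s M + (INR M + 1) * c M).
    { unfold emZ. cbn [emean psum]. rewrite term_0 by exact Hx. unfold c. ring. }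
    rewrite EM. ring. }
  apply clim_ext with (S := fun M => INR M * (l - psum c M) + emZ 0 x s M).
  { intros M. symmetry. apply Abel. }
  replace (Zv x s) with (0 + Zv x s) by ring. apply clim_plus.
  - apply clim_bound_inv with (B := B). intros N HN. assert (H := HS N HN).
    assert (Hn : (0 < INR N)%R) by (apply lt_0_INR; lia).
    replace (INR N * (l - psum c N) - 0) with (INR N * (l - psum c N)) by ring.
    rewrite Cmod_mult, Cmod_R, Rabs_pos_eq by lra. rewrite Cmod_minus_sym.
    replace (B / INR N)%R with (INR N * (B / INR N ^ 2))%R by (field; lra).
    apply Rmult_le_compat_l; lra.
  - apply clim_bound_inv with (B := (2 * term_const 1 (Cmod s) (Cmod x) + term_const 0 (Cmod s) (Cmod x))%R).
    intros N HN.
    assert (A1 := Zv_approx 1 x s (Cmod s) (Cmod x) N Hx (Rle_refl _) (Rle_refl _) ltac:(simpl; lra) HN).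
    assert (A2 := term_bound 0 1 N x s (Cmod s) (Cmod x) Hx (Rle_refl _) (Rle_refl _) ltac:(simpl; lra) HN).
    rewrite pow_1 in A2.
    (* The plain partial sums differ from the first means by half of a term, which is O(1/N) for Re
       s > 2. *)
    replace (emZ 0 x s N - Zv x s) with ((emZ 1 x s N - Zv x s) - sgn N * term 0 x s N / 2).
    + eapply Rle_trans; [apply Cmod_triangle_minus|].
      rewrite Cmod_div by exact RtoC_2_neq_0. rewrite Cmod_mult, Cmod_sgn, Cmod_R, Rabs_pos_eq by lra.
      assert (P := Cmod_ge_0 (term 0 x s N)).
      replace ((2 * term_const 1 (Cmod s) (Cmod x) + term_const 0 (Cmod s) (Cmod x)) / INR N)%R
        with (2 * term_const 1 (Cmod s) (Cmod x) / INR N + term_const 0 (Cmod s) (Cmod x) / INR N)%R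
        by (unfold Rdiv; ring). lra.
    + unfold emZ. cbn [emean psum]. field.
Qed.

(** * Dissection of the series of periods (N1,N2) *)

Definition cell (N1 N2 : nat) (x : C) (k1 k2 : nat) : C :=
  (x + INR N1 * INR k1 + INR N2 * INR k2) / (INR N1 * INR N2).

Definition ZvN (N1 N2 : nat) (x s : C) : C :=
  psum (fun k1 => psum (fun k2 =>
    sgn (k1 + k2) * (Cexp (- s * ln (INR N1 * INR N2)) * Zv (cell N1 N2 x k1 k2) s)) N1) N2.

(** Here oddness enters the dissection: the sign of N2 n1 + k1 + N1 n2 + k2 splits as the sign of n1
    + n2 times that of k1 + k2. *)
Lemma sgn_odd_mul (N n : nat) : Nat.Odd N -> sgn (N * n) = sgn n.
Proof.
  intros [k ->]. induction n as [|n IH]; [rewrite Nat.mul_0_r; reflexivity|].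
  rewrite Nat.mul_succ_r, sgn_plus, IH, sgn_S, sgn_plus.
  replace (2 * k)%nat with (k + k)%nat by lia. rewrite sgn_plus.
  assert (H : sgn k * sgn k = 1).
  { clear. induction k; [unfold sgn; simpl; ring|]. rewrite sgn_S.
    transitivity (sgn k * sgn k); [ring|exact IHk]. }
  rewrite H. unfold sgn at 2. simpl. ring.
Qed.

Lemma odd_INR_pos (N : nat) : Nat.Odd N -> (0 < INR N)%R.
Proof. intros [k ->]. apply lt_0_INR. lia. Qed.

Lemma INR_C_neq_0 (N : nat) : Nat.Odd N -> RtoC (INR N) <> 0.
Proof. intros H E. apply RtoC_inj in E. assert (X := odd_INR_pos N H). lra. Qed.

Lemma Re_cell (N1 N2 : nat) (x : C) (k1 k2 : nat) : Nat.Odd N1 -> Nat.Odd N2 ->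
  (0 < Re x)%R -> (0 < Re (cell N1 N2 x k1 k2))%R.
Proof.
  intros H1 H2 Hx. apply odd_INR_pos in H1, H2.
  assert (K1 := pos_INR k1). assert (K2 := pos_INR k2).
  unfold cell. rewrite <- (RtoC_mult (INR N1) (INR N2)). unfold Cdiv.
  rewrite <- RtoC_inv by nra. rewrite re_scal_r.
  apply Rmult_lt_0_compat; [|apply Rinv_0_lt_compat; nra].
  unfold Re in *; simpl. nra.
Qed.

Lemma zetaE2_term_dissect (N1 N2 : nat) (x s : C) (k1 k2 n1 n2 : nat) :
  Nat.Odd N1 -> Nat.Odd N2 -> (0 < Re x)%R ->
  zetaE2_term (INR N1) (INR N2) x s (N2 * n1 + k1) (N1 * n2 + k2) =
  sgn (k1 + k2) * (Cexp (- s * ln (INR N1 * INR N2)) * dterm (cell N1 N2 x k1 k2) s n1 n2).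
Proof.
  intros O1 O2 Hx. assert (P1 := odd_INR_pos N1 O1). assert (P2 := odd_INR_pos N2 O2).
  assert (Q1 := INR_C_neq_0 N1 O1). assert (Q2 := INR_C_neq_0 N2 O2).
  unfold zetaE2_term, dterm.
  assert (Hc := Re_cell N1 N2 x k1 k2 O1 O2 Hx).
  assert (E : x + INR (N2 * n1 + k1) * INR N1 + INR (N1 * n2 + k2) * INR N2 =
    RtoC (INR N1 * INR N2) * (cell N1 N2 x k1 k2 + INR n1 + INR n2)).
  { rewrite !plus_INR, !mult_INR, !RtoC_plus, !RtoC_mult. unfold cell. field. auto. }
  rewrite E. fold (sgn (N2 * n1 + k1 + (N1 * n2 + k2))).
  change (Cexp (- s * Clog (RtoC (INR N1 * INR N2) * (cell N1 N2 x k1 k2 + INR n1 + INR n2))))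
    with (pw s (RtoC (INR N1 * INR N2) * (cell N1 N2 x k1 k2 + INR n1 + INR n2))).
  rewrite pw_scal; [|nra|repeat apply Re_plus_nat; exact Hc].
  rewrite !sgn_plus, !sgn_odd_mul by assumption. ring.
Qed.

Lemma is_double_series_ZvN (N1 N2 : nat) (x s : C) : Nat.Odd N1 -> Nat.Odd N2 ->
  (0 < Re x)%R -> (2 < Re s)%R ->
  is_double_series (zetaE2_term (INR N1) (INR N2) x s) (ZvN N1 N2 x s).
Proof.
  intros O1 O2 Hx Hs.
  assert (P1 : (0 < N1)%nat) by (destruct O1; lia). assert (P2 : (0 < N2)%nat) by (destruct O2; lia).
  set (E := Cexp (- s * ln (INR N1 * INR N2))).
  assert (HZ := fun k1 k2 => Zv_double_series (cell N1 N2 x k1 k2) s (Re_cell N1 N2 x k1 k2 O1 O2 Hx) Hs).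
  (* The sum of the row m1 = N2 n1 + k1, itself assembled from the N1 classes of m2. *)
  set (R := fun k1 n1 => psum (fun k2 => sgn (k1 + k2) * (E * drow (cell N1 N2 x k1 k2) s n1)) N1).
  assert (Hmod : forall k n, (k < N2)%nat -> ((N2 * n + k) mod N2 = k /\ (N2 * n + k) / N2 = n)%nat).
  { intros k n Hk. rewrite Nat.add_comm, Nat.mul_comm. split.
    - rewrite Nat.Div0.mod_add. apply Nat.mod_small. exact Hk.
    - rewrite Nat.div_add by lia. rewrite Nat.div_small by exact Hk. reflexivity. }
  exists (fun m => R (m mod N2)%nat (m / N2)%nat). split.
  - intros m. apply is_series_clim. unfold R. apply clim_dissect; [exact P1|].
    intros k2 Hk2.
    apply clim_ext with (S := fun N => sgn (m mod N2 + k2) *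
       (E * psum (dterm (cell N1 N2 x (m mod N2) k2) s (m / N2)) N)).
    + intros N. rewrite <- !psum_scal. apply psum_ext. intros n _.
      (* Only the row index of the series term is to be split; the quotients and remainders already
         present must stay as they are. *)
      rewrite (Nat.div_mod_eq m N2) at 4.
      rewrite zetaE2_term_dissect by assumption. reflexivity.
    + apply clim_scal, clim_scal. apply HZ.
  - apply is_series_clim. unfold ZvN. fold E.
    apply (clim_dissect _ (fun k1 => psum (fun k2 => sgn (k1 + k2) * (E * Zv (cell N1 N2 x k1 k2) s)) N1));
      [exact P2|].
    intros k1 Hk1.
    apply clim_ext with (S := fun N => psum (fun k2 => sgn (k1 + k2) *
       (E * psum (drow (cell N1 N2 x k1 k2) s) N)) N1).
    + intros N.
      transitivity (psum (fun i => R k1 i) N).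
      * unfold R. rewrite psum_swap. apply psum_ext. intros k2 _. rewrite <- !psum_scal. reflexivity.
      * apply psum_ext. intros n _. destruct (Hmod k1 n Hk1) as [-> ->]. reflexivity.
    + apply (clim_psum (fun k2 N => sgn (k1 + k2) * (E * psum (drow (cell N1 N2 x k1 k2) s) N))).
      intros k2 _. apply clim_scal, clim_scal. apply HZ.
Qed.

Lemma is_double_series_unique (a : nat -> nat -> C) (l m : C) :
  is_double_series a l -> is_double_series a m -> l = m.
Proof.
  intros [r [R1 R2]] [t [T1 T2]]. apply is_series_clim in R2, T2.
  assert (E : forall n, r n = t n).
  { intros n. specialize (R1 n). specialize (T1 n). apply is_series_clim in R1, T1.
    exact (clim_unique _ _ _ R1 T1). }
  apply (clim_unique (psum t)); [|exact T2].
  apply clim_ext with (2 := R2). intros n. apply psum_ext. intros; apply E.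
Qed.

Lemma psum_cderiv (u : nat -> C -> C) (u' : nat -> C) (s : C) (N : nat) :
  (forall n, cderiv (u n) s (u' n)) -> cderiv (fun s => psum (fun n => u n s) N) s (psum u' N).
Proof. intros H. induction N; simpl; [apply cderiv_const | apply cderiv_plus; auto]. Qed.

Lemma psum_cdiff (u : nat -> C -> C) (s : C) (N : nat) :
  (forall n, cdiff (u n) s) -> cdiff (fun s => psum (fun n => u n s) N) s.
Proof. intros H. induction N; simpl; [apply cdiff_const | apply cdiff_plus; auto]. Qed.

Lemma ZvN_cdiff (N1 N2 : nat) (x s : C) : Nat.Odd N1 -> Nat.Odd N2 -> (0 < Re x)%R ->
  cdiff (ZvN N1 N2 x) s.
Proof.
  intros O1 O2 Hx. unfold ZvN. apply psum_cdiff with (u := fun k1 s => psum _ N1). intros k1.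
  apply psum_cdiff with (u := fun k2 s => sgn (k1 + k2) * (Cexp (- s * ln (INR N1 * INR N2)) * Zv (cell N1 N2 x k1 k2) s)).
  intros k2. apply cdiff_mult; [apply cdiff_const|]. apply cdiff_mult.
  - apply cdiff_Cexp_comp. apply cdiff_mult; [apply cdiff_opp, cdiff_id | apply cdiff_const].
  - apply Zv_cdiff. apply Re_cell; assumption.
Qed.

(** Carried along unevaluated: it enters only through [GNconst], which cancels in [GN_reflect], and
    for periods (1,1) through a product with ln 1. *)
Definition sgn_total (N1 N2 : nat) : C := psum (fun k1 => psum (fun k2 => sgn (k1 + k2)) N1) N2.

Lemma ZvN_cderiv_0 (N1 N2 : nat) (x : C) : Nat.Odd N1 -> Nat.Odd N2 -> (0 < Re x)%R ->
  cderiv (ZvN N1 N2 x) 0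
    (- ln (INR N1 * INR N2) / 4 * sgn_total N1 N2 +
     psum (fun k1 => psum (fun k2 => sgn (k1 + k2) * Dz (cell N1 N2 x k1 k2)) N1) N2).
Proof.
  intros O1 O2 Hx. eapply cderiv_eq.
  - unfold ZvN.
    apply psum_cderiv with (u := fun k1 s => psum (fun k2 =>
      sgn (k1 + k2) * (Cexp (- s * ln (INR N1 * INR N2)) * Zv (cell N1 N2 x k1 k2) s)) N1)
      (u' := fun k1 => psum (fun k2 => sgn (k1 + k2) *
         (- ln (INR N1 * INR N2) / 4 + Dz (cell N1 N2 x k1 k2))) N1).
    intros k1.
    apply psum_cderiv with (u := fun k2 s => sgn (k1 + k2) *
      (Cexp (- s * ln (INR N1 * INR N2)) * Zv (cell N1 N2 x k1 k2) s)).
    intros k2. apply cderiv_scal. assert (Hc := Re_cell N1 N2 x k1 k2 O1 O2 Hx).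
    eapply cderiv_eq.
    + apply cderiv_mult; [|apply cderiv_Zv_0; exact Hc].
      apply cderiv_Cexp_comp. apply cderiv_mult; [apply cderiv_opp, cderiv_id | apply cderiv_const].
    (* The derivative of (N1 N2)^(-s) is multiplied by the value of [Zv] at 0, which is 1/4 in every
       cell; this makes the first summand constant in x. *)
    + cbv beta. rewrite Zv_0 by exact Hc.
      replace (Cexp (- 0 * ln (INR N1 * INR N2))) with (RtoC 1).
      * unfold Cdiv. ring.
      * rewrite <- Cexp_0. f_equal. ring.
  - unfold sgn_total. rewrite <- psum_scal, <- psum_plus. apply psum_ext. intros k1 _.
    rewrite <- psum_scal, <- psum_plus. apply psum_ext. intros k2 _. ring.
Qed.

(** Along the segment from a point of A to one of B, the supremum of the times up to which the
    segment stays in A can lie in neither open set. *)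
Lemma connected_C : connected (fun _ => True).
Proof.
  intros A B HA HB Hcov Hdis [z0 [_ H0]] z1 _.
  destruct (Hcov z1 I) as [H1|H1]; [exact H1|]. exfalso.
  set (f := fun t : R => z0 + t * (z1 - z0)).
  set (L := (Cmod (z1 - z0) + 1)%R).
  assert (HL : (0 < L)%R) by (unfold L; assert (X := Cmod_ge_0 (z1 - z0)); lra).
  assert (Hf : forall (U : C -> Prop) t, open U -> U (f t) -> exists d : R, (0 < d)%R /\
     forall t', (Rabs (t' - t) < d)%R -> U (f t')).
  { intros U t HU Ht. specialize (HU _ Ht). apply locally_Cmod in HU. destruct HU as [d [Hd HU]].
    exists (d / L)%R. split; [apply Rdiv_lt_0_compat; assumption|]. intros t' Ht'. apply HU.
    unfold f. replace (z0 + t' * (z1 - z0) - (z0 + t * (z1 - z0))) with ((t' - t)%R * (z1 - z0))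
      by (rewrite RtoC_minus; ring).
    rewrite Cmod_mult, Cmod_R. apply (Rmult_lt_compat_r L) in Ht'; [|exact HL].
    unfold Rdiv in Ht'. rewrite Rmult_assoc, Rinv_l in Ht' by lra.
    assert (X := Rabs_pos (t' - t)). unfold L in *. nra. }
  assert (E0 : f 0%R = z0) by (unfold f; ring).
  assert (E1 : f 1%R = z1) by (unfold f; ring).
  destruct (completeness (fun t => (0 <= t <= 1)%R /\ forall s, (0 <= s <= t)%R -> A (f s))) as [m [M1 M2]].
  - exists 1%R. intros t [Ht _]. lra.
  - exists 0%R. split; [lra|]. intros s Hs. replace s with 0%R by lra. rewrite E0. exact H0.
  - assert (Hm0 : (0 <= m)%R).
    { apply M1. split; [lra|]. intros s Hs. replace s with 0%R by lra. rewrite E0. exact H0. }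
    assert (Hm1 : (m <= 1)%R) by (apply M2; intros t [Ht _]; lra).
    assert (Hbelow : forall s, (0 <= s < m)%R -> A (f s)).
    { intros s Hs. apply NNPP. intros Hn.
      assert (m <= s)%R; [|lra]. apply M2. intros t [Ht1 Ht2].
      apply Rnot_lt_le. intros Hst. apply Hn, Ht2. lra. }
    destruct (Hcov (f m) I) as [Hm|Hm].
    + destruct (Hf A m HA Hm) as [d [Hd HAd]].
      destruct (Req_dec m 1) as [->|Hne].
      * rewrite E1 in Hm. exact (Hdis z1 I (conj Hm H1)).
      * assert (Rmin (m + d / 2) 1 <= m)%R.
        { apply M1. split.
          - split; [apply Rmin_glb; lra | apply Rmin_r].
          - intros s Hs. assert (X := Rmin_l (m + d / 2) 1).
            destruct (Rlt_dec s m) as [Hsm|Hsm]; [apply Hbelow; lra|].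
            apply HAd. apply Rabs_lt_between. lra. }
        revert H. unfold Rmin. destruct (Rle_dec _ _); lra.
    + destruct (Hf B m HB Hm) as [d [Hd HBd]].
      destruct (Req_dec m 0) as [->|Hne].
      * rewrite E0 in Hm. exact (Hdis z0 I (conj H0 Hm)).
      * set (s := Rmax 0 (m - d / 2)).
        assert (Hs : (0 <= s < m /\ m - d < s)%R).
        { unfold s, Rmax. destruct (Rle_dec _ _); lra. }
        apply (Hdis (f s) I). split; [apply Hbelow; lra|].
        apply HBd. apply Rabs_lt_between. lra.
Qed.

(** [ZvN] shows that a continuation exists, so [zetaE2] is one, on some unknown connected [U]. As
    [ZvN] is entire, the identity theorem applies on [U] itself, starting from the unit disc about
    3, where both are the sum of the series, and reaching 0. *)
Lemma zetaE2_derive_0 (N1 N2 : nat) (x : C) : Nat.Odd N1 -> Nat.Odd N2 -> (0 < Re x)%R ->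
  C_derive (zetaE2 (INR N1) (INR N2) x) 0 =
    - ln (INR N1 * INR N2) / 4 * sgn_total N1 N2 +
    psum (fun k1 => psum (fun k2 => sgn (k1 + k2) * Dz (cell N1 N2 x k1 k2)) N1) N2.
Proof.
  intros O1 O2 Hx.
  assert (HZ : forall s, holomorphic_at (ZvN N1 N2 x) s).
  { intros s. apply holomorphic_at_Cmod. exists 1%R. split; [lra|]. intros w _.
    apply ZvN_cdiff; assumption. }
  assert (Hex : is_zetaE2 (INR N1) (INR N2) x (ZvN N1 N2 x)).
  { exists (fun _ => True). repeat split; auto.
    - apply open_Cmod. intros z _. exists 1%R. split; [lra| auto].
    - exact connected_C.
    - intros s Hs. apply is_double_series_ZvN; assumption. }
  assert (Hspec := epsilon_spec (inhabits (fun _ : C => RtoC 0)) _ (ex_intro _ _ Hex)).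
  fold (zetaE2 (INR N1) (INR N2) x) in Hspec.
  set (F := zetaE2 (INR N1) (INR N2) x) in *.
  destruct Hspec as [U [U1 [U2 [U3 [U4 [U5 U6]]]]]].
  assert (HEq : forall s, U s -> F s = ZvN N1 N2 x s).
  { apply (identity_theorem U F (ZvN N1 N2 x) 3 U2 U5).
    - intros; apply HZ.
    - apply U4. simpl. lra.
    - apply locally_Cmod. exists 1%R. split; [lra|]. intros w Hw.
      assert (Hw2 : (2 < Re w)%R).
      { destruct (dist_in_sq _ _ _ Hw). simpl Re in *. lra. }
      apply (is_double_series_unique (zetaE2_term (INR N1) (INR N2) x w)).
      + apply U6. exact Hw2.
      + apply is_double_series_ZvN; assumption. }
  apply is_C_derive_unique. apply (cderiv_ext_loc (ZvN N1 N2 x)).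
  - specialize (U1 _ U3). apply locally_Cmod in U1. destruct U1 as [d [Hd U1]].
    exists d. split; [exact Hd|]. intros w Hw. symmetry. apply HEq. apply U1. exact Hw.
  - apply ZvN_cderiv_0; assumption.
Qed.

(** * Meromorphic functions and the double gamma function *)

Notation near' a P := (locally' (T := C_UniformSpace) (a : C) P).

Lemma near'_and (a : C) (P Q : C -> Prop) : near' a P -> near' a Q -> near' a (fun z => P z /\ Q z).
Proof. intros HP HQ. apply (filter_and (F := locally' (T := C_UniformSpace) a)); assumption. Qed.

Lemma near'_imp (a : C) (P Q : C -> Prop) : (forall z, P z -> Q z) -> near' a P -> near' a Q.
Proof. intros H. apply filter_imp. exact H. Qed.

Lemma near'_neq (a : C) : near' a (fun z => z <> a).
Proof. apply locally'_Cmod. exists 1%R. split; [lra|]. auto. Qed.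

Lemma near'_forall_lt (a : C) (P : nat -> C -> Prop) (N : nat) :
  (forall k, near' a (P k)) -> near' a (fun z => forall k, (k < N)%nat -> P k z).
Proof.
  intros H. induction N as [|N IH].
  - apply near'_imp with (P := fun z => z <> a); [intros; lia | apply near'_neq].
  - apply near'_imp with (2 := near'_and _ _ _ IH (H N)). intros z [A B] k Hk.
    destruct (Nat.eq_dec k N) as [->|Hne]; [exact B | apply A; lia].
Qed.

Lemma affine_dist (g : C -> C) (p q a : C) : (forall z, g z = p * z + q) ->
  forall d : R, (0 < d)%R -> exists e : R, (0 < e)%R /\
    forall w, (Cmod (w - a) < e)%R -> (Cmod (g w - g a) < d)%R.
Proof.
  intros Hg d Hd. assert (Hp := Cmod_ge_0 p).
  exists (d / (Cmod p + 1))%R. split; [apply Rdiv_lt_0_compat; lra|]. intros w Hw.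
  rewrite !Hg. replace (p * w + q - (p * a + q)) with (p * (w - a)) by ring. rewrite Cmod_mult.
  apply (Rmult_lt_compat_r (Cmod p + 1)) in Hw; [|lra].
  unfold Rdiv in Hw. rewrite Rmult_assoc, Rinv_l in Hw by lra.
  assert (X := Cmod_ge_0 (w - a)). nra.
Qed.

Lemma affine_inj (g : C -> C) (p q z w : C) : (forall z, g z = p * z + q) -> p <> 0 ->
  z <> w -> g z <> g w.
Proof.
  intros Hg Hp Hz E. apply Hz. rewrite !Hg in E.
  assert (E2 : p * (z - w) = 0) by (transitivity ((p * z + q) - (p * w + q)); [ring | rewrite E; ring]).
  apply Ceq_minus. rewrite <- (Cmult_1_l (z - w)), <- (Cinv_l p Hp), <- Cmult_assoc, E2. ring.
Qed.

Lemma near'_affine (g : C -> C) (p q a : C) (P : C -> Prop) : (forall z, g z = p * z + q) -> p <> 0 ->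
  near' (g a) P -> near' a (fun z => P (g z)).
Proof.
  intros Hg Hp H. apply locally'_Cmod in H. destruct H as [d [Hd H]].
  apply locally'_Cmod. destruct (affine_dist g p q a Hg d Hd) as [e [He Hw]].
  exists e. split; [exact He|]. intros w Hw1 Hw2. apply H; [auto|].
  apply (affine_inj g p q); assumption.
Qed.

(** [f] is meromorphic at [a] and not identically zero near [a]. *)
Definition mnz (f : C -> C) (a : C) : Prop :=
  exists (n m : nat) (h : C -> C), holomorphic_at h a /\ h a <> 0 /\
    near' a (fun z => (z - a) ^ n * f z = (z - a) ^ m * h z).

Lemma mnz_ext (f g : C -> C) (a : C) : near' a (fun z => f z = g z) -> mnz f a -> mnz g a.
Proof.
  intros E [n [m [h [Hh [Ha H]]]]]. exists n, m, h. split; [exact Hh|]. split; [exact Ha|].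
  apply near'_imp with (2 := near'_and _ _ _ E H). intros z [E1 E2]. rewrite <- E1. exact E2.
Qed.

Lemma mnz_holomorphic (f : C -> C) (a : C) : holomorphic_at f a -> f a <> 0 -> mnz f a.
Proof.
  intros Hf Ha. exists 0%nat, 0%nat, f. split; [exact Hf|]. split; [exact Ha|].
  apply near'_imp with (2 := near'_neq a). reflexivity.
Qed.

Lemma mnz_const (c a : C) : c <> 0 -> mnz (fun _ => c) a.
Proof.
  intros Hc. apply mnz_holomorphic; [|exact Hc].
  apply holomorphic_at_Cmod. exists 1%R. split; [lra|]. intros. apply cdiff_const.
Qed.

Lemma mnz_id (a : C) : mnz (fun z => z) a.
Proof.
  destruct (classic (a = 0)) as [->|Ha].
  - exists 0%nat, 1%nat, (fun _ => RtoC 1). split; [|split].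
    + apply holomorphic_at_Cmod. exists 1%R. split; [lra|]. intros. apply cdiff_const.
    + exact C1_nz.
    + apply near'_imp with (2 := near'_neq 0). intros z _. simpl. ring.
  - apply mnz_holomorphic; [|exact Ha].
    apply holomorphic_at_Cmod. exists 1%R. split; [lra|]. intros. apply cdiff_id.
Qed.

Lemma mnz_mult (f g : C -> C) (a : C) : mnz f a -> mnz g a -> mnz (fun z => f z * g z) a.
Proof.
  intros [n1 [m1 [h1 [A1 [B1 C1]]]]] [n2 [m2 [h2 [A2 [B2 C2]]]]].
  exists (n1 + n2)%nat, (m1 + m2)%nat, (fun z => h1 z * h2 z).
  split; [apply holomorphic_at_mult; assumption|]. split; [apply Cmult_neq_0; assumption|].
  apply near'_imp with (2 := near'_and _ _ _ C1 C2). intros z [E1 E2].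
  rewrite !Cpow_add_r. transitivity (((z - a) ^ n1 * f z) * ((z - a) ^ n2 * g z)); [ring|].
  rewrite E1, E2. ring.
Qed.

Lemma mnz_nonzero (f : C -> C) (a : C) : mnz f a -> near' a (fun z => f z <> 0).
Proof.
  intros [n [m [h [A [B H]]]]].
  destruct (ccont_neq_0 h a) as [d [Hd Hh]]; [apply cdiff_ccont, holomorphic_at_cdiff; exact A | exact B|].
  assert (N : near' a (fun z => h z <> 0)).
  { apply locally'_Cmod. exists d. split; [exact Hd|]. intros w Hw _. apply Hh. exact Hw. }
  apply near'_imp with (2 := near'_and _ _ _ (near'_neq a) (near'_and _ _ _ H N)).
  intros z [Hz [E Hz2]] E0. rewrite E0, Cmult_0_r in E.
  apply (Cmult_neq_0 ((z - a) ^ m) (h z)); [apply Cpow_nz, Cminus_neq_0; exact Hz | exact Hz2 |].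
  symmetry. exact E.
Qed.

(** Inversion exchanges the exponents n and m and replaces h by 1/h, which is holomorphic where h
    does not vanish. *)
Lemma mnz_inv (f : C -> C) (a : C) : mnz f a -> mnz (fun z => / f z) a.
Proof.
  intros H. assert (N := mnz_nonzero f a H). destruct H as [n [m [h [A [B H]]]]].
  exists m, n, (fun z => / h z).
  destruct (ccont_neq_0 h a) as [d [Hd Hh]]; [apply cdiff_ccont, holomorphic_at_cdiff; exact A | exact B|].
  split; [|split].
  - apply holomorphic_at_Cmod in A. destruct A as [e [He A]]. apply holomorphic_at_Cmod.
    exists (Rmin d e). split; [apply Rmin_pos; assumption|]. intros w Hw. apply cdiff_inv.
    + apply A. eapply Rlt_le_trans; [exact Hw | apply Rmin_r].
    + apply Hh. eapply Rlt_le_trans; [exact Hw | apply Rmin_l].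
  - intros E. apply C1_nz. rewrite <- (Cinv_l (h a) B), E. ring.
  - assert (N2 : near' a (fun z => h z <> 0)).
    { apply locally'_Cmod. exists d. split; [exact Hd|]. intros w Hw _. apply Hh. exact Hw. }
    apply near'_imp with (2 := near'_and _ _ _ (near'_and _ _ _ N N2) H).
    intros z [[Hf Hz] E]. transitivity ((z - a) ^ m * h z / (f z * h z)); [field; auto|].
    rewrite <- E. field. auto.
Qed.

(** Since g z - g a = p (z - a), the powers of p are absorbed into the new holomorphic factor. *)
Lemma mnz_affine (f g : C -> C) (p q a : C) : (forall z, g z = p * z + q) -> p <> 0 ->
  mnz f (g a) -> mnz (fun z => f (g z)) a.
Proof.
  intros Hg Hp [n [m [h [A [B H]]]]].
  exists n, m, (fun z => p ^ m / p ^ n * h (g z)).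
  assert (Hn := Cpow_nz p n Hp). assert (Hm := Cpow_nz p m Hp).
  split; [|split].
  - apply holomorphic_at_Cmod in A. destruct A as [d [Hd A]]. apply holomorphic_at_Cmod.
    destruct (affine_dist g p q a Hg d Hd) as [e [He Hw]].
    exists e. split; [exact He|]. intros w Hw1. apply cdiff_mult; [apply cdiff_const|].
    apply (cdiff_comp h g); [apply A; auto|].
    eexists. apply (cderiv_ext (fun z => p * z + q)).
    + intros z. symmetry. apply Hg.
    + apply cderiv_plus; [apply cderiv_scal, cderiv_id | apply cderiv_const].
  - apply Cmult_neq_0; [|exact B]. intros E. apply Hm.
    transitivity (p ^ m / p ^ n * p ^ n); [field; exact Hn | rewrite E; ring].
  - apply near'_imp with (2 := near'_affine g p q a _ Hg Hp H). intros z E.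
    replace (g z - g a) with (p * (z - a)) in E by (rewrite !Hg; ring).
    rewrite !Cpow_mult_l in E.
    transitivity (/ p ^ n * (p ^ n * (z - a) ^ n * f (g z))); [field; exact Hn|].
    rewrite E. field. exact Hn.
Qed.

Lemma mnz_meromorphic (f : C -> C) : (forall a, mnz f a) -> meromorphic f.
Proof.
  intros H a. destruct (H a) as [n [m [h [A [B E]]]]].
  exists n, (fun z => (z - a) ^ m * h z). split; [|exact E].
  apply holomorphic_at_mult; [|exact A]. apply holomorphic_at_Cmod. exists 1%R. split; [lra|].
  intros w _. apply cdiff_pow, cdiff_minus; [apply cdiff_id | apply cdiff_const].
Qed.

Lemma holomorphic_at_pow_sub (a : C) (n : nat) : holomorphic_at (fun z => (z - a) ^ n) a.
Proof.
  apply holomorphic_at_Cmod. exists 1%R. split; [lra|].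
  intros w _. apply cdiff_pow, cdiff_minus; [apply cdiff_id | apply cdiff_const].
Qed.

(** Near each point f - g becomes holomorphic after multiplication by (z-a)^(n+m), which vanishes
    only at [a]; so f and g agree or differ throughout a punctured neighbourhood, and connectedness
    spreads the agreement from the disc about 1. *)
Lemma meromorphic_identity (f g : C -> C) : meromorphic f -> meromorphic g ->
  (forall z, (0 < Re z)%R -> f z = g z) -> forall a, near' a (fun z => f z = g z).
Proof.
  intros Hf Hg H a.
  apply (punctured_dichotomy (fun _ => True) (fun z => f z = g z) 1); auto.
  - exact connected_C.
  - clear a. intros a _. destruct (Hf a) as [n [f1 [A1 E1]]]. destruct (Hg a) as [m [g1 [A2 E2]]].
    assert (K : forall z, z <> a -> (z - a) ^ n * f z = f1 z -> (z - a) ^ m * g z = g1 z ->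
       (z - a) ^ m * f1 z - (z - a) ^ n * g1 z = (z - a) ^ (n + m) * (f z - g z)).
    { intros z _ <- <-. rewrite Cpow_add_r. ring. }
    destruct (holomorphic_eq_dichotomy (fun z => (z - a) ^ m * f1 z) (fun z => (z - a) ^ n * g1 z) a) as [D|D].
    + apply holomorphic_at_mult; [apply holomorphic_at_pow_sub | exact A1].
    + apply holomorphic_at_mult; [apply holomorphic_at_pow_sub | exact A2].
    + left. apply near'_imp with (2 := near'_and _ _ _ (near'_and _ _ _ (near'_neq a) D) (near'_and _ _ _ E1 E2)).
      intros z [[Hz Hd] [X1 X2]]. specialize (K z Hz X1 X2). apply Ceq_minus in Hd. rewrite Hd in K.
      apply Ceq_minus. apply NNPP. intros Hn.
      apply (Cmult_neq_0 ((z - a) ^ (n + m)) (f z - g z)); [apply Cpow_nz, Cminus_neq_0; exact Hz | exact Hn|].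
      symmetry. exact K.
    + right. apply near'_imp with (2 := near'_and _ _ _ (near'_and _ _ _ (near'_neq a) D) (near'_and _ _ _ E1 E2)).
      intros z [[Hz Hd] [X1 X2]] E. specialize (K z Hz X1 X2). apply Hd. apply Ceq_minus. rewrite K, E. ring.
  - apply locally'_Cmod. exists 1%R. split; [lra|]. intros w Hw _. apply H.
    destruct (dist_in_sq _ _ _ Hw). simpl Re in *. lra.
Qed.

(** Agrees with the double gamma function of periods [(1,1)] on [- n < Re x]. *)
Fixpoint Gext (n : nat) (x : C) : C :=
  match n with
  | O => Cexp (Dz x)
  | S n => / (x * (Gext n (x + 1) * Gext n (x + 1)) * Gext n (x + 2))
  end.

Lemma Gext_0_shift (x : C) : (0 < Re x)%R -> Gext 1 x = Gext 0 x.
Proof.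
  intros Hx. simpl. rewrite <- !Cexp_plus. rewrite <- (Cexp_Clog x Hx) at 1.
  rewrite <- !Cexp_plus, <- Cexp_inv. f_equal.
  replace (Clog x) with (- - Clog x) by ring. rewrite <- Dz_shift by exact Hx. ring.
Qed.

(** For n = 0 this is the exponential of [Dz_shift]. The defining relation only looks at x+1 and
    x+2, which lie in the half-plane of the previous stage. *)
Lemma Gext_S (n : nat) (x : C) : (- INR n < Re x)%R -> Gext (S n) x = Gext n x.
Proof.
  revert x. induction n as [|n IH]; intros x Hx.
  - apply Gext_0_shift. simpl in Hx. lra.
  - assert (E1 : Re (x + 1) = (Re x + 1)%R) by reflexivity.
    assert (E2 : Re (x + 2) = (Re x + 2)%R) by reflexivity.
    rewrite S_INR in Hx.
    change (Gext (S (S n)) x) with (/ (x * (Gext (S n) (x + 1) * Gext (S n) (x + 1)) * Gext (S n) (x + 2))).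
    rewrite !IH by lra. reflexivity.
Qed.

Lemma Gext_le (n m : nat) (x : C) : (n <= m)%nat -> (- INR n < Re x)%R -> Gext m x = Gext n x.
Proof.
  intros H Hx. induction H as [|m H IH]; [reflexivity|].
  rewrite Gext_S; [exact IH|]. apply le_INR in H. lra.
Qed.

Lemma Gext_mnz (n : nat) (a : C) : (- INR n < Re a)%R -> mnz (Gext n) a.
Proof.
  revert a. induction n as [|n IH]; intros a Ha.
  - simpl in Ha. apply mnz_holomorphic; [|apply Cexp_neq_0].
    apply holomorphic_at_Cmod. exists (Re a). split; [lra|]. intros w Hw.
    apply cdiff_Cexp_comp, Dz_cdiff.
    destruct (dist_in_sq _ _ _ Hw). lra.
  - rewrite S_INR in Ha.
    assert (E1 : Re (a + 1) = (Re a + 1)%R) by reflexivity.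
    assert (E2 : Re (a + 2) = (Re a + 2)%R) by reflexivity.
    assert (M1 : mnz (fun z => Gext n (z + 1)) a).
    { apply (mnz_affine (Gext n) (fun z => z + 1) 1 1); [intros; ring | exact C1_nz|]. apply IH. lra. }
    assert (M2 : mnz (fun z => Gext n (z + 2)) a).
    { apply (mnz_affine (Gext n) (fun z => z + 2) 1 2); [intros; ring | exact C1_nz|]. apply IH. lra. }
    apply (mnz_inv (fun x => x * (Gext n (x + 1) * Gext n (x + 1)) * Gext n (x + 2))).
    apply (mnz_mult (fun x => x * (Gext n (x + 1) * Gext n (x + 1)))); [|exact M2].
    apply (mnz_mult (fun x => x)); [apply mnz_id|].
    apply (mnz_mult (fun x => Gext n (x + 1))); exact M1.
Qed.

(** [up] exceeds its argument and [Z.to_nat] truncates at 0, so this stage n satisfies - n < Re x;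
    by [Gext_le] all other admissible stages give the same value. *)
Definition G11 (x : C) : C := Gext (Z.to_nat (up (- Re x))) x.

Lemma G11_eq (n : nat) (x : C) : (- INR n < Re x)%R -> G11 x = Gext n x.
Proof.
  intros Hx. unfold G11. set (k := Z.to_nat (up (- Re x))).
  assert (Hk : (- INR k < Re x)%R).
  { destruct (archimed (- Re x)) as [A _].
    assert (IZR (up (- Re x)) <= INR k)%R; [|lra].
    rewrite INR_IZR_INZ. apply IZR_le. unfold k. lia. }
  destruct (Nat.le_ge_cases n k).
  - apply Gext_le; assumption.
  - symmetry. apply Gext_le; assumption.
Qed.

Lemma G11_pos (x : C) : (0 < Re x)%R -> G11 x = Cexp (Dz x).
Proof. intros Hx. apply (G11_eq 0). simpl. lra. Qed.

Lemma G11_mnz (a : C) : mnz G11 a.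
Proof.
  (* The margin 2 lets one stage serve the whole unit disc about [a], on which [G11] changes stage
     from point to point. *)
  destruct (exists_INR_ge (2 - Re a)) as [n Hn].
  apply mnz_ext with (f := Gext n); [|apply Gext_mnz; lra].
  apply locally'_Cmod. exists 1%R. split; [lra|]. intros w Hw _. symmetry. apply G11_eq.
  destruct (dist_in_sq _ _ _ Hw). lra.
Qed.

(** * Finite products and exponents 1 and -1 *)

Lemma Cprod_0 (f : nat -> C) : Cprod 0 f = 1.
Proof. reflexivity. Qed.

Lemma Cprod_S (n : nat) (f : nat -> C) : Cprod (S n) f = Cprod n f * f n.
Proof.
  unfold Cprod. rewrite seq_S, map_app, fold_right_app. simpl.
  generalize (map f (seq 0 n)). induction l as [|y l IH]; simpl; [ring|]. rewrite IH. ring.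
Qed.

Lemma Cprod_ext (n : nat) (f g : nat -> C) : (forall k, (k < n)%nat -> f k = g k) -> Cprod n f = Cprod n g.
Proof.
  induction n; intros H; [reflexivity|]. rewrite !Cprod_S, IHn, H by (intros; auto with arith). reflexivity.
Qed.

Lemma Cprod_mult (n : nat) (f g : nat -> C) : Cprod n (fun k => f k * g k) = Cprod n f * Cprod n g.
Proof. induction n; [rewrite !Cprod_0; ring|]. rewrite !Cprod_S, IHn. ring. Qed.

Lemma Cprod_S_l (n : nat) (f : nat -> C) : Cprod (S n) f = f 0%nat * Cprod n (fun k => f (S k)).
Proof.
  induction n; [rewrite Cprod_S, !Cprod_0; ring|]. rewrite Cprod_S, IHn, Cprod_S. ring.
Qed.

Lemma Cprod_rev (n : nat) (f : nat -> C) : Cprod n f = Cprod n (fun k => f (n - 1 - k)%nat).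
Proof.
  revert f. induction n as [|n IH]; intros f; [reflexivity|].
  rewrite Cprod_S_l, Cprod_S, (IH (fun k => f (S k))), Cmult_comm.
  f_equal; [|f_equal; lia]. apply Cprod_ext. intros k Hk. f_equal. lia.
Qed.

Lemma Cinv_0 : / (RtoC 0) = 0.
Proof. unfold Cinv, RtoC; simpl. f_equal; unfold Rdiv; ring. Qed.

(** With the default / 0 = 0 the rule has no side condition, so [GN_reflect] becomes an identity of
    total functions, valid at zeros and poles too. *)
Lemma Cinv_mult_total (u v : C) : / (u * v) = / u * / v.
Proof.
  destruct (classic (u = 0)) as [->|Hu]; [rewrite Cmult_0_l, Cinv_0; ring|].
  destruct (classic (v = 0)) as [->|Hv]; [rewrite Cmult_0_r, Cinv_0; ring|].
  field. auto.
Qed.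

Lemma Cprod_inv (n : nat) (f : nat -> C) : / Cprod n f = Cprod n (fun k => / f k).
Proof.
  induction n; [rewrite !Cprod_0; rewrite <- RtoC_inv, Rinv_1 by lra; reflexivity|].
  rewrite !Cprod_S, Cinv_mult_total, IHn. reflexivity.
Qed.

Notation esgn n := ((-1) ^ Z.of_nat n)%Z.

Lemma esgn_cases (n : nat) : (esgn n = 1%Z /\ sgn n = 1) \/ (esgn n = (-1)%Z /\ sgn n = - (1)).
Proof.
  induction n as [|n IH]; [left; split; reflexivity|].
  rewrite Nat2Z.inj_succ, Z.pow_succ_r, sgn_S by lia.
  destruct IH as [[-> ->]|[-> ->]]; [right|left]; split; try reflexivity; ring.
Qed.

Lemma esgn_sgn (n m : nat) : sgn n = sgn m -> esgn n = esgn m.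
Proof.
  intros H. destruct (esgn_cases n) as [[-> A]|[-> A]], (esgn_cases m) as [[-> B]|[-> B]];
    try reflexivity; rewrite A, B in H; injection H; lra.
Qed.

Lemma Cpowz_1 (z : C) : Cpowz z 1 = z.
Proof. simpl. ring. Qed.

Lemma Cpowz_m1 (z : C) : Cpowz z (-1) = / z.
Proof. simpl. rewrite Cmult_1_r. reflexivity. Qed.

Lemma Cpowz_esgn_div (u v : C) (n : nat) : Cpowz (u / v) (esgn n) = Cpowz u (esgn n) * / Cpowz v (esgn n).
Proof.
  destruct (esgn_cases n) as [[-> _]|[-> _]].
  - rewrite !Cpowz_1. reflexivity.
  - rewrite !Cpowz_m1. unfold Cdiv. apply Cinv_mult_total.
Qed.

Lemma Cpowz_esgn_Cexp (z : C) (n : nat) : Cpowz (Cexp z) (esgn n) = Cexp (sgn n * z).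
Proof.
  destruct (esgn_cases n) as [[-> ->]|[-> ->]].
  - rewrite Cpowz_1, Cmult_1_l. reflexivity.
  - rewrite Cpowz_m1, <- Cexp_inv. f_equal. ring.
Qed.

Lemma mnz_Cpowz_esgn (f : C -> C) (n : nat) (a : C) : mnz f a -> mnz (fun z => Cpowz (f z) (esgn n)) a.
Proof.
  intros H. destruct (esgn_cases n) as [[-> _]|[-> _]].
  - apply mnz_ext with (2 := H). apply near'_imp with (2 := near'_neq a). intros. symmetry. apply Cpowz_1.
  - apply mnz_ext with (2 := mnz_inv f a H). apply near'_imp with (2 := near'_neq a).
    intros. symmetry. apply Cpowz_m1.
Qed.

Lemma mnz_Cprod (f : nat -> C -> C) (n : nat) (a : C) : (forall k, mnz (f k) a) ->
  mnz (fun z => Cprod n (fun k => f k z)) a.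
Proof.
  intros H. induction n as [|n IH].
  - apply (mnz_const 1). exact C1_nz.
  - apply mnz_ext with (2 := mnz_mult _ _ a IH (H n)). apply near'_imp with (2 := near'_neq a).
    intros. symmetry. apply Cprod_S.
Qed.

Lemma Cexp_psum (u : nat -> C) (n : nat) : Cexp (psum u n) = Cprod n (fun k => Cexp (u k)).
Proof. induction n; simpl psum; [apply Cexp_0|]. rewrite Cexp_plus, IHn, Cprod_S. reflexivity. Qed.

(** * The double gamma function of odd periods and the product formula *)

Definition GNconst (N1 N2 : nat) : C := Cexp (- ln (INR N1 * INR N2) / 4 * sgn_total N1 N2).

(** The exponential of the formula in [zetaE2_derive_0], with exp Dz replaced by its extension
    [G11], so that it makes sense on the whole plane. *)
Definition GN (N1 N2 : nat) (x : C) : C :=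
  GNconst N1 N2 * Cprod N2 (fun k1 => Cprod N1 (fun k2 => Cpowz (G11 (cell N1 N2 x k1 k2)) (esgn (k1 + k2)))).

Lemma cell_affine (N1 N2 k1 k2 : nat) (x : C) :
  cell N1 N2 x k1 k2 = / (INR N1 * INR N2) * x +
    (INR N1 * INR k1 + INR N2 * INR k2) / (INR N1 * INR N2).
Proof. unfold cell, Cdiv. ring. Qed.

Lemma inv_N1N2_neq_0 (N1 N2 : nat) (O1 : Nat.Odd N1) (O2 : Nat.Odd N2) : / (INR N1 * INR N2) <> 0.
Proof.
  assert (Q1 := INR_C_neq_0 N1 O1). assert (Q2 := INR_C_neq_0 N2 O2).
  intros E. apply C1_nz. rewrite <- (Cinv_l (INR N1 * INR N2)), E by (apply Cmult_neq_0; assumption). ring.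
Qed.

Lemma cell_reflect (N1 N2 : nat) (O1 : Nat.Odd N1) (O2 : Nat.Odd N2) (x : C) (k1 k2 : nat) : (k1 < N2)%nat -> (k2 < N1)%nat ->
  cell N1 N2 (INR N1 + INR N2 - x) (N2 - 1 - k1) (N1 - 1 - k2) = 1 + 1 - cell N1 N2 x k1 k2.
Proof.
  intros H1 H2. assert (Q1 := INR_C_neq_0 N1 O1). assert (Q2 := INR_C_neq_0 N2 O2).
  unfold cell. rewrite !minus_INR by lia. rewrite !RtoC_minus. simpl (INR 1). field. auto.
Qed.

(** The exponents of a cell and of its reflection add up to N1 + N2 - 2, which is even for odd
    periods. *)
Lemma esgn_reflect (N1 N2 : nat) (O1 : Nat.Odd N1) (O2 : Nat.Odd N2) (k1 k2 : nat) : (k1 < N2)%nat -> (k2 < N1)%nat ->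
  esgn ((N2 - 1 - k1) + (N1 - 1 - k2)) = esgn (k1 + k2).
Proof.
  intros H1 H2. apply esgn_sgn.
  assert (S : forall k, sgn k * sgn k = 1).
  { induction k; [unfold sgn; simpl; ring|]. rewrite sgn_S. rewrite <- IHk. ring. }
  assert (T : forall n, sgn (2 * n) = 1).
  { intros n. replace (2 * n)%nat with (n + n)%nat by lia. rewrite sgn_plus. apply S. }
  destruct O1 as [a Ha]. destruct O2 as [b Hb].
  assert (E : sgn ((N2 - 1 - k1) + (N1 - 1 - k2)) * sgn (k1 + k2) = 1).
  { rewrite <- sgn_plus. replace (N2 - 1 - k1 + (N1 - 1 - k2) + (k1 + k2))%nat with (2 * (a + b))%nat by lia.
    apply T. }
  transitivity (sgn (N2 - 1 - k1 + (N1 - 1 - k2)) * (sgn (k1 + k2) * sgn (k1 + k2))).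
  - rewrite S. ring.
  - rewrite Cmult_assoc, E. ring.
Qed.

Lemma GN_mnz (N1 N2 : nat) (O1 : Nat.Odd N1) (O2 : Nat.Odd N2) (a : C) : mnz (GN N1 N2) a.
Proof.
  apply mnz_mult; [apply mnz_const, Cexp_neq_0|].
  apply (mnz_Cprod (fun k1 z => Cprod N1 (fun k2 => Cpowz (G11 (cell N1 N2 z k1 k2)) (esgn (k1 + k2))))).
  intros k1. apply (mnz_Cprod (fun k2 z => Cpowz (G11 (cell N1 N2 z k1 k2)) (esgn (k1 + k2)))).
  intros k2. apply (mnz_Cpowz_esgn (fun z => G11 (cell N1 N2 z k1 k2))).
  eapply (mnz_affine G11 (fun z => cell N1 N2 z k1 k2)).
  - intros z. apply cell_affine.
  - apply inv_N1N2_neq_0; assumption.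
  - apply G11_mnz.
Qed.

Lemma GN_pos (N1 N2 : nat) (O1 : Nat.Odd N1) (O2 : Nat.Odd N2) (x : C) : (0 < Re x)%R ->
  GN N1 N2 x = Cexp (C_derive (zetaE2 (INR N1) (INR N2) x) 0).
Proof.
  intros Hx. rewrite zetaE2_derive_0, Cexp_plus by assumption. unfold GN, GNconst. f_equal.
  rewrite Cexp_psum. apply Cprod_ext. intros k1 _.
  rewrite Cexp_psum. apply Cprod_ext. intros k2 _.
  rewrite G11_pos by (apply Re_cell; assumption). apply Cpowz_esgn_Cexp.
Qed.

Lemma GN_reflect (N1 N2 : nat) (O1 : Nat.Odd N1) (O2 : Nat.Odd N2) (x : C) :
  GN N1 N2 (INR N1 + INR N2 - x) / GN N1 N2 x =
  Cprod N2 (fun k1 => Cprod N1 (fun k2 =>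
    Cpowz (G11 (1 + 1 - cell N1 N2 x k1 k2) / G11 (cell N1 N2 x k1 k2)) (esgn (k1 + k2)))).
Proof.
  assert (E : GN N1 N2 (INR N1 + INR N2 - x) = GNconst N1 N2 * Cprod N2 (fun k1 => Cprod N1 (fun k2 =>
      Cpowz (G11 (1 + 1 - cell N1 N2 x k1 k2)) (esgn (k1 + k2))))).
  { unfold GN. f_equal. rewrite Cprod_rev. apply Cprod_ext. intros k1 H1.
    rewrite Cprod_rev. apply Cprod_ext. intros k2 H2.
    rewrite cell_reflect, esgn_reflect by assumption. reflexivity. }
  rewrite E. unfold GN, Cdiv. rewrite Cinv_mult_total.
  assert (Hc : GNconst N1 N2 * / GNconst N1 N2 = 1) by (apply Cinv_r, Cexp_neq_0).
  match goal with |- ?c * ?A * (/ ?c * ?B) = _ => transitivity (c * / c * (A * B)); [ring|] end.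
  rewrite Hc, Cmult_1_l, Cprod_inv, <- Cprod_mult. apply Cprod_ext. intros k1 _.
  rewrite Cprod_inv, <- Cprod_mult. apply Cprod_ext. intros k2 _.
  symmetry. apply Cpowz_esgn_div.
Qed.
(** [G] serves twice: it shows that the specification behind [epsilon] can be met, and it is the
    function with which the chosen one is then identified. *)
Lemma Gammabar2_near (w1 w2 : R) (G : C -> C) : (forall a, mnz G a) ->
  (forall x, (0 < Re x)%R -> G x = Cexp (C_derive (zetaE2 w1 w2 x) 0)) ->
  forall a, near' a (fun z => G z = Gammabar2 w1 w2 z).
Proof.
  intros Hm Hpos.
  assert (Hex : is_Gammabar2 w1 w2 G) by (split; [apply mnz_meromorphic; exact Hm | exact Hpos]).
  assert (Hspec := epsilon_spec (inhabits (fun _ : C => RtoC 0)) _ (ex_intro _ _ Hex)).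
  destruct Hspec as [S1 S2]. apply meromorphic_identity.
  - apply mnz_meromorphic. exact Hm.
  - exact S1.
  - intros z Hz. rewrite Hpos by exact Hz. symmetry. apply S2. exact Hz.
Qed.

(** The case N1 = N2 = 1 of the dissection: the only cell is x itself and ln 1 = 0 removes the
    constant. *)
Lemma G11_Gammabar2 (a : C) : near' a (fun z => G11 z = Gammabar2 1 1 z).
Proof.
  apply (Gammabar2_near 1 1 G11 G11_mnz). intros x Hx. rewrite G11_pos by exact Hx. f_equal.
  assert (O : Nat.Odd 1) by (exists 0%nat; reflexivity).
  assert (E := zetaE2_derive_0 1 1 x O O Hx). change (INR 1) with 1%R in E. rewrite E.
  replace (cell 1 1 x 0 0) with x.
  - rewrite Rmult_1_l, ln_1. unfold sgn_total, sgn; simpl.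
    replace (cell 1 1 x 0 0) with x; [unfold Cdiv; ring|].
    unfold cell; simpl. field.
  - unfold cell; simpl. field.
Qed.

Theorem theorem3p20 (N1 N2 : nat) (hN1 : Nat.Odd N1) (hN2 : Nat.Odd N2) :
  eq_meromorphic
    (fun x : C => C2 (INR N1) (INR N2) x)
    (fun x : C =>
       Cprod N2 (fun k1 => Cprod N1 (fun k2 =>
         Cpowz
           (C2 1 1 ((x + INR N1 * INR k1 + INR N2 * INR k2)
                    / (INR N1 * INR N2)))
           ((-1) ^ Z.of_nat (k1 + k2))%Z))).
Proof.
  set (g := fun x : C => INR N1 + INR N2 - x).
  assert (Hg : forall x, g x = - (1) * x + (INR N1 + INR N2)) by (intros; unfold g; ring).
  assert (Hm1 : - (1) <> RtoC 0).
  { intros E. apply C1_nz. replace (RtoC 1) with (- - (1)) by ring. rewrite E. ring. }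
  assert (GNeq := Gammabar2_near (INR N1) (INR N2) (GN N1 N2) (GN_mnz N1 N2 hN1 hN2) (GN_pos N1 N2 hN1 hN2)).
  assert (ML : forall a, mnz (fun x => C2 (INR N1) (INR N2) x) a).
  { intros a. assert (M : forall b, mnz (Gammabar2 (INR N1) (INR N2)) b).
    { intros b. apply mnz_ext with (1 := GNeq b). apply GN_mnz; assumption. }
    apply (mnz_mult (fun x => Gammabar2 (INR N1) (INR N2) (g x))).
    - apply (mnz_affine _ g _ _ a Hg Hm1). apply M.
    - apply mnz_inv. apply M. }
  assert (Hq := inv_N1N2_neq_0 N1 N2 hN1 hN2).
  set (g2 := fun (k1 k2 : nat) (x : C) => 1 + 1 - cell N1 N2 x k1 k2).
  assert (Hg2 : forall k1 k2 x, g2 k1 k2 x = - / (INR N1 * INR N2) * x +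
     (1 + 1 - (INR N1 * INR k1 + INR N2 * INR k2) / (INR N1 * INR N2))).
  { intros. unfold g2. rewrite cell_affine. ring. }
  assert (Hq2 : - / (INR N1 * INR N2) <> 0).
  { intros E. apply Hq. replace (/ (INR N1 * INR N2)) with (- - / (INR N1 * INR N2)) by ring.
    rewrite E. ring. }
  split; [apply mnz_meromorphic; exact ML|]. split.
  - apply mnz_meromorphic. intros a.
    apply (mnz_Cprod (fun k1 x => Cprod N1 (fun k2 => Cpowz (C2 1 1 (cell N1 N2 x k1 k2)) (esgn (k1 + k2))))).
    intros k1. apply (mnz_Cprod (fun k2 x => Cpowz (C2 1 1 (cell N1 N2 x k1 k2)) (esgn (k1 + k2)))).
    intros k2. apply (mnz_Cpowz_esgn (fun x => C2 1 1 (cell N1 N2 x k1 k2))).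
    assert (M : forall b, mnz (Gammabar2 1 1) b).
    { intros b. apply mnz_ext with (1 := G11_Gammabar2 b). apply G11_mnz. }
    apply (mnz_mult (fun x => Gammabar2 1 1 (g2 k1 k2 x))).
    + apply (mnz_affine _ (g2 k1 k2) _ _ a (Hg2 k1 k2) Hq2). apply M.
    + apply (mnz_inv (fun x => Gammabar2 1 1 (cell N1 N2 x k1 k2))).
      apply (mnz_affine _ (fun x => cell N1 N2 x k1 k2) _ _ a (cell_affine N1 N2 k1 k2) Hq). apply M.
  - intros a.
    (* Numerator and denominator of [C2] evaluate [Gammabar2] at different points, so its
       exceptional set has to be avoided near both [a] and its reflection g a. *)
    assert (L1 := near'_and _ _ _ (GNeq a) (near'_affine g _ _ a _ Hg Hm1 (GNeq (g a)))).
    (* The same for both arguments in each of the finitely many cells, pulled back to [a] along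
       injective affine maps. *)
    assert (L2 : near' a (fun z => forall k1, (k1 < N2)%nat -> forall k2, (k2 < N1)%nat ->
       G11 (cell N1 N2 z k1 k2) = Gammabar2 1 1 (cell N1 N2 z k1 k2) /\
       G11 (g2 k1 k2 z) = Gammabar2 1 1 (g2 k1 k2 z))).
    { apply near'_forall_lt. intros k1. apply near'_forall_lt. intros k2. apply near'_and.
      - apply (near'_affine (fun x => cell N1 N2 x k1 k2) _ _ a
          (fun z => G11 z = Gammabar2 1 1 z) (cell_affine N1 N2 k1 k2) Hq).
        apply G11_Gammabar2.
      - apply (near'_affine (g2 k1 k2) _ _ a (fun z => G11 z = Gammabar2 1 1 z) (Hg2 k1 k2) Hq2).
        apply G11_Gammabar2. }
    apply near'_imp with (2 := near'_and _ _ _ L1 L2). intros z [[E1 E2] E3].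
    unfold C2 at 1. fold (g z). rewrite <- E1, <- E2. unfold g. rewrite GN_reflect by assumption.
    apply Cprod_ext. intros k1 H1. apply Cprod_ext. intros k2 H2.
    destruct (E3 k1 H1 k2 H2) as [E4 E5]. unfold g2 in E5.
    fold (cell N1 N2 z k1 k2). unfold C2. rewrite E4, E5. reflexivity.
Qed.
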